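(* Let $c\in\{1,-1\}$ and let $\mathbb{M}^3_c\subset\mathbb{R}^4_q$ denote the De Sitter space $\mathbb{S}^3_1\subset\mathbb{R}^4_1$ (if $c=1$, $q=1$) or the anti De Sitter space $\mathbb{H}^3_1\subset\mathbb{R}^4_2$ (if $c=-1$, $q=2$). Let $\psi:M_s^2\to\mathbb{M}^3_c\subset\mathbb{R}^4_q$ be an orientable surface of $L_1$-$2$-type. Then the following conditions are equivalent to each other: (1) $M_s^2$ has a constant principal curvature. (2) The mean curvature $H$ is constant. (3) The second mean curvature $H_2$ is constant.
   Context: Ambient spaces. For $c=\pm1$, equip $\mathbb{R}^4_q$ (with $q=1$ if $c=1$, $q=2$ if $c=-1$) with the flat metric $\langle\cdot,\cdot\rangle=-dx_1^2+c\,dx_2^2+dx_3^2+dx_4^2$, and set $\mathbb{M}^3_c=\{x\in\mathbb{R}^4_q:\langle x,x\rangle=c\}$. It is a Lorentzian manifold of constant sectional curvature $c$; $\mathbb{M}^3_1=\mathbb{S}^3_1$ is the De Sitter space and $\mathbb{M}^3_{-1}=\mathbb{H}^3_1$ is the anti De Sitter space. Surfaces. $\psi:M_s^2\to\mathbb{M}^3_c\subset\mathbb{R}^4_q$ is an isometric immersion of an orientable surface whose induced metric is non-degenerate: Riemannian if $s=0$, Lorentzian if $s=1$. $N$ is a unit normal vector field to $M_s^2$ in $\mathbb{M}^3_c$, with $\langle N,N\rangle=\varepsilon=\pm1$. The shape operator is $SX=-\nabla^0_XN$ for tangent $X$, where $\nabla^0$ is the flat connection of $\mathbb{R}^4_q$.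 The operator $S$ is self-adjoint with respect to the induced metric, but when $s=1$ it need not be diagonalizable. If a nowhere zero tangent vector field $X$ satisfies $SX=\lambda X$ for a differentiable function $\lambda$, then $X$ is called a principal direction and $\lambda$ its associated principal curvature (so principal curvatures are real). The mean curvature is $H=\frac{\varepsilon}{2}\operatorname{tr}(S)$ and the second mean curvature is $H_2=\det(S)$. Operator $L_1$. The Newton transformation is $P_1=-2\varepsilon H\,I+S$ (equivalently $P_1=S-\operatorname{tr}(S)I$). For $f\in C^\infty(M_s^2)$, $L_1(f)=\operatorname{tr}(P_1\circ\nabla^2f)$, where $\nabla^2 f(X)=\nabla_X(\nabla f)$ with $\nabla f$ the gradient and $\nabla$ the Levi-Civita connection of $M_s^2$. $L_1$ acts componentwise on $\mathbb{R}^4_q$-valued functions. $L_1$-$2$-type. The surface is of $L_1$-$2$-type if its position vector can be written as $\psi=a+\psi_1+\psi_2$ with $L_1\psi_1=\lambda_1\psi_1$, $L_1\psi_2=\lambda_2\psi_2$, where $\lambda_1\neq\lambda_2$ are real numbers, $a\in\mathbb{R}^4_q$ is a constant vector, and $\psi_1,\psi_2$ are non-constant differentiable $\mathbb{R}^4_q$-valued functions on $M_s^2$. *)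

(* Defs.v *)
From HB Require Import structures.
From mathcomp Require Import all_boot all_order all_algebra.
From mathcomp Require Import all_classical all_reals all_analysis.

Set Implicit Arguments.
Unset Strict Implicit.
Unset Printing Implicit Defensive.

Import Order.TTheory GRing.Theory Num.Theory.
Import numFieldNormedType.Exports.

Local Open Scope classical_set_scope.
Local Open Scope ring_scope.

Definition partial (R : realType) (V : normedModType R) (i : 'I_2)
    (f : 'rV[R]_2 -> V) (u : 'rV[R]_2) : V :=
  'D_(delta_mx 0 i) f u.

(* C^n functions on a set U of the plane; only used for open U. *)
Fixpoint Cn_on (R : realType) (V : normedModType R) (n : nat)
    (U : set 'rV[R]_2) (f : 'rV[R]_2 -> V) : Prop :=
  if n is n'.+1 then
    (forall u, U u -> differentiable f u) /\
    (forall i, Cn_on n' U (partial i f))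
  else forall u, U u -> {for u, continuous f}.

Definition smooth_on (R : realType) (V : normedModType R)
    (U : set 'rV[R]_2) (f : 'rV[R]_2 -> V) : Prop :=
  forall n, Cn_on n U f.

(* A homeomorphism from an open set of M onto an open set of the plane;
   the values of cmap outside cdom, and of cinv outside cimg, are junk. *)
Record chart (R : realType) (M : topologicalType) := Chart {
  cdom : set M;
  cimg : set 'rV[R]_2;
  cmap : M -> 'rV[R]_2;
  cinv : 'rV[R]_2 -> M;
  open_cdom : open cdom;
  open_cimg : open cimg;
  cmap_cimg : forall p, cdom p -> cimg (cmap p);
  cinv_cdom : forall u, cimg u -> cdom (cinv u);
  cmapK : forall p, cdom p -> cinv (cmap p) = p;
  cinvK : forall u, cimg u -> cmap (cinv u) = u;
  continuous_cmap : forall p, cdom p -> {for p, continuous cmap};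
  continuous_cinv : forall u, cimg u -> {for u, continuous cinv}
}.

Section Surface.
Context (R : realType) (M : topologicalType).
Implicit Types (phi chi : chart R M) (A B : set (chart R M)).

Definition overlap phi chi : set 'rV[R]_2 :=
  [set u | cimg phi u /\ cdom chi (cinv phi u)].

Definition transition phi chi : 'rV[R]_2 -> 'rV[R]_2 :=
  cmap chi \o cinv phi.

Definition compatible A B : Prop :=
  forall phi chi, A phi -> B chi ->
    smooth_on (overlap phi chi) (transition phi chi) /\
    smooth_on (overlap chi phi) (transition chi phi).

Definition atlas A : Prop :=
  (forall p, exists2 phi, A phi & cdom phi p) /\ compatible A A.

Definition smooth_surface A : Prop :=
  [/\ hausdorff_space M, @second_countable M, connected [set: M] & atlas A].

Definition orientable A : Prop :=
  exists B, [/\ atlas B, compatible A B &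
    forall phi chi, B phi -> B chi -> forall u, overlap phi chi u ->
      0 < \det ('J (transition phi chi) u)].

Definition smooth (V : normedModType R) A (f : M -> V) : Prop :=
  forall phi, A phi -> smooth_on (cimg phi) (f \o cinv phi).

End Surface.

(* The flat metric -dx1^2 + c dx2^2 + dx3^2 + dx4^2 on R^4. *)
Definition eta (R : realType) (c : R) : 'M[R]_4 :=
  diag_mx (\row_(i < 4) [:: -1; c; 1; 1]`_i).

Definition ip (R : realType) (c : R) (x y : 'rV[R]_4) : R :=
  (x *m eta c *m y^T) 0 0.

Definition Mc (R : realType) (c : R) : set 'rV[R]_4 :=
  [set x | ip c x x = c].

(* Geometry of a parametrized surface x : U -> R^4 with unit normal n.
   Tangent vectors at u are given by their row of coordinates in the basis
   (d_1 x, d_2 x), i.e. v : 'rV_2 stands for v *m 'J x u, and endomorphisms of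
   the tangent plane are matrices acting on the right of these rows. *)
Section Local.
Context (R : realType) (c eps : R) (x n : 'rV[R]_2 -> 'rV[R]_4).
Implicit Types (f : 'rV[R]_2 -> R) (u : 'rV[R]_2).

Definition first_form u : 'M[R]_2 := 'J x u *m eta c *m ('J x u)^T.

(* S X = - nabla^0_X n: the rows of -'J n u, which are tangent since n is a
   unit normal field, expressed in the basis of the rows of 'J x u. *)
Definition shape u : 'M[R]_2 := (- 'J n u) *m pinvmx ('J x u).

Definition mean_curv u : R := eps / 2 * \tr (shape u).

Definition second_mean_curv u : R := \det (shape u).

Definition newton1 u : 'M[R]_2 := (- 2 * eps * mean_curv u)%:M + shape u.

Definition christoffel (k l i : 'I_2) u : R :=
  2^-1 * \sum_(m < 2) invmx (first_form u) i m *
    (partial k (fun v => first_form v l m) u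
     + partial l (fun v => first_form v k m) u
     - partial m (fun v => first_form v k l) u).

Definition grad f u : 'rV[R]_2 :=
  \row_(i < 2) \sum_(j < 2) invmx (first_form u) i j * partial j f u.

(* Row k is nabla_{d_k x} (grad f), for the Levi-Civita connection. *)
Definition hess f u : 'M[R]_2 :=
  \matrix_(k < 2, i < 2) (partial k (fun v => grad f v 0 i) u
    + \sum_(l < 2) christoffel k l i u * grad f u 0 l).

Definition L1 f u : R := \tr (hess f u *m newton1 u).

End Local.

Section Immersed.
Context (R : realType) (M : topologicalType).
Variables (A : set (chart R M)) (c eps : R) (psi N : M -> 'rV[R]_4).

(* By Sylvester's law: G is non-degenerate with s negative squares. *)
Definition has_index (s : nat) (G : 'M[R]_2) : Prop :=
  exists2 P : 'M[R]_2, P \in unitmx &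
    P *m G *m P^T = diag_mx (\row_(i < 2) if (i < s)%N then -1 else 1).

Definition immersed_in_Mc (s : nat) : Prop :=
  [/\ smooth A psi, forall p, Mc c (psi p) &
    forall phi u, A phi -> cimg phi u ->
      row_free ('J (psi \o cinv phi) u) /\
      has_index s (first_form c (psi \o cinv phi) u)].

(* The tangent space of Mc at x is the orthogonal of x. *)
Definition unit_normal : Prop :=
  [/\ smooth A N, forall p, ip c (N p) (N p) = eps,
    forall p, ip c (N p) (psi p) = 0 &
    forall phi u, A phi -> cimg phi u -> forall v : 'rV[R]_2,
      ip c (N (cinv phi u)) (v *m 'J (psi \o cinv phi) u) = 0].

(* Tangent vectors are seen as vectors of R^4 through the differential of psi;
   v is the row of coordinates of X at the given point. *)
Definition principal_direction (X : M -> 'rV[R]_4) (lambda : M -> R) : Prop :=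
  [/\ smooth A X, smooth A lambda, forall p, X p != 0 &
    forall phi p, A phi -> cdom phi p ->
      let x := psi \o cinv phi in
      let n := N \o cinv phi in
      let u := cmap phi p in
      exists2 v : 'rV[R]_2, X p = v *m 'J x u &
        v *m shape x n u *m 'J x u = lambda p *: X p].

Definition has_constant_principal_curvature : Prop :=
  exists (X : M -> 'rV[R]_4) (k : R), principal_direction X (fun=> k).

(* tr S, det S and L1 do not depend on the chart; an identity about them is
   required to hold in every chart around the point. *)
Definition constant_mean_curvature : Prop :=
  exists h : R, forall phi p, A phi -> cdom phi p ->
    mean_curv eps (psi \o cinv phi) (N \o cinv phi) (cmap phi p) = h.

Definition constant_second_mean_curvature : Prop :=
  exists h : R, forall phi p, A phi -> cdom phi p ->
    second_mean_curv (psi \o cinv phi) (N \o cinv phi) (cmap phi p) = h.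

(* L1 F = lambda F, componentwise. *)
Definition L1_eigen (lambda : R) (F : M -> 'rV[R]_4) : Prop :=
  forall phi p, A phi -> cdom phi p -> forall j : 'I_4,
    L1 c eps (psi \o cinv phi) (N \o cinv phi)
       (fun u => F (cinv phi u) 0 j) (cmap phi p)
    = lambda * F p 0 j.

Definition L1_2_type : Prop :=
  exists (a : 'rV[R]_4) (psi1 psi2 : M -> 'rV[R]_4) (lambda1 lambda2 : R),
    [/\ lambda1 != lambda2,
      smooth A psi1 /\ smooth A psi2,
      ~ (exists v, forall p, psi1 p = v) /\ ~ (exists v, forall p, psi2 p = v),
      L1_eigen lambda1 psi1 /\ L1_eigen lambda2 psi2 &
      forall p, psi p = a + psi1 p + psi2 p].

End Immersed.

(* Main.v *)
Require Import Defs.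
From HB Require Import structures.
From mathcomp Require Import all_boot all_order all_algebra.
From mathcomp Require Import all_classical all_reals all_analysis.
From mathcomp Require Import ring lra.

Set Implicit Arguments.
Unset Strict Implicit.
Unset Printing Implicit Defensive.

Import Order.TTheory GRing.Theory Num.Theory.
Import numFieldNormedType.Exports.

Local Open Scope classical_set_scope.
Local Open Scope ring_scope.

(** In a chart the surface is described by its two fundamental forms g and b. The
    Gauss, Weingarten and Codazzi equations give
      L1 psi = -2 eps H_2 N + c tr(S) psi,
    and similar formulas for L1 N and for L1 of products ([LL_x], [LL_n_xr],
    [LL_n_n], [LL_n_x], [LL_mul]). If psi = a + psi_1 + psi_2 is of two-type, then
      L1 (L1 psi) = (l1 + l2) L1 psi - l1 l2 (psi - a),
    whose tangential part and components along N and psi are three equations for tr S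
    and det S ([two_type_tangent], [two_type_normal], [two_type_position]).

    If tr S is constant they give h dh = 0 for h = det S ([const_t_h]). If det S is
    constant, or if S has a constant eigenvalue, they produce a nonzero polynomial p
    with p(tr S) d(tr S) = 0 ([const_h_t], [const_eigenvalue_t]): the differential of
    tr S is an eigenvector of S with an eigenvalue that is rational in tr S, and the
    characteristic equation of S is then a polynomial equation for tr S. On a
    connected surface such relations force the function to be constant
    ([constant_of_gradient]). This proves that a constant principal curvature makes H
    constant, and that H is constant if and only if H_2 is.

    Conversely let tr S and det S be constant, and let D = tr(S)^2 - 4 det S. What has
    to be found is a nowhere zero principal field on the whole surface, which need not
    be simply connected.

    If D is not zero, the second fundamental form is parallel and the surface is flat
    ([Db_eq0], [gauss_flat]); the two-type equations then give D = l1^2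
    ([discr_square]), so that the principal curvatures k1, k2 are real and distinct.
    The focal map N + k2 psi runs along a plane curve, the same on the whole surface,
    whose velocity is a k1-principal direction ([theta_const], [theta_focal]). Turning
    the value of the focal map by a right angle in that plane gives a global principal
    field ([distinct_curvatures_principal]).

    If D = 0 and the metric is definite, then S is a multiple k of the identity and
    N + k psi is constant, so that L1 psi = al psi + be with a number al and a constant
    vector be; a two-type psi cannot satisfy this ([two_type_not_umbilic]).

    If D = 0 and the metric is Lorentzian, then there are two global null tangent
    fields P and Q ([null_fields_exist]) and at each point at least one of them is
    principal. Which one may change along the surface. In null coordinates the second
    fundamental form on P is a function of one coordinate and that on Q a function of
    the other one, and their product is zero; hence around each point P or Q is
    principal on a whole neighbourhood ([null_coordinate], [separate_product_zero],
    [null_alternative]). A smooth function that is 0 where P is not principal and 1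
    where Q is not principal ([smooth_separation]) interpolates between Q and P by a
    nowhere zero principal field ([lorentzian_double_curvature]). *)

(** * Functions of class C^n on open sets of the plane *)

Section NearEq.
Context {R : numFieldType} {V W : normedModType R}.
Implicit Types f g : V -> W.

Lemma near_eq_differentiable f g x :
  {near x, f =1 g} -> differentiable f x -> differentiable g x.
Proof.
move=> fg df.
pose k : V -> W := g - f.
have k0 : \forall h \near (0 : V), k (h + x) = 0.
  have : \forall y \near x, k y = 0.
    by near=> y; rewrite /k !fctE (near fg y) ?subrr.
  by rewrite (near_shift 0); apply: filterS => h /=; rewrite subr0.
have dk : continuous (0 : V -> W) /\ k \o shift x = cst (k x) + (0 : V -> W) +o_ 0 id.
  split; first by move=> y; exact: cvg_cst.
  apply/eqaddoP => e e0; near=> h.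
  rewrite -[X in `|X| <= _]/(k (h + x) - (k x + 0)) (near k0 h)//.
  by rewrite /k !fctE (nbhs_singleton fg) subrr addr0 subr0 normr0 mulr_ge0// ltW.
have -> : g = f + k by apply/funext => y; rewrite /k !fctE addrC subrK.
apply: differentiableD => //.
by apply/diff_locallyP; rewrite (diff_unique dk.1 dk.2).
Unshelve. all: by end_near. Qed.

End NearEq.

Section Calculus.
Context {R : realType}.

Lemma continuous_rV (T : topologicalType) m (F : T -> 'rV[R]_m) u :
  (forall j, {for u, continuous (fun v => F v 0 j)}) -> {for u, continuous F}.
Proof.
move=> cF; change (F @ u --> F u); apply/(@cvg_ballP _ _ _ (nbhs u)) => e e0.
have : forall j, \forall v \near u, ball (F u 0 j) e (F v 0 j).
  by move=> j; have /cvg_ballP := cF j; exact.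
move=> /filter_forall; apply: filterS => v H; split=> // i j.
by rewrite !ord1; exact: H.
Qed.

Local Notation E := 'rV[R]_2.
Implicit Types (U : set E).

Lemma partialE (V : normedModType R) i (f : E -> V) u :
  differentiable f u -> partial i f u = 'd f u (delta_mx 0 i).
Proof. by move=> df; rewrite /partial deriveE. Qed.

Lemma partial_ext (V : normedModType R) U i (f g : E -> V) u :
  open U -> (forall v, U v -> f v = g v) -> U u -> partial i f u = partial i g u.
Proof.
move=> oU fg Uu; apply: near_eq_derive.
by apply: filterS (open_nbhs_nbhs (conj oU Uu)) => v; exact: fg.
Qed.

Lemma Cn_ext (V : normedModType R) n U (f g : E -> V) :
  open U -> (forall u, U u -> f u = g u) -> Cn_on n U f -> Cn_on n U g.
Proof.
move=> oU; elim: n f g => [|n IHn] f g fg /=.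
  move=> cf u Uu; have nU : \forall v \near u, f v = g v.
    by apply: filterS (open_nbhs_nbhs (conj oU Uu)) => v; exact: fg.
  change (g @ u --> g u); rewrite -(fg _ Uu); apply: cvg_trans (cf _ Uu).
  exact: (near_eq_cvg nU).
move=> [df pf]; split=> [u Uu|i].
  apply: near_eq_differentiable (df _ Uu).
  by apply: filterS (open_nbhs_nbhs (conj oU Uu)) => v; exact: fg.
by apply: IHn (pf i) => u Uu; exact: (partial_ext _ oU).
Qed.

Lemma CnS (V : normedModType R) n U (f : E -> V) : Cn_on n.+1 U f -> Cn_on n U f.
Proof.
elim: n f => [|n IHn] f [df pf].
  by move=> u Uu; apply: differentiable_continuous; exact: df.
by split=> // i; apply: IHn; exact: pf.
Qed.

Lemma Cn_sub (V : normedModType R) n U U' (f : E -> V) :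
  U' `<=` U -> Cn_on n U f -> Cn_on n U' f.
Proof.
move=> sU; elim: n f => [|n IHn] f; first by move=> cf u /sU; exact: cf.
by move=> [df pf]; split=> [u /sU|i]; [exact: df|exact: IHn (pf i)].
Qed.

Lemma Cn_cst (V : normedModType R) n U (a : V) : Cn_on n U (cst a : E -> V).
Proof.
elim: n a => [|n IHn] a; first by move=> u _; exact: cst_continuous.
split=> [u _|i]; first exact: differentiable_cst.
have -> : partial i (cst a) = cst (0 : V) :> (E -> V).
  by apply/funext => u; rewrite /partial derive_cst.
exact: IHn.
Qed.

Lemma CnD (V : normedModType R) n U (f g : E -> V) : open U ->
  Cn_on n U f -> Cn_on n U g -> Cn_on n U (f + g).
Proof.
move=> oU; elim: n f g => [|n IHn] f g.
  by move=> cf cg u Uu; exact: (cvgD (cf u Uu) (cg u Uu)).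
move=> [df pf] [dg pg]; split=> [u Uu|i].
  by apply: differentiableD; [exact: df|exact: dg].
apply: Cn_ext (IHn _ _ (pf i) (pg i)) => // u Uu.
by rewrite /partial deriveD//; apply: diff_derivable; [exact: df|exact: dg].
Qed.

Lemma CnM n U (f g : E -> R) : open U ->
  Cn_on n U f -> Cn_on n U g -> Cn_on n U (f * g).
Proof.
move=> oU; elim: n f g => [|n IHn] f g.
  by move=> cf cg u Uu; exact: (cvgM (cf u Uu) (cg u Uu)).
move=> cf cg; have [df pf] := cf; have [dg pg] := cg; split=> [u Uu|i].
  by apply: differentiableM; [exact: df|exact: dg].
apply: Cn_ext (CnD oU (IHn _ _ (CnS cf) (pg i)) (IHn _ _ (CnS cg) (pf i))) => // u Uu.
by rewrite /partial deriveM//; apply: diff_derivable; [exact: df|exact: dg].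
Qed.

Lemma CnV n U (f : E -> R) : open U -> (forall u, U u -> f u != 0) ->
  Cn_on n U f -> Cn_on n U (fun u => (f u)^-1).
Proof.
move=> oU f0; elim: n f f0 => [|n IHn] f f0.
  by move=> cf u Uu; exact: (cvgV (f0 u Uu) (cf u Uu)).
move=> cf; have [df pf] := cf; split=> [u Uu|i].
  by apply: differentiableV; [exact: df|exact: f0].
have iV := IHn _ f0 (CnS cf).
have := CnM oU (Cn_cst n U (-1 : R)) (CnM oU (pf i) (CnM oU iV iV)).
apply: Cn_ext => // u Uu.
rewrite /partial deriveV ?f0//; last by apply: diff_derivable; exact: df.
rewrite /GRing.scale/= /cst !fctE; field; exact: f0.
Qed.

Lemma Cn_mx m n U (F : E -> 'rV[R]_m) : open U ->
  Cn_on n U F <-> forall j, Cn_on n U (fun u => F u 0 j).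
Proof.
move=> oU; elim: n F => [|n IHn] F.
  split=> [cF j u Uu|cF u Uu].
    apply: (@continuous_comp _ _ _ F (fun M : 'rV[R]_m => M 0 j)); first exact: cF.
    exact: coord_continuous.
  by apply: continuous_rV => j; exact: cF.
have pE i j u : differentiable F u -> partial i (fun v => F v 0 j) u = partial i F u 0 j.
  by move=> dF; rewrite /partial derive_mx ?mxE//; exact: diff_derivable.
split.
  move=> [dF pF] j; split=> [u Uu|i].
    apply: (@differentiable_comp _ _ _ _ F (fun M : 'rV[R]_m => M 0 j)); first exact: dF.
    exact: differentiable_coord.
  apply: Cn_ext (proj1 (IHn _) (pF i) j) => // u Uu.
  by rewrite pE//; exact: dF.
move=> H.
have dF u : U u -> differentiable F u.
  move=> Uu.
  have -> : F = \sum_(j < m) (fun v => F v 0 j *: delta_mx 0 j).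
    apply/funext => v; rewrite fct_sumE {1}(matrix_sum_delta (F v)) big_ord1.
    by apply: eq_bigr.
  apply: differentiable_sum => j.
  by apply: differentiableZl; exact: (H j).1.
split=> // i; apply/IHn => j.
by apply: Cn_ext ((H j).2 i) => // u Uu; rewrite pE//; exact: dF.
Qed.

End Calculus.

(** The two directions of the plane, as constants that do not unfold. *)
Definition i0 : 'I_2 := ord0.
Definition i1 : 'I_2 := ord_max.

Section Calculus2.
Context {R : realType}.
Local Notation E := 'rV[R]_2.
Implicit Types (U : set E).

Lemma sum2 (V : nmodType) (F : 'I_2 -> V) : \sum_(i < 2) F i = F i0 + F i1.
Proof. by rewrite big_ord_recl big_ord1; congr (_ + F _); apply/val_inj. Qed.

Lemma diff_partial (V : normedModType R) (f : E -> V) u v :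
  differentiable f u -> 'd f u v = \sum_(i < 2) v 0 i *: partial i f u.
Proof.
move=> df; rewrite {1}(matrix_sum_delta v) big_ord1 linear_sum.
by apply: eq_bigr => i _; rewrite linearZ partialE.
Qed.

Lemma line_derive (V : normedModType R) (f : E -> V) p v s :
  differentiable f (p + s *: v) ->
  is_derive s 1 (fun t : R => f (p + t *: v)) ('d f (p + s *: v) v).
Proof.
move=> df.
have dl : is_diff s (fun t : R => p + t *: v) (fun t : R => t *: v).
  have := is_diffD (is_diff_cst p s) (is_diff_scalel s v).
  by rewrite add0r.
have [dl1 dl2] := dl.
have dfl : differentiable (f \o (fun t : R => p + t *: v)) s.
  exact: differentiable_comp.
have E1 : 'D_1 (fun t : R => f (p + t *: v)) s = 'd f (p + s *: v) v.
  rewrite (deriveE _ dfl) diff_comp//=.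
  by rewrite dl2 scale1r.
rewrite -E1; apply: DeriveDef => //.
exact: diff_derivable.
Qed.

Lemma zero_partials_ball (f : E -> R) u w r :
  (forall v, ball u r v -> differentiable f v) ->
  (forall v i, ball u r v -> partial i f v = 0) ->
  ball u r w -> f w = f u.
Proof.
move=> df pf uw.
have seg (s : R) : 0 <= s <= 1 -> ball u r (u + s *: (w - u)).
  move=> /andP[s0 s1]; rewrite -ball_normE/= opprD addrA subrr add0r normrN normrZ.
  rewrite ger0_norm//; apply: le_lt_trans (_ : `|w - u| < r).
    by rewrite ler_piMl.
  by move: uw; rewrite -ball_normE/= distrC.
have D (s : R) : 0 <= s <= 1 -> is_derive s 1 (fun t : R => f (u + t *: (w - u))) 0.
  move=> s01; have us := seg _ s01.
  have -> : 0 = 'd f (u + s *: (w - u)) (w - u).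
    rewrite diff_partial; last exact: df.
    by rewrite big1// => i _; rewrite pf// scaler0.
  by apply: line_derive; exact: df.
have [s s01] : exists2 c : R, c \in `]0, 1[%R &
   (fun t : R => f (u + t *: (w - u))) 1 - (fun t : R => f (u + t *: (w - u))) 0 = 0 * (1 - 0).
  apply: (@MVT R (fun t : R => f (u + t *: (w - u))) (fun=> 0) 0 1) => //.
    move=> s; rewrite in_itv/= => /andP[/ltW s0 /ltW s1].
    by apply: D; rewrite s0 s1.
  apply: derivable_within_continuous => s; rewrite in_itv/= => s01.
  by have [] := D _ s01.
by rewrite mul0r scale1r scale0r addr0 [u + (w - u)]addrC subrK => /eqP; rewrite subr_eq0 => /eqP.
Qed.

Lemma Cn_comp n U U' (f : E -> R) (T : E -> E) :
  open U -> (forall u, U u -> U' (T u)) ->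
  Cn_on n U' f -> Cn_on n U T -> Cn_on n U (f \o T).
Proof.
move=> oU TU; elim: n f => [|n IHn] f.
  move=> cf cT u Uu; apply: continuous_comp; first exact: cT.
  by apply: cf; exact: TU.
move=> cf cT; have [df pf] := cf; have [dT pT] := cT; split=> [u Uu|i].
  by apply: differentiable_comp; [exact: dT|exact: df (TU _ Uu)].
have H j : Cn_on n U ((fun u => partial i T u 0 j) * (partial j f \o T)).
  apply: CnM => //; first exact: (proj1 (Cn_mx n _ oU) (pT i) j).
  by apply: IHn; [exact: (pf j)|exact: CnS].
apply: Cn_ext (CnD oU (H i0) (H i1)) => // u Uu.
rewrite partialE; last by apply: differentiable_comp; [exact: dT|exact: df (TU _ Uu)].
rewrite diff_comp; [|exact: dT|exact: df (TU _ Uu)].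
rewrite /= -partialE; last exact: dT.
rewrite diff_partial; last exact: df (TU _ Uu).
by rewrite sum2.
Qed.

Fixpoint C1n n (e : R -> R) : Prop :=
  if n is n'.+1 then (forall x, derivable e x 1) /\ C1n n' (derive1 e) else continuous e.

Lemma Cn_comp1 n U (e : R -> R) (q : E -> R) :
  open U -> C1n n e -> Cn_on n U q -> Cn_on n U (e \o q).
Proof.
move=> oU; elim: n e => [|n IHn] e.
  by move=> ce cq u Uu; apply: continuous_comp; [exact: cq|exact: ce].
move=> ce cq; have [de pe] := ce; have [dq pq] := cq.
have dc u : U u -> differentiable (e \o q) u.
  by move=> Uu; apply: differentiable_comp; [exact: dq|exact/derivable1_diffP].
split=> // i.
have iH := IHn _ pe (CnS cq).
apply: Cn_ext (CnM oU iH (pq i)) => // u Uu.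
rewrite partialE; last exact: dc.
rewrite diff_comp; [|exact: dq|exact/derivable1_diffP].
rewrite /= -partialE; last exact: dq.
by rewrite deriv1E// mulrC.
Qed.

(** The second difference of f over a small square, divided by the area of the
    square, is a value near u of either mixed derivative, by two applications of the
    mean value theorem. *)
Lemma schwarz2 (f : E -> R) U u i j : open U -> Cn_on 2 U f -> U u ->
  partial i (partial j f) u = partial j (partial i f) u.
Proof.
move=> oU [df pf] Uu.
have key k l (e : R) : 0 < e -> exists2 d, 0 < d & forall h, 0 < h < d ->
   exists2 y, `|partial k (partial l f) u - y| < e &
   f (u + h *: delta_mx 0 k + h *: delta_mx 0 l) - f (u + h *: delta_mx 0 k)
    - f (u + h *: delta_mx 0 l) + f u = h * h * y.
  move=> e0.
  have c : {for u, continuous (partial k (partial l f))}.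
    by have [_ /(_ k)] := pf l; exact.
  have /cvgrPdist_lt/(_ _ e0) c1 := c.
  have : \forall v \near u, U v /\ `|partial k (partial l f) u - partial k (partial l f) v| < e.
    by near=> v; split; near: v; [exact: open_nbhs_nbhs|exact: c1].
  move=> /nbhs_ballP[r /= r0 ur].
  exists (r / 2); first by rewrite divr_gt0.
  move=> h /andP[h0 hr].
  have box (a b : R) : 0 <= a <= h -> 0 <= b <= h -> ball u r (u + a *: delta_mx 0 k + b *: delta_mx 0 l).
    move=> /andP[a0 ah] /andP[b0 bh]; rewrite -ball_normE/= distrC -(addrA u) [u + _]addrC addrK.
    apply: le_lt_trans (ler_normD _ _) _; rewrite !normrZ.
    have dn m : `|delta_mx 0 m : E| <= 1.
      rewrite [leLHS]/Num.Def.normr/= mx_normrE (bigmax_le _ ler01)//= => -[x y] _.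
      by rewrite mxE; case: (_ && _); rewrite ?normr1 ?normr0.
    rewrite (ger0_norm a0) (ger0_norm b0).
    have := ler_wpM2l a0 (dn k); have := ler_wpM2l b0 (dn l); lra.
  (* the mean value theorem in direction l, for the difference in direction k *)
  pose G (s : R) := f (u + h *: delta_mx 0 k + s *: delta_mx 0 l) - f (u + s *: delta_mx 0 l).
  pose G' (s : R) := partial l f (u + h *: delta_mx 0 k + s *: delta_mx 0 l) - partial l f (u + s *: delta_mx 0 l).
  have hh : 0 <= h <= h by rewrite (ltW h0) lexx.
  have h00 : (0 : R) <= 0 <= h by rewrite lexx (ltW h0).
  have dG (s : R) : 0 <= s <= h -> is_derive s 1 G (G' s).
    move=> s0h; rewrite /G'.
    have b1 := (ur _ (box _ _ hh s0h)).1.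
    have := (ur _ (box _ _ h00 s0h)).1; rewrite scale0r addr0 => b2.
    rewrite !partialE; [|exact: df..].
    by apply: is_deriveB; apply: line_derive; exact: df.
  have [s s0h Gs] : exists2 s, s \in `]0, h[%R & G h - G 0 =
     G' s * (h - 0).
    apply: (@MVT R G G' 0 h); first exact: h0.
      by move=> s; rewrite in_itv/= => /andP[/ltW s0 /ltW s1]; apply: dG; rewrite s0.
    by apply: derivable_within_continuous => s; rewrite in_itv/= => /dG[].
  move: s0h; rewrite in_itv/= => /andP[/ltW s0 /ltW s1].
  have s0h : 0 <= s <= h by rewrite s0.
  pose K (a : R) := partial l f (u + s *: delta_mx 0 l + a *: delta_mx 0 k).
  pose K' (a : R) := partial k (partial l f) (u + s *: delta_mx 0 l + a *: delta_mx 0 k).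
  have dK (a : R) : 0 <= a <= h -> is_derive a 1 K (K' a).
    move=> a0h; rewrite /K'.
    have := (ur _ (box _ _ a0h s0h)).1; rewrite addrAC => b1.
    have [d2 _] := pf l.
    rewrite partialE; last exact: d2.
    by apply: line_derive; exact: d2.
  have [a a0h Ka] : exists2 a, a \in `]0, h[%R & K h - K 0 =
     K' a * (h - 0).
    apply: (@MVT R K K' 0 h); first exact: h0.
      by move=> a; rewrite in_itv/= => /andP[/ltW a0 /ltW a1]; apply: dK; rewrite a0.
    by apply: derivable_within_continuous => a; rewrite in_itv/= => /dK[].
  move: a0h; rewrite in_itv/= => /andP[/ltW a0 /ltW a1].
  have a0h : 0 <= a <= h by rewrite a0.
  exists (partial k (partial l f) (u + s *: delta_mx 0 l + a *: delta_mx 0 k)).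
    by have := (ur _ (box _ _ a0h s0h)).2; rewrite addrAC.
  have E1 : G h - G 0 = f (u + h *: delta_mx 0 k + h *: delta_mx 0 l) - f (u + h *: delta_mx 0 k)
    - f (u + h *: delta_mx 0 l) + f u by rewrite /G !scale0r !addr0; ring.
  rewrite -E1 Gs subr0 /=.
  move: Ka; rewrite /G' /K' /K scale0r addr0 subr0 addrAC => ->; ring.
apply/eqP; rewrite -subr_eq0 -normr_le0; apply/ler_addgt0Pl => e e0; rewrite addr0.
have e20 : 0 < e / 2 by rewrite divr_gt0.
have [d1 d10 H1] := key i j _ e20; have [d2 d20 H2] := key j i _ e20.
pose h := Num.min d1 d2 / 2.
have h0 : 0 < h by rewrite divr_gt0// lt_min d10.
have hm : h < Num.min d1 d2 by rewrite /h ltr_pdivrMr// ltr_pMr ?ltr1n// lt_min d10.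
move: (hm); rewrite lt_min => /andP[hd1 hd2].
have [|y1 y1e E1] := H1 h; first by rewrite h0.
have [|y2 y2e E2] := H2 h; first by rewrite h0.
have y12 : y1 = y2.
  apply: (@mulfI _ (h * h)); first by rewrite mulf_neq0 ?gt_eqF.
  rewrite -E1 -E2 [u + _ + _]addrAC; ring.
rewrite (le_trans (ler_distD y1 _ _))// {2}y12 [leRHS]splitr lerD ?ltW//.
by rewrite distrC.
Unshelve. all: by end_near. Qed.

End Calculus2.

(** * Smooth functions and the flat metric *)

(** Opaque forms of the partial derivative and of the flat metric: two such terms are
    compared through their arguments, never by unfolding limits of difference
    quotients. *)
HB.lock Definition pd (R : realType) (V : normedModType R) (i : 'I_2)
  (f : 'rV[R]_2 -> V) (u : 'rV[R]_2) : V := partial i f u.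
HB.lock Definition dot (R : realType) (c : R) (a b : 'rV[R]_4) : R := ip c a b.

Section Smooth.
Context {R : realType}.
Local Notation E := 'rV[R]_2.
Implicit Types (U : set E) (f g : E -> R).

Lemma pdE (V : normedModType R) i (f : E -> V) : pd i f = partial i f.
Proof. by rewrite unlock. Qed.

Lemma pd_ext (V : normedModType R) U i (f g : E -> V) u :
  open U -> (forall v, U v -> f v = g v) -> U u -> pd i f u = pd i g u.
Proof. by rewrite !pdE; exact: partial_ext. Qed.

Lemma smooth_ext (V : normedModType R) U (f g : E -> V) : open U ->
  (forall u, U u -> f u = g u) -> smooth_on U f -> smooth_on U g.
Proof. by move=> oU fg sf n; apply: Cn_ext (sf n). Qed.

Lemma smooth_sub (V : normedModType R) U U' (f : E -> V) : U' `<=` U ->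
  smooth_on U f -> smooth_on U' f.
Proof. by move=> sU sf n; apply: Cn_sub (sf n). Qed.

Lemma smooth_cst (V : normedModType R) U (a : V) : smooth_on U (fun _ : E => a).
Proof. by move=> n; exact: Cn_cst. Qed.

Lemma smooth_add U f g : open U -> smooth_on U f -> smooth_on U g ->
  smooth_on U (fun u => f u + g u).
Proof. by move=> oU sf sg n; exact: CnD. Qed.

Lemma smooth_mul U f g : open U -> smooth_on U f -> smooth_on U g ->
  smooth_on U (fun u => f u * g u).
Proof. by move=> oU sf sg n; exact: CnM. Qed.

Lemma smooth_opp U f : open U -> smooth_on U f -> smooth_on U (fun u => - f u).
Proof.
move=> oU sf; apply: smooth_ext (smooth_mul oU (smooth_cst U (-1 : R)) sf) => //.
by move=> u _; rewrite mulN1r.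
Qed.

Lemma smooth_subr U f g : open U -> smooth_on U f -> smooth_on U g ->
  smooth_on U (fun u => f u - g u).
Proof. by move=> oU sf sg; apply: smooth_add => //; exact: smooth_opp. Qed.

Lemma smooth_inv U f : open U -> (forall u, U u -> f u != 0) -> smooth_on U f ->
  smooth_on U (fun u => (f u)^-1).
Proof. by move=> oU f0 sf n; exact: CnV. Qed.

Lemma smooth_pd (V : normedModType R) U (f : E -> V) i :
  smooth_on U f -> smooth_on U (pd i f).
Proof. by move=> sf n; rewrite pdE; exact: (sf n.+1).2. Qed.

Lemma smooth_id U : smooth_on U (fun v : E => v).
Proof.
case=> [|n] /=; first by move=> v _; exact: cvg_id.
split=> [v _|i]; first by have [] := is_diff_id v.
have -> : partial i (fun v : E => v) = cst (delta_mx 0 i : E).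
  by apply/funext => v; rewrite /partial derive_id.
exact: Cn_cst.
Qed.

Lemma smooth_coord m U (F : E -> 'rV[R]_m) j : open U ->
  smooth_on U F -> smooth_on U (fun u => F u 0 j).
Proof. by move=> oU sF n; exact: (proj1 (Cn_mx n _ oU)). Qed.

Lemma smooth_rV m U (F : E -> 'rV[R]_m) : open U ->
  (forall j, smooth_on U (fun u => F u 0 j)) -> smooth_on U F.
Proof. by move=> oU sF n; apply/Cn_mx => // j; exact: sF. Qed.

Lemma smooth_differentiable (V : normedModType R) U (f : E -> V) u :
  smooth_on U f -> U u -> differentiable f u.
Proof. by move=> sf; apply: (sf 1%N).1. Qed.

Lemma smooth_continuous (V : normedModType R) U (f : E -> V) u :
  smooth_on U f -> U u -> {for u, continuous f}.
Proof. by move=> sf; apply: (sf 0%N). Qed.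

Lemma smooth_comp U U' f (T : E -> E) : open U ->
  (forall u, U u -> U' (T u)) -> smooth_on U' f -> smooth_on U T ->
  smooth_on U (f \o T).
Proof. by move=> oU TU sf sT n; exact: (Cn_comp oU TU (sf n) (sT n)). Qed.

Lemma schwarz U f u i j : open U -> smooth_on U f -> U u ->
  pd i (pd j f) u = pd j (pd i f) u.
Proof. by move=> oU sf Uu; rewrite !pdE; apply: schwarz2 oU (sf 2%N) Uu. Qed.

Lemma partial_coord m (F : E -> 'rV[R]_m) i j u : differentiable F u ->
  pd i (fun v => F v 0 j) u = pd i F u 0 j.
Proof. by move=> dF; rewrite !pdE /partial derive_mx ?mxE//; exact: diff_derivable. Qed.

Lemma schwarz_rV m U (F : E -> 'rV[R]_m) u i j : open U -> smooth_on U F -> U u ->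
  pd i (pd j F) u = pd j (pd i F) u.
Proof.
move=> oU sF Uu; apply/rowP => k.
have dF l v : U v -> differentiable (pd l F) v.
  by move=> Uv; exact: smooth_differentiable (smooth_pd l sF) Uv.
have dFu : forall v, U v -> differentiable F v by move=> v; exact: smooth_differentiable sF.
have H l l' : pd l (pd l' F) u 0 k = pd l (pd l' (fun v => F v 0 k)) u.
  rewrite -partial_coord; last exact: dF.
  by apply: (pd_ext _ oU) => // v Uv; rewrite partial_coord//; exact: dFu.
apply: etrans (H i j) _; apply: etrans _ (esym (H j i)).
exact: (schwarz i j oU (smooth_coord k oU sF) Uu).
Qed.

(** Bundling differentiability with the value of a derivative lets both
    be read off an expression by structural rules. *)
Definition is_partial i f u d := differentiable f u /\ pd i f u = d.

Lemma is_partial_eq i f u d d' : is_partial i f u d -> d = d' -> is_partial i f u d'.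
Proof. by move=> H <-. Qed.

Lemma is_partial_smooth U i f u : smooth_on U f -> U u -> is_partial i f u (pd i f u).
Proof. by move=> sf Uu; split=> //; exact: smooth_differentiable sf Uu. Qed.

Lemma is_partial_cst i (a : R) u : is_partial i (fun _ : E => a) u 0.
Proof. by split; [exact: differentiable_cst|rewrite pdE; exact: derive_cst]. Qed.

Lemma is_partial_add i f g u df dg : is_partial i f u df -> is_partial i g u dg ->
  is_partial i (fun v => f v + g v) u (df + dg).
Proof.
move=> [f' <-] [g' <-]; split; first exact: differentiableD.
by rewrite !pdE /partial (@deriveD _ _ _ f g)//; exact: diff_derivable.
Qed.

Lemma is_partial_opp i f u df : is_partial i f u df ->
  is_partial i (fun v => - f v) u (- df).
Proof.
move=> [f' <-]; split; first exact: differentiableN.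
by rewrite !pdE /partial (@deriveN _ _ _ f)//; exact: diff_derivable.
Qed.

Lemma is_partial_sub i f g u df dg : is_partial i f u df -> is_partial i g u dg ->
  is_partial i (fun v => f v - g v) u (df - dg).
Proof. by move=> Hf Hg; apply: is_partial_add => //; exact: is_partial_opp. Qed.

Lemma is_partial_mul i f g u df dg : is_partial i f u df -> is_partial i g u dg ->
  is_partial i (fun v => f v * g v) u (df * g u + f u * dg).
Proof.
move=> [f' <-] [g' <-]; split; first exact: differentiableM.
rewrite !pdE /partial (@deriveM _ _ f g); [|exact: diff_derivable..].
by rewrite /GRing.scale/= addrC [g u * _]mulrC.
Qed.

Lemma is_partial_inv i f u df : f u != 0 -> is_partial i f u df ->
  is_partial i (fun v => (f v)^-1) u (- df / (f u * f u)).
Proof.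
move=> fu0 [f' <-]; split; first exact: differentiableV.
rewrite !pdE /partial (@deriveV _ _ f)//; last exact: diff_derivable.
by rewrite /GRing.scale/=; field.
Qed.

Lemma is_partial_unique U i f g u df dg : open U -> U u ->
  (forall v, U v -> f v = g v) -> is_partial i f u df -> is_partial i g u dg -> df = dg.
Proof. by move=> oU Uu fg [_ <-] [_ <-]; exact: (pd_ext _ oU). Qed.

End Smooth.

Section InnerProduct.
Context {R : realType}.
Local Notation E := 'rV[R]_2.
Variable (c : R).
Implicit Types (a b : 'rV[R]_4).

Lemma dotE a b : dot c a b = - (a 0 0 * b 0 0) + c * (a 0 1 * b 0 1)
  + a 0 2%:R * b 0 2%:R + a 0 3%:R * b 0 3%:R.
Proof.
rewrite unlock /ip /Defs.eta mxE !big_ord_recl big_ord0 mul_mx_diag !mxE /=.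
have -> : lift ord0 ord0 = 1 :> 'I_4 by exact/val_inj.
have -> : lift ord0 (lift ord0 ord0) = 2%:R :> 'I_4 by exact/val_inj.
have -> : lift ord0 (lift ord0 (lift ord0 ord0)) = 3%:R :> 'I_4 by exact/val_inj.
rewrite -[ord0]/(0 : 'I_4) /=; ring.
Qed.

Lemma dotC a b : dot c a b = dot c b a.
Proof. by rewrite !dotE; ring. Qed.

Lemma dotDl a b d : dot c (a + b) d = dot c a d + dot c b d.
Proof. by rewrite !dotE !mxE; ring. Qed.

Lemma dotZl k a d : dot c (k *: a) d = k * dot c a d.
Proof. by rewrite !dotE !mxE; ring. Qed.

Lemma dotDr a b d : dot c d (a + b) = dot c d a + dot c d b.
Proof. by rewrite dotC dotDl !(dotC d). Qed.

Lemma dotZr k a d : dot c d (k *: a) = k * dot c d a.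
Proof. by rewrite dotC dotZl (dotC d). Qed.

Lemma dotNl a d : dot c (- a) d = - dot c a d.
Proof. by rewrite -scaleN1r dotZl mulN1r. Qed.

Lemma dotNr a d : dot c d (- a) = - dot c d a.
Proof. by rewrite dotC dotNl dotC. Qed.

Lemma dot0l d : dot c 0 d = 0.
Proof. by rewrite -(scale0r d) dotZl mul0r. Qed.

Lemma dot0r d : dot c d 0 = 0.
Proof. by rewrite dotC dot0l. Qed.

Definition dot_lin := (dotDl, dotDr, dotZl, dotZr, dotNl, dotNr, dot0l, dot0r).

Lemma dot_nondeg a : c != 0 -> (forall b, dot c a b = 0) -> a = 0.
Proof.
move=> c0 H; apply/rowP => j.
have := H (delta_mx 0 j); rewrite dotE !mxE.
case: j => [[|[|[|[|//]]]] lj] /=; rewrite ?(mulr0, mulr1, addr0, add0r, oppr0).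
- by move=> /eqP; rewrite oppr_eq0 => /eqP <-; congr (a 0 _); apply/val_inj.
- move=> /eqP; rewrite mulf_eq0 (negbTE c0) => /eqP <-; congr (a 0 _); exact/val_inj.
- by move=> <-; congr (a 0 _); apply/val_inj.
- by move=> <-; congr (a 0 _); apply/val_inj.
Qed.

Lemma is_partial_coord m U (F : E -> 'rV[R]_m) i j u : smooth_on U F -> U u ->
  is_partial i (fun v => F v 0 j) u (pd i F u 0 j).
Proof.
move=> sF Uu; have dF := smooth_differentiable sF Uu.
split; last exact: partial_coord.
by apply: (@differentiable_comp _ _ _ _ F (fun M : 'rV[R]_m => M 0 j)) => //; exact: differentiable_coord.
Qed.

Lemma is_partial_dot U (F H : E -> 'rV[R]_4) i u : smooth_on U F -> smooth_on U H -> U u ->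
  is_partial i (fun v => dot c (F v) (H v)) u (dot c (pd i F u) (H u) + dot c (F u) (pd i H u)).
Proof.
move=> sF sH Uu.
have -> : (fun v => dot c (F v) (H v)) = (fun v => - (F v 0 0 * H v 0 0) + c * (F v 0 1 * H v 0 1)
  + F v 0 2%:R * H v 0 2%:R + F v 0 3%:R * H v 0 3%:R).
  by apply/funext => v; rewrite dotE.
apply: is_partial_eq.
  have P j := is_partial_coord i j sF Uu; have Q j := is_partial_coord i j sH Uu.
  apply: is_partial_add; last exact: is_partial_mul (P _) (Q _).
  apply: is_partial_add; last exact: is_partial_mul (P _) (Q _).
  apply: is_partial_add; last first.
    by apply: is_partial_mul; [exact: is_partial_cst|exact: is_partial_mul (P _) (Q _)].
  by apply: is_partial_opp; exact: is_partial_mul (P _) (Q _).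
rewrite !dotE; ring.
Qed.

Lemma smooth_dot U (F H : E -> 'rV[R]_4) : open U -> smooth_on U F -> smooth_on U H ->
  smooth_on U (fun v => dot c (F v) (H v)).
Proof.
move=> oU sF sH.
have P j := smooth_coord j oU sF; have Q j := smooth_coord j oU sH.
have M j := smooth_mul oU (P j) (Q j).
apply: smooth_ext (smooth_add oU (smooth_add oU (smooth_add oU (smooth_opp oU (M 0))
  (smooth_mul oU (smooth_cst U c) (M 1))) (M 2%:R)) (M 3%:R)) => // u _.
by rewrite dotE.
Qed.

End InnerProduct.

(** * Surfaces in a chart: the equations of Gauss, Weingarten and Codazzi *)

Lemma ip_mx0 (R : realType) (c : R) (v w : 'rV[R]_4) : v *m Defs.eta c = 0 -> dot c v w = 0.
Proof. by rewrite unlock /ip => ->; rewrite mul0mx mxE. Qed.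

Lemma ip_scalar_mx (R : realType) (c : R) (v w : 'rV[R]_4) :
  v *m Defs.eta c *m w^T = (dot c v w)%:M.
Proof. by rewrite {1}[_ *m _]mx11_scalar unlock. Qed.

#[local] Opaque i0 i1.

(** Proves an equation as a consequence of a combination p' = q' of known ones; the
    second premise is a ring identity. *)
Lemma lincomb (V : zmodType) (p q p' q' : V) : p' = q' -> p - q = p' - q' -> p = q.
Proof. by move=> -> /eqP; rewrite subrr subr_eq0 => /eqP. Qed.

Lemma ord2E (i : 'I_2) : i = i0 \/ i = i1.
Proof. by case: i => [[|[|//]] li]; [left|right]; apply/val_inj. Qed.

Lemma det_mx22 (R : comPzRingType) (A : 'M[R]_2) : \det A = A i0 i0 * A i1 i1 - A i0 i1 * A i1 i0.
Proof.
rewrite (expand_det_row A i0) sum2 /cofactor !det_mx11 !mxE /=.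
rewrite expr0 expr1 mul1r mulN1r mulrN.
by congr (_ * A _ _ - _ * A _ _); apply/val_inj.
Qed.

Lemma gram_col_mx (R : pzRingType) m1 m2 m3 m4 p (A : 'M[R]_(m1, p)) (B : 'M[R]_(m2, p))
    (A' : 'M[R]_(m3, p)) (B' : 'M[R]_(m4, p)) (Q : 'M[R]_p) :
  col_mx A B *m Q *m (col_mx A' B')^T =
  block_mx (A *m Q *m A'^T) (A *m Q *m B'^T) (B *m Q *m A'^T) (B *m Q *m B'^T).
Proof. by rewrite tr_col_mx mul_col_mx mul_col_row. Qed.

Lemma det_block_scalar (R : comPzRingType) (p q r s : R) :
  \det (block_mx p%:M q%:M r%:M s%:M : 'M[R]_(1 + 1)) = p * s - q * r.
Proof.
have E (A : 'M[R]_(1 + 1)) : [/\ A i0 i0 = A (lshift 1 0) (lshift 1 0),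
    A i0 i1 = A (lshift 1 0) (rshift 1 0), A i1 i0 = A (rshift 1 0) (lshift 1 0)
    & A i1 i1 = A (rshift 1 0) (rshift 1 0)].
  by split; congr (A _ _); apply/val_inj.
have [e1 e2 e3 e4] := E (block_mx p%:M q%:M r%:M s%:M).
apply: etrans (det_mx22 _) _; rewrite e1 e2 e3 e4.
by rewrite block_mxEul block_mxEur block_mxEdl block_mxEdr !mxE !mulr1n.
Qed.

Section Patch.
Context {R : realType}.
Local Notation E := 'rV[R]_2.
Implicit Types (c eps : R) (x n : E -> 'rV[R]_4) (f : E -> R) (i j k m : 'I_2).

(** The classical tensors of a parametrized surface x with normal n: first and second
    fundamental forms fg and fb, determinant fG of the metric, Christoffel symbols fC
    of the first kind and gam0, gam1 of the second, rows fS0, fS1 of the coefficients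
    of the shape operator S, its trace ft and determinant fh, covariant Hessian Hs,
    and the operator L1 as the contraction LL of the Hessian with the Newton tensor. *)
Definition fg c x i j u := dot c (pd i x u) (pd j x u).
Definition fb c x n i j u := dot c (pd i (pd j x) u) (n u).
Definition fG c x u := fg c x i0 i0 u * fg c x i1 i1 u - fg c x i0 i1 u * fg c x i0 i1 u.
Definition fC c x k j m u := dot c (pd k (pd j x) u) (pd m x u).
Definition gam0 c x k j u :=
  (fC c x k j i0 u * fg c x i1 i1 u - fC c x k j i1 u * fg c x i0 i1 u) / fG c x u.
Definition gam1 c x k j u :=
  (fC c x k j i1 u * fg c x i0 i0 u - fC c x k j i0 u * fg c x i0 i1 u) / fG c x u.
Definition fS0 c x n k u :=
  (fb c x n k i0 u * fg c x i1 i1 u - fb c x n k i1 u * fg c x i0 i1 u) / fG c x u.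
Definition fS1 c x n k u :=
  (fb c x n k i1 u * fg c x i0 i0 u - fb c x n k i0 u * fg c x i0 i1 u) / fG c x u.
Definition ft c x n u :=
  (fb c x n i1 i1 u * fg c x i0 i0 u - 2 * fb c x n i0 i1 u * fg c x i0 i1 u
   + fb c x n i0 i0 u * fg c x i1 i1 u) / fG c x u.
Definition fh c x n u :=
  (fb c x n i0 i0 u * fb c x n i1 i1 u - fb c x n i0 i1 u * fb c x n i0 i1 u) / fG c x u.
Definition Hs c x k j f u :=
  pd k (pd j f) u - gam0 c x k j u * pd i0 f u - gam1 c x k j u * pd i1 f u.
Definition LL c x n f u :=
  - (fb c x n i1 i1 u * Hs c x i0 i0 f u - 2 * fb c x n i0 i1 u * Hs c x i0 i1 f u
     + fb c x n i0 i0 u * Hs c x i1 i1 f u) / fG c x u.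

(** A chart of a surface of the quadric <x, x> = c, with its unit normal n. *)
Record immersed_patch c eps U x n : Prop := Patch {
  patch_c : c * c = 1;
  patch_eps : eps * eps = 1;
  patch_open : open U;
  patch_x : smooth_on U x;
  patch_n : smooth_on U n;
  patch_xx : forall u, U u -> dot c (x u) (x u) = c;
  patch_nn : forall u, U u -> dot c (n u) (n u) = eps;
  patch_nx : forall u, U u -> dot c (n u) (x u) = 0;
  patch_nt : forall u i, U u -> dot c (n u) (pd i x u) = 0;
  patch_G : forall u, U u -> fG c x u != 0
}.

Section Formulas.
Context {c eps : R} {U : set E} {x n : E -> 'rV[R]_4}.
Hypothesis H : immersed_patch c eps U x n.
Let hc := patch_c H.
Let he := patch_eps H.
Let oU := patch_open H.
Let sx := patch_x H.
Let sn := patch_n H.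
Let xx := patch_xx H.
Let nn := patch_nn H.
Let nx := patch_nx H.
Let nt := patch_nt H.
Let G0 := patch_G H.
Local Notation g := (fg c x).
Local Notation b := (fb c x n).
Local Notation G := (fG c x).
Local Notation C := (fC c x).
Local Notation S0 := (fS0 c x n).
Local Notation S1 := (fS1 c x n).
Local Notation X i := (pd i x).
Local Notation XX i j := (pd i (pd j x)).

Lemma patch_c0 : c != 0.
Proof. by apply: contra_eq_neq hc => ->; rewrite mul0r eq_sym oner_neq0. Qed.

Lemma patch_eps0 : eps != 0.
Proof. by apply: contra_eq_neq he => ->; rewrite mul0r eq_sym oner_neq0. Qed.

Let c0 := patch_c0.
Let e0 := patch_eps0.

Let sX i : smooth_on U (X i). Proof. exact: smooth_pd. Qed.
Let sXX i j : smooth_on U (XX i j). Proof. exact/smooth_pd/smooth_pd. Qed.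
Let sN i : smooth_on U (pd i n). Proof. exact: smooth_pd. Qed.

Lemma fgC i j u : g i j u = g j i u.
Proof. exact: dotC. Qed.

Lemma XXC i j u : U u -> XX i j u = XX j i u.
Proof. by move=> Uu; apply: (schwarz_rV _ _ oU). Qed.

Lemma fbC i j u : U u -> b i j u = b j i u.
Proof. by move=> Uu; rewrite /fb XXC. Qed.

Lemma fCC i j m u : U u -> C i j m u = C j i m u.
Proof. by move=> Uu; rewrite /fC XXC. Qed.

Lemma ip_xi_x i u : U u -> dot c (X i u) (x u) = 0.
Proof.
move=> Uu; have := is_partial_unique oU Uu xx (is_partial_dot c i sx sx Uu) (is_partial_cst i c u).
rewrite [dot c (x u) _]dotC => /eqP; rewrite -mulr2n mulrn_eq0 /= => /eqP; exact.
Qed.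

Lemma ip_n_ni i u : U u -> dot c (n u) (pd i n u) = 0.
Proof.
move=> Uu; have := is_partial_unique oU Uu nn (is_partial_dot c i sn sn Uu) (is_partial_cst i eps u).
rewrite [dot c (pd i n u) _]dotC => /eqP; rewrite -mulr2n mulrn_eq0 /= => /eqP; exact.
Qed.

Lemma ip_ni_x i u : U u -> dot c (pd i n u) (x u) = 0.
Proof.
move=> Uu; have := is_partial_unique oU Uu nx (is_partial_dot c i sn sx Uu) (is_partial_cst i 0 u).
by rewrite nt// addr0.
Qed.

Lemma ip_xij_x i j u : U u -> dot c (XX i j u) (x u) = - g i j u.
Proof.
move=> Uu; have := is_partial_unique oU Uu (ip_xi_x j) (is_partial_dot c i (sX j) sx Uu) (is_partial_cst i 0 u).
by move/eqP; rewrite addr_eq0 => /eqP ->; congr (- _); exact: dotC.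
Qed.

Lemma ip_xi_nj i j u : U u -> dot c (X i u) (pd j n u) = - b i j u.
Proof.
move=> Uu; have := is_partial_unique oU Uu (fun v => @nt v i) (is_partial_dot c j sn (sX i) Uu) (is_partial_cst j 0 u).
by move/eqP; rewrite addr_eq0 dotC => /eqP ->; rewrite -fbC// /fb [in RHS]dotC XXC.
Qed.

Lemma fC_gam k j m u : U u -> C k j m u = gam0 c x k j u * g i0 m u + gam1 c x k j u * g i1 m u.
Proof.
move=> Uu; have := G0 Uu; rewrite /gam0 /gam1 /fG.
by case: (ord2E m) => ->; rewrite ?(fgC i1 i0); move: (C k j _ u) (C k j _ u) (g i0 i0 u) (g i0 i1 u) (g i1 i1 u) => *; field.
Qed.

Lemma fb_S i m u : U u -> b i m u = S0 i u * g i0 m u + S1 i u * g i1 m u.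
Proof.
move=> Uu; have := G0 Uu; rewrite /fS0 /fS1 /fG.
by case: (ord2E m) => ->; rewrite ?(fgC i1 i0); move: (b i _ u) (b i _ u) (g i0 i0 u) (g i0 i1 u) (g i1 i1 u) => *; field.
Qed.

Definition frame u : 'M[R]_4 :=
  (col_mx (col_mx (X i0 u) (X i1 u)) (col_mx (n u) (x u)) : 'M[R]_((1 + 1) + (1 + 1), 4)).

Lemma gram_frame u : U u -> \det (frame u *m Defs.eta c *m (frame u)^T) = G u * (eps * c).
Proof.
move=> Uu; pose F := col_mx (X i0 u) (X i1 u); pose K := col_mx (n u) (x u).
have -> : frame u *m Defs.eta c *m (frame u)^T =
    block_mx (F *m Defs.eta c *m F^T) (F *m Defs.eta c *m K^T) (K *m Defs.eta c *m F^T) (K *m Defs.eta c *m K^T)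
    :> 'M[R]_((1 + 1) + (1 + 1)).
  exact: (gram_col_mx F K F K (Defs.eta c)).
have B (a d a' d' : 'rV[R]_4) : col_mx a d *m Defs.eta c *m (col_mx a' d')^T =
   block_mx (dot c a a')%:M (dot c a d')%:M (dot c d a')%:M (dot c d d')%:M.
  by rewrite gram_col_mx !ip_scalar_mx.
have zero : (0 : 'M[R]_1) = 0%:M by rewrite raddf0.
have -> : F *m Defs.eta c *m K^T = 0.
  rewrite /F /K (B (X i0 u) (X i1 u) (n u) (x u)).
  rewrite (dotC c (X i0 u) (n u)) (dotC c (X i1 u) (n u)).
  rewrite (nt i0 Uu) (nt i1 Uu).
  rewrite (ip_xi_x i0 Uu) (ip_xi_x i1 Uu).
  rewrite raddf0.
  by rewrite block_mx_const.
transitivity (\det (F *m Defs.eta c *m F^T) * \det (K *m Defs.eta c *m K^T)).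
  exact: (det_lblock (F *m Defs.eta c *m F^T) (K *m Defs.eta c *m F^T) (K *m Defs.eta c *m K^T)).
rewrite /F /K !B.
rewrite !det_block_scalar.
rewrite -/(fg c x i0 i0 u) [dot c (X i1 u) (X i0 u)]dotC !(dotC c (x u) (n u)) nx// nn// xx//.
by rewrite mul0r subr0.
Qed.

Lemma det_eta : \det (Defs.eta c) = - c.
Proof.
by rewrite /Defs.eta det_diag !big_ord_recl big_ord0 !mxE /=; ring.
Qed.

(** The position and its unit normal complete the tangent plane to a frame of the
    flat space, so the sign of the induced metric is read off that of the frame. *)
Lemma frame_sign u : U u -> G u * eps = - \det (frame u) ^+ 2.
Proof.
move=> Uu; apply: (mulIf c0); have := gram_frame Uu.
rewrite !det_mulmx det_tr det_eta mulrA => <-; ring.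
Qed.

Lemma frame_unit u : U u -> frame u \in unitmx.
Proof.
move=> Uu; rewrite unitmxE unitfE; apply: contraNneq (mulf_neq0 (G0 Uu) e0) => d0.
by rewrite frame_sign// d0 expr0n oppr0.
Qed.

Lemma frame_ext u (v : 'rV[R]_4) : U u -> dot c v (X i0 u) = 0 -> dot c v (X i1 u) = 0 ->
  dot c v (n u) = 0 -> dot c v (x u) = 0 -> v = 0.
Proof.
move=> Uu v0 v1 vn vx; apply: (dot_nondeg c0) => w.
have E0 : v *m Defs.eta c *m (frame u)^T = 0.
  have Z : v *m Defs.eta c *m (col_mx (col_mx (X i0 u) (X i1 u)) (col_mx (n u) (x u)))^T = 0;
    last exact: Z.
  rewrite !tr_col_mx !mul_mx_row !ip_scalar_mx v0 v1 vn vx.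
  have zero : 0%:M = const_mx 0 :> 'M[R]_1 by rewrite raddf0.
  by rewrite zero !row_mx_const.
have : v *m Defs.eta c = 0.
  apply: (can_inj (mulmxK (_ : (frame u)^T \in unitmx))); first by rewrite unitmx_tr frame_unit.
  by rewrite E0 mul0mx.
exact: ip_mx0.
Qed.

Lemma gauss k j u : U u -> XX k j u = gam0 c x k j u *: X i0 u + gam1 c x k j u *: X i1 u
  + (eps * b k j u) *: n u - (c * g k j u) *: x u.
Proof.
move=> Uu; apply/eqP; rewrite -subr_eq0; apply/eqP; apply: (frame_ext Uu).
- rewrite !dot_lin -/(C k j i0 u) -/(g i0 i0 u) -/(g i1 i0 u) nt// [dot c (x u) _]dotC ip_xi_x//.
  rewrite fC_gam//; ring.
- rewrite !dot_lin -/(C k j i1 u) -/(g i0 i1 u) -/(g i1 i1 u) nt// [dot c (x u) _]dotC ip_xi_x//.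
  rewrite fC_gam//; ring.
- rewrite !dot_lin -/(b k j u) ![dot c (X _ u) (n u)]dotC !nt// nn// [dot c (x u) _]dotC nx//.
  by ring: he.
- rewrite !dot_lin ip_xij_x// !ip_xi_x// nx// xx//.
  by ring: hc.
Qed.

Lemma weingarten k u : U u -> pd k n u = - (S0 k u *: X i0 u + S1 k u *: X i1 u).
Proof.
move=> Uu; apply/eqP; rewrite -subr_eq0; apply/eqP; apply: (frame_ext Uu).
- rewrite !dot_lin [dot c (pd k n u) _]dotC ip_xi_nj// -/(g i0 i0 u) -/(g i1 i0 u).
  by rewrite fbC// fb_S//; ring.
- rewrite !dot_lin [dot c (pd k n u) _]dotC ip_xi_nj// -/(g i0 i1 u) -/(g i1 i1 u).
  by rewrite fbC// fb_S//; ring.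
- by rewrite !dot_lin [dot c (pd k n u) _]dotC ip_n_ni// ![dot c (X _ u) (n u)]dotC !nt//; ring.
- by rewrite !dot_lin ip_ni_x// !ip_xi_x//; ring.
Qed.

Lemma is_partial_g k i j u : U u -> is_partial k (g i j) u (C k i j u + C k j i u).
Proof.
move=> Uu; apply: is_partial_eq (is_partial_dot c k (sX i) (sX j) Uu) _.
by rewrite /fC [in RHS]addrC addrC [dot c (X i u) _]dotC.
Qed.

Lemma ip_nkj_xr k j r u : U u -> dot c (pd k (pd j n) u) (X r u) =
  - pd k (b r j) u + gam0 c x k r u * b j i0 u + gam1 c x k r u * b j i1 u.
Proof.
move=> Uu.
have sb : smooth_on U (b r j) by apply: smooth_dot.
have := is_partial_unique oU Uu (ip_xi_nj r j) (is_partial_dot c k (sX r) (sN j) Uu)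
  (is_partial_opp (is_partial_smooth k sb Uu)).
rewrite gauss// !dot_lin !ip_xi_nj// ip_n_ni// [dot c (x u) _]dotC ip_ni_x//.
rewrite !(fbC _ j)//; rewrite dotC => E1.
by rewrite [in RHS]addrC -E1 [dot c _ (X r u)]dotC; ring.
Qed.

Lemma nijC i j u : U u -> pd i (pd j n) u = pd j (pd i n) u.
Proof. by move=> Uu; apply: (schwarz_rV _ _ oU). Qed.

(** The second derivatives of n commute. *)
Lemma codazzi k j r u : U u ->
  pd k (b r j) u - gam0 c x k r u * b j i0 u - gam1 c x k r u * b j i1 u =
  pd j (b r k) u - gam0 c x j r u * b k i0 u - gam1 c x j r u * b k i1 u.
Proof.
move=> Uu; have := ip_nkj_xr k j r Uu; rewrite nijC// ip_nkj_xr// => E1.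
by apply: oppr_inj; rewrite !opprD !opprK E1.
Qed.

Lemma ip_nkj_n k j u : U u -> dot c (pd k (pd j n) u) (n u) =
  - (S0 j u * b i0 k u + S1 j u * b i1 k u).
Proof.
move=> Uu.
have := is_partial_unique oU Uu (ip_n_ni j) (is_partial_dot c k sn (sN j) Uu) (is_partial_cst k 0 u).
rewrite addrC => /eqP; rewrite addr_eq0 => /eqP E.
rewrite dotC E [dot c (pd k n u) _]dotC (weingarten j Uu) !dot_lin !ip_xi_nj//; ring.
Qed.

Lemma ip_nkj_x k j u : U u -> dot c (pd k (pd j n) u) (x u) = b k j u.
Proof.
move=> Uu.
have := is_partial_unique oU Uu (ip_ni_x j) (is_partial_dot c k (sN j) sx Uu) (is_partial_cst k 0 u).
by move/eqP; rewrite addr_eq0 dotC => /eqP; rewrite dotC => ->; rewrite dotC ip_xi_nj// opprK.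
Qed.

End Formulas.
End Patch.

(** * The operator L1 in coordinates *)

Section PatchOps.
Context {R : realType}.
Local Notation E := 'rV[R]_2.
Context {c eps : R} {U : set E} {x n : E -> 'rV[R]_4}.
Hypothesis H : immersed_patch c eps U x n.
Let oU := patch_open H.
Let sx := patch_x H.
Let sn := patch_n H.
Let G0 := patch_G H.
Local Notation g := (fg c x).
Local Notation b := (fb c x n).
Local Notation G := (fG c x).
Local Notation gam0 := (gam0 c x).
Local Notation gam1 := (gam1 c x).
Local Notation t := (ft c x n).
Local Notation h := (fh c x n).
Local Notation X i := (pd i x).
Implicit Types (f : E -> R) (i j k m r : 'I_2) (a : 'rV[R]_4).

Lemma smooth_g i j : smooth_on U (g i j).
Proof. by apply: smooth_dot => //; exact: smooth_pd. Qed.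

Lemma smooth_b i j : smooth_on U (b i j).
Proof. by apply: smooth_dot => //; do 2 apply: smooth_pd. Qed.

Lemma smooth_G : smooth_on U G.
Proof. by apply: smooth_subr => //; apply: smooth_mul => //; exact: smooth_g. Qed.

Lemma smooth_Ginv : smooth_on U (fun u => (G u)^-1).
Proof. exact: smooth_inv oU (@G0) smooth_G. Qed.

Lemma smooth_t : smooth_on U t.
Proof.
have := smooth_g; have := smooth_b; have := smooth_Ginv => sG sb sg.
apply: smooth_mul => //; apply: smooth_add => //; [apply: smooth_subr => //|];
  repeat apply: smooth_mul => //; exact: smooth_cst.
Qed.

Lemma smooth_h : smooth_on U h.
Proof.
have := smooth_b; have := smooth_Ginv => sG sb.
by apply: smooth_mul => //; apply: smooth_subr => //; apply: smooth_mul.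
Qed.

(** The covariant derivative of the second fundamental form. *)
Definition Db k j r u := pd k (b r j) u - gam0 k r u * b j i0 u - gam1 k r u * b j i1 u
  - gam0 k j u * b r i0 u - gam1 k j u * b r i1 u.

Lemma DbC k j r u : U u -> Db k j r u = Db j k r u.
Proof.
move=> Uu; rewrite /Db (codazzi H k j r Uu).
by rewrite /gam0 /gam1 !(fCC H k j _ Uu).
Qed.

Lemma DbC23 k j r u : U u -> Db k j r u = Db k r j u.
Proof.
move=> Uu; rewrite /Db (pd_ext k oU (fun v => @fbC _ _ _ _ _ _ H r j v) Uu); ring.
Qed.

Lemma gamC k j u : U u -> gam0 k j u = gam0 j k u /\ gam1 k j u = gam1 j k u.
Proof. by move=> Uu; rewrite /gam0 /gam1 !(fCC H k j _ Uu). Qed.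

Lemma is_partial_G k u : U u -> is_partial k G u (2 * G u * (gam0 k i0 u + gam1 k i1 u)).
Proof.
move=> Uu; have P i j := is_partial_g H k i j Uu.
apply: is_partial_eq (is_partial_sub (is_partial_mul (P _ _) (P _ _)) (is_partial_mul (P _ _) (P _ _))) _.
rewrite !(fC_gam H) // !(fgC i1 i0) /fG; ring.
Qed.

Lemma pd_h k u : U u -> G u * pd k h u =
  b i1 i1 u * Db k i0 i0 u - 2 * b i0 i1 u * Db k i0 i1 u + b i0 i0 u * Db k i1 i1 u.
Proof.
move=> Uu; have P i j := is_partial_smooth k (smooth_b i j) Uu.
have E1 : forall v, U v -> h v * G v = b i0 i0 v * b i1 i1 v - b i0 i1 v * b i0 i1 v.
  by move=> v Uv; rewrite /fh divfK// G0.
have := is_partial_unique oU Uu E1 (is_partial_mul (is_partial_smooth k smooth_h Uu) (is_partial_G k Uu))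
  (is_partial_sub (is_partial_mul (P i0 i0) (P i1 i1)) (is_partial_mul (P i0 i1) (P i0 i1))).
have := E1 _ Uu; rewrite /Db !(fbC H i1 i0 Uu) (pd_ext k oU (fun v => @fbC _ _ _ _ _ _ H i1 i0 v) Uu).
move: (pd k h u) (h u) (G u) (b i0 i0 u) (b i0 i1 u) (b i1 i1 u) (pd k _ u) (pd k _ u) (pd k _ u).
move: (gam0 k i0 u) (gam0 k i1 u) (gam1 k i0 u) (gam1 k i1 u).
move=> a1 a2 a3 a4 hk hh GG b0 b1 b2 B0 B1 B2 e1 e2.
by apply: (lincomb (congr2 (fun p q => p - 2 * (a1 + a4) * q) e2 e1)); ring.
Qed.

Lemma pd_t k u : U u -> G u * pd k t u =
  g i1 i1 u * Db k i0 i0 u - 2 * g i0 i1 u * Db k i0 i1 u + g i0 i0 u * Db k i1 i1 u.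
Proof.
move=> Uu; have P i j := is_partial_smooth k (smooth_b i j) Uu.
have Q i j := is_partial_g H k i j Uu.
have E1 : forall v, U v -> t v * G v = b i1 i1 v * g i0 i0 v - 2 * b i0 i1 v * g i0 i1 v + b i0 i0 v * g i1 i1 v.
  by move=> v Uv; rewrite /ft divfK// G0.
have := is_partial_unique oU Uu E1 (is_partial_mul (is_partial_smooth k smooth_t Uu) (is_partial_G k Uu))
  (is_partial_add (is_partial_sub (is_partial_mul (P i1 i1) (Q i0 i0))
     (is_partial_mul (is_partial_mul (is_partial_cst k 2 u) (P i0 i1)) (Q i0 i1)))
   (is_partial_mul (P i0 i0) (Q i1 i1))).
have := E1 _ Uu; rewrite /Db !(fC_gam H)// !(fbC H i1 i0 Uu) !(fgC i1 i0) (pd_ext k oU (fun v => @fbC _ _ _ _ _ _ H i1 i0 v) Uu).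
move: (pd k t u) (t u) (G u) (b i0 i0 u) (b i0 i1 u) (b i1 i1 u) (g i0 i0 u) (g i0 i1 u) (g i1 i1 u) (pd k _ u) (pd k _ u) (pd k _ u).
move: (gam0 k i0 u) (gam0 k i1 u) (gam1 k i0 u) (gam1 k i1 u).
move=> a1 a2 a3 a4 hk hh GG b0 b1 b2 g0 g1 g2 B0 B1 B2 e1 e2.
by apply: (lincomb (congr2 (fun p q => p - 2 * (a1 + a4) * q) e2 e1)); ring.
Qed.

Lemma pd_dotl (F : E -> 'rV[R]_4) a i u : smooth_on U F -> U u ->
  pd i (fun v => dot c (F v) a) u = dot c (pd i F u) a.
Proof.
move=> sF Uu; have [_ ->] := is_partial_dot c i sF (smooth_cst U a) Uu.
have -> : pd i (fun _ : E => a) u = 0 by rewrite pdE /partial derive_cst.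
by rewrite dot_lin addr0.
Qed.

Lemma Hs_dotl (F : E -> 'rV[R]_4) a k j u : smooth_on U F -> U u ->
  Hs c x k j (fun v => dot c (F v) a) u = dot c (pd k (pd j F) u) a
    - gam0 k j u * dot c (pd i0 F u) a - gam1 k j u * dot c (pd i1 F u) a.
Proof.
move=> sF Uu; rewrite /Hs !(pd_dotl _ _ sF Uu) (pd_ext k oU (fun v => pd_dotl a j sF) Uu).
by rewrite (pd_dotl _ _ (smooth_pd j sF) Uu).
Qed.

Lemma LL_ext f f' u : (forall v, U v -> f v = f' v) -> U u -> LL c x n f u = LL c x n f' u.
Proof.
move=> ff Uu; rewrite /LL /Hs.
have e i v : U v -> pd i f v = pd i f' v by move=> Uv; exact: (pd_ext i oU ff Uv).
by rewrite !e// !(pd_ext _ oU (fun v => e _ v) Uu).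
Qed.

Lemma LL_add f f' u : smooth_on U f -> smooth_on U f' -> U u ->
  LL c x n (fun v => f v + f' v) u = LL c x n f u + LL c x n f' u.
Proof.
move=> sf sf' Uu; rewrite /LL /Hs.
have e i v : U v -> pd i (fun v => f v + f' v) v = pd i f v + pd i f' v.
  by move=> Uv; have [] := is_partial_add (is_partial_smooth i sf Uv) (is_partial_smooth i sf' Uv).
have e2 i j : pd i (pd j (fun v => f v + f' v)) u = pd i (pd j f) u + pd i (pd j f') u.
  rewrite (pd_ext i oU (fun v => e j v) Uu).
  by have [] := is_partial_add (is_partial_smooth i (smooth_pd j sf) Uu) (is_partial_smooth i (smooth_pd j sf') Uu).
rewrite !e// !e2; ring.
Qed.

Lemma LL_cst (p : R) u : LL c x n (fun=> p) u = 0.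
Proof.
have e i : pd i (fun _ : E => p) = fun=> 0.
  by apply/funext => v; have [] := is_partial_cst i p v.
rewrite /LL /Hs !e.
have e' i : pd i (fun _ : E => 0) u = 0 :> R by have [] := is_partial_cst i (0 : R) u.
rewrite !e'; ring.
Qed.

(** The polarization of the second-order symbol of L1. *)
Definition cross f f' u := - (b i1 i1 u * (pd i0 f u * pd i0 f' u)
  - b i0 i1 u * (pd i0 f u * pd i1 f' u + pd i1 f u * pd i0 f' u)
  + b i0 i0 u * (pd i1 f u * pd i1 f' u)) / G u.

Lemma LL_mul f f' u : smooth_on U f -> smooth_on U f' -> U u ->
  LL c x n (fun v => f v * f' v) u = f u * LL c x n f' u + f' u * LL c x n f u + 2 * cross f f' u.
Proof.
move=> sf sf' Uu; rewrite /LL /Hs /cross.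
have e i v : U v -> pd i (fun v => f v * f' v) v = pd i f v * f' v + f v * pd i f' v.
  by move=> Uv; have [] := is_partial_mul (is_partial_smooth i sf Uv) (is_partial_smooth i sf' Uv).
have e2 i j : pd i (pd j (fun v => f v * f' v)) u = pd i (pd j f) u * f' u + pd j f u * pd i f' u
    + (pd i f u * pd j f' u + f u * pd i (pd j f') u).
  rewrite (pd_ext i oU (fun v => e j v) Uu).
  by have [] := is_partial_add (is_partial_mul (is_partial_smooth i (smooth_pd j sf) Uu) (is_partial_smooth i sf' Uu))
     (is_partial_mul (is_partial_smooth i sf Uu) (is_partial_smooth i (smooth_pd j sf') Uu)).
rewrite !e// !e2; ring.
Qed.

Lemma LL_scale (p : R) f u : smooth_on U f -> U u -> LL c x n (fun v => p * f v) u = p * LL c x n f u.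
Proof.
move=> sf Uu; rewrite (LL_mul (smooth_cst U p) sf Uu) LL_cst /cross.
have e' i : pd i (fun _ : E => p) u = 0 :> R by have [] := is_partial_cst i p u.
rewrite !e'; ring.
Qed.

Lemma Hs_x a k j u : U u -> Hs c x k j (fun v => dot c (x v) a) u =
  eps * b k j u * dot c (n u) a - c * g k j u * dot c (x u) a.
Proof. by move=> Uu; rewrite Hs_dotl// (gauss H k j Uu) !dot_lin; ring. Qed.

Lemma LL_x a u : U u -> LL c x n (fun v => dot c (x v) a) u =
  - 2 * eps * h u * dot c (n u) a + c * t u * dot c (x u) a.
Proof.
move=> Uu; rewrite /LL !Hs_x// /ft /fh; have := G0 Uu.
move: (G u) (b i0 i0 u) (b i0 i1 u) (b i1 i1 u) (g i0 i0 u) (g i0 i1 u) (g i1 i1 u) (dot c _ a) (dot c _ a) => *.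
by field.
Qed.

(** Only the Codazzi equations enter: contracted with the Newton tensor, the covariant
    derivative of the second fundamental form is the gradient of det S. *)
Lemma LL_n_xr r u : U u -> LL c x n (fun v => dot c (n v) (X r u)) u = pd r h u.
Proof.
move=> Uu; rewrite /LL !Hs_dotl//.
rewrite !(ip_nkj_xr H)// ![dot c (pd _ n u) (X r u)]dotC !(ip_xi_nj H)//.
apply: (mulfI (G0 Uu)); rewrite pd_h//.
rewrite ![Db r _ _ u](DbC r _ _ Uu) ![Db _ r _ u](DbC23 _ r _ Uu) mulrCA divff ?G0// mulr1 /Db; ring.
Qed.

Lemma S_trdet u : U u -> t u = fS0 c x n i0 u + fS1 c x n i1 u /\
  h u = fS0 c x n i0 u * fS1 c x n i1 u - fS1 c x n i0 u * fS0 c x n i1 u.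
Proof.
move=> Uu; have := G0 Uu; rewrite /ft /fh /fS0 /fS1 !(fbC H i1 i0 Uu) /fG.
move: (b i0 i0 u) (b i0 i1 u) (b i1 i1 u) (g i0 i0 u) (g i0 i1 u) (g i1 i1 u) => *.
by split; field.
Qed.

Lemma LL_n_n u : U u -> LL c x n (fun v => dot c (n v) (n u)) u = t u * h u.
Proof.
move=> Uu; rewrite /LL !Hs_dotl// !(ip_nkj_n H)// ![dot c (pd _ n u) (n u)]dotC !(ip_n_ni H)// (fbC H i1 i0 Uu).
rewrite /fS0 /fS1 (fbC H i1 i0 Uu) /ft /fh /fG; have := G0 Uu; rewrite /fG.
move: (b i0 i0 u) (b i0 i1 u) (b i1 i1 u) (g i0 i0 u) (g i0 i1 u) (g i1 i1 u) (gam0 _ _ u) (gam0 _ _ u) (gam0 _ _ u) (gam1 _ _ u) (gam1 _ _ u) (gam1 _ _ u) => *.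
by field.
Qed.

Lemma LL_n_x u : U u -> LL c x n (fun v => dot c (n v) (x u)) u = - 2 * h u.
Proof.
move=> Uu; rewrite /LL !Hs_dotl// !(ip_nkj_x H)// !(ip_ni_x H)// /fh.
have := G0 Uu; move: (G u) (b i0 i0 u) (b i0 i1 u) (b i1 i1 u) => *.
by field.
Qed.

End PatchOps.

Lemma invmx22 (R : realType) (A : 'M[R]_2) : \det A != 0 ->
  [/\ invmx A i0 i0 = A i1 i1 / \det A, invmx A i0 i1 = - A i0 i1 / \det A,
      invmx A i1 i0 = - A i1 i0 / \det A & invmx A i1 i1 = A i0 i0 / \det A].
Proof.
move=> d0; have uA : A \in unitmx by rewrite unitmxE unitfE.
have E := mulVmx uA.
have e i j : invmx A i i0 * A i0 j + invmx A i i1 * A i1 j = (i == j)%:R.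
  by move/matrixP/(_ i j): E; rewrite !mxE sum2.
have n01 : (i0 == i1) = false by [].
have := e i0 i0; have := e i0 i1; have := e i1 i0; have := e i1 i1.
rewrite n01 eq_sym n01 !eqxx; rewrite det_mx22 in d0 *.
move: (invmx A i0 i0) (invmx A i0 i1) (invmx A i1 i0) (invmx A i1 i1) d0.
move: (A i0 i0) (A i0 i1) (A i1 i0) (A i1 i1) => p q r s u v w z d0 e1 e2 e3 e4.
split; apply: (canRL (mulfK d0)).
- by apply: (lincomb (congr2 (fun x y => x * s - y * r) e4 e3)); rewrite /=; ring.
- by apply: (lincomb (congr2 (fun x y => y * p - x * q) e4 e3)); rewrite /=; ring.
- by apply: (lincomb (congr2 (fun x y => x * s - y * r) e2 e1)); rewrite /=; ring.
- by apply: (lincomb (congr2 (fun x y => y * p - x * q) e2 e1)); rewrite /=; ring.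
Qed.

Lemma mxtrace_mul22 (R : pzRingType) (A B : 'M[R]_2) : \tr (A *m B) =
  (A i0 i0 * B i0 i0 + A i0 i1 * B i1 i0) + (A i1 i0 * B i0 i1 + A i1 i1 * B i1 i1).
Proof. by rewrite /mxtrace sum2 !mxE !sum2. Qed.

Section Link.
Context {R : realType}.
Local Notation E := 'rV[R]_2.
Context {c eps : R} {U : set E} {x n : E -> 'rV[R]_4}.
Hypothesis H : immersed_patch c eps U x n.
Let he := patch_eps H.
Let oU := patch_open H.
Let sx := patch_x H.
Let sn := patch_n H.
Let G0 := patch_G H.
Local Notation g := (fg c x).
Local Notation b := (fb c x n).
Local Notation G := (fG c x).
Local Notation gam0 := (gam0 c x).
Local Notation gam1 := (gam1 c x).
Local Notation t := (ft c x n).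
Local Notation h := (fh c x n).
Local Notation S0 := (fS0 c x n).
Local Notation S1 := (fS1 c x n).
Local Notation X i := (pd i x).
Implicit Types (f : E -> R) (i j k m r : 'I_2) (a : 'rV[R]_4).

Lemma row_jacobian (F : E -> 'rV[R]_4) i u : differentiable F u -> row i ('J F u) = pd i F u.
Proof. by move=> dF; rewrite rowE -deriveEjacobian// pdE. Qed.

Lemma mul_row_col p q (A : 'M[R]_(p, q)) (B : 'M[R]_(q, p)) (i j : 'I_p) :
  (A *m B) i j = (row i A *m col j B) 0 0.
Proof. by rewrite -row_mul !mxE; apply: eq_bigr => k _; rewrite !mxE. Qed.

Lemma first_formE (y : E -> 'rV[R]_4) i j u : differentiable y u ->
  first_form c y u i j = fg c y i j u.
Proof.
move=> dy; rewrite /first_form /fg -!row_jacobian// dot.unlock /ip.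
by rewrite [LHS]mul_row_col row_mul -tr_row.
Qed.

Lemma det_first_formE (y : E -> 'rV[R]_4) u : differentiable y u ->
  \det (first_form c y u) = fG c y u.
Proof. by move=> dy; rewrite det_mx22 !first_formE// /fG (fgC i1 i0). Qed.

Lemma det_first_form u : U u -> \det (first_form c x u) = G u.
Proof. by move=> Uu; apply: det_first_formE; exact: smooth_differentiable sx Uu. Qed.

Lemma row_free_jacobian u : U u -> row_free ('J x u).
Proof.
move=> Uu; apply/row_freeP.
exists (Defs.eta c *m ('J x u)^T *m invmx (first_form c x u)).
rewrite !mulmxA mulmxV// unitmxE unitfE -/(first_form c x u) det_first_form//; exact: G0.
Qed.

Definition Smat u : 'M[R]_2 := \matrix_(i, j) if j == i0 then S0 i u else S1 i u.

Lemma shape_jacobian u : U u -> - 'J n u = Smat u *m 'J x u.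
Proof.
move=> Uu; have dx := smooth_differentiable sx Uu; have dn := smooth_differentiable sn Uu.
apply/row_matrixP => i; rewrite row_mul -[- 'J n u]scaleN1r linearZ/= row_jacobian// (weingarten H)//.
rewrite scaleN1r opprK mulmx_sum_row sum2 !row_jacobian// !mxE eqxx.
by have -> : (i1 == i0) = false by [].
Qed.

Lemma shapeE u : U u -> Defs.shape x n u = Smat u.
Proof.
move=> Uu; apply: (row_free_inj (row_free_jacobian Uu)).
rewrite /Defs.shape mulmxKpV; first by rewrite shape_jacobian.
by rewrite shape_jacobian// submxMl.
Qed.

Lemma tr_shape u : U u -> \tr (Defs.shape x n u) = t u.
Proof.
move=> Uu; rewrite shapeE// /mxtrace sum2 !mxE eqxx.
have -> : (i1 == i0) = false by [].
by have [-> _] := S_trdet H Uu.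
Qed.

Lemma det_shape u : U u -> \det (Defs.shape x n u) = h u.
Proof.
move=> Uu; rewrite shapeE// det_mx22 !mxE eqxx.
have -> : (i1 == i0) = false by [].
by have [_ ->] := S_trdet H Uu.
Qed.

Lemma mean_curvE u : U u -> mean_curv eps x n u = eps / 2 * t u.
Proof. by move=> Uu; rewrite /mean_curv tr_shape. Qed.

Lemma second_mean_curvE u : U u -> second_mean_curv x n u = h u.
Proof. by move=> Uu; rewrite /second_mean_curv det_shape. Qed.

Lemma newton1E u i j : U u -> newton1 eps x n u i j = Smat u i j - t u *+ (i == j).
Proof.
move=> Uu; rewrite /newton1 shapeE// mean_curvE// !mxE.
have -> : - 2 * eps * (eps / 2 * t u) = - t u.
  by apply: (lincomb (congr1 (fun z => - z * t u) he)); field.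
by rewrite mulNrn addrC.
Qed.

Lemma ginvE u : U u ->
  [/\ invmx (first_form c x u) i0 i0 = g i1 i1 u / G u,
      invmx (first_form c x u) i0 i1 = - g i0 i1 u / G u,
      invmx (first_form c x u) i1 i0 = - g i0 i1 u / G u
    & invmx (first_form c x u) i1 i1 = g i0 i0 u / G u].
Proof.
move=> Uu; have dx := smooth_differentiable sx Uu.
have [|e1 e2 e3 e4] := @invmx22 R (first_form c x u); first by rewrite det_first_form// G0.
by rewrite e1 e2 e3 e4 det_first_form// !first_formE// (fgC i1 i0).
Qed.

Lemma christoffelE k j u : U u ->
  christoffel c x k j i0 u = gam0 k j u /\ christoffel c x k j i1 u = gam1 k j u.
Proof.
move=> Uu; have [e1 e2 e3 e4] := ginvE Uu.
have P l i m : partial l (fun v => first_form c x v i m) u = fC c x l i m u + fC c x l m i u.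
  rewrite -pdE (pd_ext l (g := fg c x i m) oU) //; first by have [] := is_partial_g H l i m Uu.
  by move=> v Uv; rewrite first_formE//; exact: smooth_differentiable sx Uv.
have Q m : partial k (fun v => first_form c x v j m) u + partial j (fun v => first_form c x v k m) u
   - partial m (fun v => first_form c x v k j) u = 2 * fC c x k j m u.
  rewrite !P (fCC H j k m Uu) (fCC H m k j Uu) (fCC H m j k Uu); ring.
rewrite /christoffel !sum2 !Q e1 e2 e3 e4 /gam0 /gam1; have := G0 Uu.
move: (G u) (g i0 i0 u) (g i0 i1 u) (g i1 i1 u) (fC c x k j i0 u) (fC c x k j i1 u) => *.
by split; field.
Qed.

(** Lowering an index turns the covariant derivative of the gradient into the
    covariant Hessian, which no longer involves derivatives of the inverse metric. *)
Lemma hess_lower f k m u : smooth_on U f -> U u ->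
  hess c x f u k i0 * g i0 m u + hess c x f u k i1 * g i1 m u = Hs c x k m f u.
Proof.
move=> sf Uu.
have gradE v : U v -> grad c x f v 0 i0 = (g i1 i1 v * pd i0 f v - g i0 i1 v * pd i1 f v) / G v /\
   grad c x f v 0 i1 = (g i0 i0 v * pd i1 f v - g i0 i1 v * pd i0 f v) / G v.
  move=> Uv; have [e1 e2 e3 e4] := ginvE Uv.
  by rewrite /grad !mxE !sum2 e1 e2 e3 e4 -!pdE; split; ring.
have sg i : smooth_on U (fun v => grad c x f v 0 i).
  have := smooth_Ginv H; have := smooth_g H => sg sG.
  have s0 : smooth_on U (fun v => (g i1 i1 v * pd i0 f v - g i0 i1 v * pd i1 f v) / G v).
    by apply: smooth_mul => //; apply: smooth_subr => //; apply: smooth_mul => //; exact: smooth_pd.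
  have s1 : smooth_on U (fun v => (g i0 i0 v * pd i1 f v - g i0 i1 v * pd i0 f v) / G v).
    by apply: smooth_mul => //; apply: smooth_subr => //; apply: smooth_mul => //; exact: smooth_pd.
  case: (ord2E i) => ->; [apply: smooth_ext s0 => // v Uv|apply: smooth_ext s1 => // v Uv].
    by have [->] := gradE v Uv.
  by have [_ ->] := gradE v Uv.
have low j v : U v -> grad c x f v 0 i0 * g i0 j v + grad c x f v 0 i1 * g i1 j v = pd j f v.
  move=> Uv; have [-> ->] := gradE v Uv; have := G0 Uv; rewrite /fG.
  by case: (ord2E j) => ->; rewrite ?(fgC i1 i0);
    move: (g i0 i0 v) (g i0 i1 v) (g i1 i1 v) (pd i0 f v) (pd i1 f v) => *; field.
have := is_partial_unique oU Uu (low m) (is_partial_add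
   (is_partial_mul (is_partial_smooth k (sg i0) Uu) (is_partial_g H k i0 m Uu))
   (is_partial_mul (is_partial_smooth k (sg i1) Uu) (is_partial_g H k i1 m Uu)))
   (is_partial_smooth k (smooth_pd m sf) Uu).
have [c00 c01] := christoffelE k i0 Uu; have [c10 c11] := christoffelE k i1 Uu.
have hE i : hess c x f u k i = pd k (fun v => grad c x f v 0 i) u
    + (christoffel c x k i0 i u * grad c x f u 0 i0 + christoffel c x k i1 i u * grad c x f u 0 i1).
  by rewrite /hess [LHS]mxE sum2 pdE.
rewrite !hE c00 c01 c10 c11 /Hs -(low i0 u Uu) -(low i1 u Uu).
rewrite !(fC_gam H)// ?(fgC m).
have [-> ->] := gamC H k m Uu; have [-> ->] := gamC H k i0 Uu; have [-> ->] := gamC H k i1 Uu.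
move=> <-; case: (ord2E m) => ->; rewrite ?(fgC i1 i0);
  move: (grad c x f u 0 i0) (grad c x f u 0 i1) (pd k _ u) (pd k _ u) => *; ring.
Qed.

Lemma L1E f u : smooth_on U f -> U u -> L1 c eps x n f u = LL c x n f u.
Proof.
move=> sf Uu.
have e k m := hess_lower k m sf Uu.
have n01 : (i0 == i1) = false by [].
have n10 : (i1 == i0) = false by [].
have sym : 2 * b i0 i1 u * Hs c x i0 i1 f u = b i0 i1 u * (Hs c x i0 i1 f u + Hs c x i1 i0 f u).
  rewrite [in RHS]/Hs (schwarz i1 i0 oU sf Uu); have [-> ->] := gamC H i1 i0 Uu.
  by rewrite -/(Hs c x i0 i1 f u); ring.
have SE i : Smat u i i0 = S0 i u /\ Smat u i i1 = S1 i u by rewrite !mxE.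
have [SE00 SE01] := SE i0; have [SE10 SE11] := SE i1.
rewrite /L1 mxtrace_mul22 !newton1E//.
rewrite SE00 SE01 SE10 SE11 !n01 !n10 !eqxx mulr0n mulr1n /LL sym -!e.
rewrite /ft /fS0 /fS1 (fbC H i1 i0 Uu) (fgC i1 i0).
move: (hess c x f u i0 i0) (hess c x f u i0 i1) (hess c x f u i1 i0) (hess c x f u i1 i1).
move: ((G u)^-1) (b i0 i0 u) (b i0 i1 u) (b i1 i1 u) (g i0 i0 u) (g i0 i1 u) (g i1 i1 u) => *.
ring.
Qed.

End Link.

(** * The two-type condition *)

Section TwoType.
Context {R : realType}.
Local Notation E := 'rV[R]_2.
Context {c eps : R} {U : set E} {x n : E -> 'rV[R]_4}.
Hypothesis H : immersed_patch c eps U x n.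
Let hc := patch_c H.
Let he := patch_eps H.
Let oU := patch_open H.
Let sx := patch_x H.
Let sn := patch_n H.
Let G0 := patch_G H.
Local Notation g := (fg c x).
Local Notation b := (fb c x n).
Local Notation G := (fG c x).
Local Notation gam0 := (gam0 c x).
Local Notation gam1 := (gam1 c x).
Local Notation t := (ft c x n).
Local Notation h := (fh c x n).
Local Notation S0 := (fS0 c x n).
Local Notation S1 := (fS1 c x n).
Local Notation X i := (pd i x).
Implicit Types (f : E -> R) (i j k m r : 'I_2) (a : 'rV[R]_4).

Lemma LL_dot (F : E -> 'rV[R]_4) a u : smooth_on U F -> U u ->
  LL c x n (fun v => dot c (F v) a) u = - (a 0 0 * LL c x n (fun v => F v 0 0) u)
   + c * (a 0 1 * LL c x n (fun v => F v 0 1) u) + a 0 2%:R * LL c x n (fun v => F v 0 2%:R) u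
   + a 0 3%:R * LL c x n (fun v => F v 0 3%:R) u.
Proof.
move=> sF Uu; have sC (j : 'I_4) := smooth_coord j oU sF.
have sZ (p : R) (j : 'I_4) : smooth_on U (fun v => p * F v 0 j) by apply: smooth_mul => //; exact: smooth_cst.
rewrite (@LL_ext _ _ _ _ _ _ H _ (fun v => - a 0 0 * F v 0 0 + c * a 0 1 * F v 0 1 +
   a 0 2%:R * F v 0 2%:R + a 0 3%:R * F v 0 3%:R) _ _ Uu); last first.
  by move=> v _; rewrite dotE; ring.
rewrite !(LL_add H) //; first rewrite !(LL_scale H)//; first ring.
  exact: smooth_add.
by apply: smooth_add => //; exact: smooth_add.
Qed.

Lemma pd_dot_n a m u : U u ->
  pd m (fun v => dot c (n v) a) u = - (S0 m u * dot c (X i0 u) a + S1 m u * dot c (X i1 u) a).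
Proof. by move=> Uu; rewrite (pd_dotl _ _ sn Uu) (weingarten H)// !dot_lin; ring. Qed.

(** The Newton tensor is divergence-free (Codazzi), so that L1 of a function is
    the Laplacian of any potential of the field it is sent to. *)
Lemma LL_potential f s u : smooth_on U f -> smooth_on U s ->
  (forall v m, U v -> S0 m v * pd i0 f v + S1 m v * pd i1 f v - t v * pd m f v = pd m s v) ->
  U u ->
  LL c x n f u = (g i1 i1 u * Hs c x i0 i0 s u - 2 * g i0 i1 u * Hs c x i0 i1 s u
    + g i0 i0 u * Hs c x i1 i1 s u) / G u.
Proof.
move=> sf ss pot Uu.
have sb := smooth_b H; have sg := smooth_g H.
have ep0 v : U v -> b i1 i1 v * pd i0 f v - b i0 i1 v * pd i1 f v =
    - (g i1 i1 v * pd i0 s v - g i0 i1 v * pd i1 s v).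
  move=> Uv; rewrite -!pot// /ft /fS0 /fS1 (fbC H i1 i0 Uv); have := G0 Uv; rewrite /fG.
  move: (b i0 i0 v) (b i0 i1 v) (b i1 i1 v) (g i0 i0 v) (g i0 i1 v) (g i1 i1 v) (pd i0 f v) (pd i1 f v) => *.
  by field.
have ep1 v : U v -> - b i0 i1 v * pd i0 f v + b i0 i0 v * pd i1 f v =
    - (- g i0 i1 v * pd i0 s v + g i0 i0 v * pd i1 s v).
  move=> Uv; rewrite -!pot// /ft /fS0 /fS1 (fbC H i1 i0 Uv); have := G0 Uv; rewrite /fG.
  move: (b i0 i0 v) (b i0 i1 v) (b i1 i1 v) (g i0 i0 v) (g i0 i1 v) (g i1 i1 v) (pd i0 f v) (pd i1 f v) => *.
  by field.
have Pb k i j := is_partial_smooth k (sb i j) Uu.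
have Pg k i j := is_partial_g H k i j Uu.
have Pf k i := is_partial_smooth k (smooth_pd i sf) Uu.
have Ps k i := is_partial_smooth k (smooth_pd i ss) Uu.
have D0 := is_partial_unique oU Uu ep0
  (is_partial_sub (is_partial_mul (Pb i0 i1 i1) (Pf i0 i0)) (is_partial_mul (Pb i0 i0 i1) (Pf i0 i1)))
  (is_partial_opp (is_partial_sub (is_partial_mul (Pg i0 i1 i1) (Ps i0 i0)) (is_partial_mul (Pg i0 i0 i1) (Ps i0 i1)))).
have D1 := is_partial_unique oU Uu ep1
  (is_partial_add (is_partial_mul (is_partial_opp (Pb i1 i0 i1)) (Pf i1 i0)) (is_partial_mul (Pb i1 i0 i0) (Pf i1 i1)))
  (is_partial_opp (is_partial_add (is_partial_mul (is_partial_opp (Pg i1 i0 i1)) (Ps i1 i0)) (is_partial_mul (Pg i1 i0 i0) (Ps i1 i1)))).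
have C0 := codazzi H i0 i1 i1 Uu; have C1 := codazzi H i1 i0 i0 Uu.
have sw f' : smooth_on U f' -> pd i1 (pd i0 f') u = pd i0 (pd i1 f') u.
  by move=> sf'; exact: (schwarz i1 i0 oU sf' Uu).
have W0 := ep0 u Uu; have W1 := ep1 u Uu.
have bs := pd_ext i1 oU (fun v => @fbC _ _ _ _ _ _ H i1 i0 v) Uu.
move: D0 D1 C0 C1; rewrite bs !sw// !(fC_gam H)// (fbC H i1 i0 Uu) !(fgC i1 i0).
have [-> ->] := gamC H i1 i0 Uu.
move=> D0 D1 C0 C1; apply: (mulIf (G0 Uu)); rewrite /LL !divfK ?G0//; apply/eqP.
rewrite -subr_eq0; apply/eqP.
pose T0 := gam0 i0 i0 u + gam1 i0 i1 u; pose T1 := gam0 i0 i1 u + gam1 i1 i1 u.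
move: (congr2 (fun p q => p + q) D0 D1) => D.
apply: (lincomb (congr2 (fun p q => q - p) (congr2 (fun p q => p + q) D
   (congr2 (fun p q => - pd i0 f u * p - pd i1 f u * q) C0 C1))
   (congr2 (fun p q => T0 * p + T1 * q) W0 W1))).
rewrite /Hs /T0 /T1 /=.
move: (gam0 i0 i0 u) (gam0 i0 i1 u) (gam0 i1 i1 u) (gam1 i0 i0 u) (gam1 i0 i1 u) (gam1 i1 i1 u).
move: (b i0 i0 u) (b i0 i1 u) (b i1 i1 u) (g i0 i0 u) (g i0 i1 u) (g i1 i1 u).
move: (pd i0 f u) (pd i1 f u) (pd i0 s u) (pd i1 s u) => *; ring.
Qed.

Context {a0 : 'rV[R]_4} {y1 y2 : E -> 'rV[R]_4} {l1 l2 : R}.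
Hypothesis sy1 : smooth_on U y1.
Hypothesis sy2 : smooth_on U y2.
Hypothesis xy : forall u, U u -> x u = a0 + y1 u + y2 u.
Hypothesis eig1 : forall u (j : 'I_4), U u -> L1 c eps x n (fun v => y1 v 0 j) u = l1 * y1 u 0 j.
Hypothesis eig2 : forall u (j : 'I_4), U u -> L1 c eps x n (fun v => y2 v 0 j) u = l2 * y2 u 0 j.
Local Notation mu := (l1 * l2).
Local Notation La := (l1 + l2).
Local Notation f := (fun v => dot c (x v) a0).

Lemma eig1_dot a u : U u -> LL c x n (fun v => dot c (y1 v) a) u = l1 * dot c (y1 u) a.
Proof.
move=> Uu; rewrite LL_dot// -!(L1E H) ?eig1// ?dotE; [ring|exact: smooth_coord..].
Qed.

Lemma eig2_dot a u : U u -> LL c x n (fun v => dot c (y2 v) a) u = l2 * dot c (y2 u) a.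
Proof.
move=> Uu; rewrite LL_dot// -!(L1E H) ?eig2// ?dotE; [ring|exact: smooth_coord..].
Qed.

Let sdot (F : E -> 'rV[R]_4) a : smooth_on U F -> smooth_on U (fun v => dot c (F v) a).
Proof. by move=> sF; apply: smooth_dot => //; exact: smooth_cst. Qed.

Lemma LLx_eig a u : U u -> - 2 * eps * h u * dot c (n u) a + c * t u * dot c (x u) a
  = l1 * dot c (y1 u) a + l2 * dot c (y2 u) a.
Proof.
move=> Uu; rewrite -(LL_x H)// -eig1_dot// -eig2_dot//.
rewrite (@LL_ext _ _ _ _ _ _ H _ (fun v => dot c a0 a + dot c (y1 v) a + dot c (y2 v) a) _ _ Uu); last first.
  by move=> v Uv; rewrite xy// !dot_lin.
rewrite !(LL_add H)//; [rewrite LL_cst; ring|exact: smooth_cst|exact: sdot| |exact: sdot].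
by apply: smooth_add => //; [exact: smooth_cst|exact: sdot].
Qed.

(** Since x - a0 is a sum of two eigenfunctions, L1 (L1 x) = La L1 x - mu (x - a0); both
    sides are evaluated against a vector a through the product rule for L1. *)
Lemma two_type_dot a u : U u ->
  - 2 * eps * (h u * LL c x n (fun v => dot c (n v) a) u + dot c (n u) a * LL c x n h u
     + 2 * cross (c := c) (x := x) (n := n) h (fun v => dot c (n v) a) u)
  + c * (t u * LL c x n (fun v => dot c (x v) a) u + dot c (x u) a * LL c x n t u
     + 2 * cross (c := c) (x := x) (n := n) t (fun v => dot c (x v) a) u)
  = La * (- 2 * eps * h u * dot c (n u) a + c * t u * dot c (x u) a)
    - mu * (dot c (x u) a - dot c a0 a).
Proof.
move=> Uu; have sn' := sdot a sn; have sx' := sdot a sx.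
have sh := smooth_h H; have st := smooth_t H.
have E1 : LL c x n (fun v => (- 2 * eps) * (h v * dot c (n v) a) + c * (t v * dot c (x v) a)) u
   = l1 * (l1 * dot c (y1 u) a) + l2 * (l2 * dot c (y2 u) a).
  rewrite -eig1_dot// -eig2_dot// -!(LL_scale H)//; [|exact: sdot..].
  rewrite -(LL_add H)//; [|by apply: smooth_mul => //; [exact: smooth_cst|exact: sdot]..].
  apply: (LL_ext H) => // v Uv; rewrite -LLx_eig//; ring.
rewrite (LL_add H) // in E1; last first.
- by apply: smooth_mul => //; [exact: smooth_cst|exact: smooth_mul].
- by apply: smooth_mul => //; [exact: smooth_cst|exact: smooth_mul].
have m1 : smooth_on U (fun v => h v * dot c (n v) a) by exact: smooth_mul.
have m2 : smooth_on U (fun v => t v * dot c (x v) a) by exact: smooth_mul.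
rewrite (LL_scale H (- 2 * eps) m1 Uu) (LL_scale H c m2 Uu) (LL_mul H sh sn' Uu) (LL_mul H st sx' Uu) in E1.
rewrite E1 LLx_eig// xy// !dot_lin; ring.
Qed.

(** The tangential component of the two-type condition. *)
Lemma two_type_tangent m u : U u ->
  - 6 * eps * h u * pd m h u + 2 * c * (S0 m u * pd i0 t u + S1 m u * pd i1 t u - t u * pd m t u)
  = mu * pd m f u.
Proof.
move=> Uu; have := two_type_dot (X m u) Uu.
rewrite (LL_n_xr H)// (LL_x H)// (patch_nt H)// [dot c (x u) _]dotC (ip_xi_x H)//.
rewrite /cross !(pd_dotl _ _ sn Uu) !(pd_dotl _ _ sx Uu) ![dot c (pd _ n u) _]dotC !(ip_xi_nj H)//.
rewrite [dot c a0 _]dotC -!/(fg c x _ _ u) => E1.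
apply: (lincomb E1).
case: (ord2E m) {E1} => ->; move: (dot c (X _ u) a0) (LL c x n h u) (LL c x n t u) => fm L1' L2';
move: (pd i0 h u) (pd i1 h u) (pd i0 t u) (pd i1 t u) => h0 h1 t0 t1;
rewrite /ft /fh /fS0 /fS1 ?(fbC H i1 i0 Uu) ?(fgC i1 i0); move: ((G u)^-1) => Gi;
move: (b i0 i0 u) (b i0 i1 u) (b i1 i1 u) (g i0 i0 u) (g i0 i1 u) (g i1 i1 u) => *; ring.
Qed.

(** Its component along the unit normal. *)
Lemma two_type_normal u : U u ->
  - 2 * t u * h u * h u - 2 * eps * LL c x n h u - 2 * c * eps * t u * h u
  = - 2 * eps * La * h u + mu * eps * dot c (n u) a0.
Proof.
move=> Uu; have := two_type_dot (n u) Uu.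
rewrite (LL_n_n H)// (LL_x H)// (patch_nn H)// [dot c (x u) _]dotC (patch_nx H)//.
rewrite /cross !(pd_dotl _ _ sn Uu) !(pd_dotl _ _ sx Uu) ![dot c (pd _ _ u) _]dotC !(ip_n_ni H)// !(patch_nt H)//.
rewrite [dot c a0 _]dotC.
move: (t u) (h u) (LL c x n h u) (LL c x n t u) (dot c (n u) a0) => T Hh L1' L2' f0 E1.
have E2 : - 2 * eps * (Hh * (T * Hh) + eps * L1') + c * (T * (- 2 * eps * Hh * eps)) =
   La * (- 2 * eps * Hh * eps) + mu * f0.
  by apply: (lincomb E1); ring.
by apply: (lincomb (congr2 (fun p q => eps * p + (q * (2 * T * Hh * Hh + 2 * eps * L1' - 2 * eps * La * Hh + 2 * eps * c * T * Hh))) E2 he));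
 ring.
Qed.

(** Its component along the position vector. *)
Lemma two_type_position u : U u ->
  4 * c * eps * h u * h u + t u * t u + c * LL c x n t u
  = c * La * t u - mu + c * mu * f u.
Proof.
move=> Uu; have := two_type_dot (x u) Uu.
rewrite (LL_n_x H)// (LL_x H)// (patch_xx H)// (patch_nx H)//.
rewrite /cross !(pd_dotl _ _ sn Uu) !(pd_dotl _ _ sx Uu) !(ip_ni_x H)// !(ip_xi_x H)//.
rewrite [dot c a0 _]dotC.
move: (t u) (h u) (LL c x n h u) (LL c x n t u) (dot c (x u) a0) => T Hh L1' L2' f0 E1.
have E2 : 4 * eps * Hh * Hh + c * (T * (c * T * c) + c * L2') = c * c * La * T - mu * (c - f0).
  by apply: (lincomb E1); ring.
by apply: (lincomb (congr2 (fun p q => c * p + (q * (c * La * T - mu - T * T - c * L2' - c * c * T * T))) E2 hc));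
 ring.
Qed.

Lemma LL_zero f' u : (forall v m, U v -> pd m f' v = 0) -> U u -> LL c x n f' u = 0.
Proof.
move=> f0 Uu.
have z i : pd i (fun _ : E => 0) u = 0 :> R by have [] := is_partial_cst i (0 : R) u.
have f2 i j : pd i (pd j f') u = 0.
  by rewrite (pd_ext i oU (fun v => f0 v j) Uu) z.
by rewrite /LL /Hs !f0// !f2; ring.
Qed.

(** If tr S is constant, the tangential component says that 6 h dh is proportional to
    the differential of <x, a0>, and the differential of the component along x says
    that 8 h dh is proportional to it with the opposite sign; their difference is a
    multiple of h dh. *)
Lemma const_t_h m u : (forall v m, U v -> pd m t v = 0) -> U u -> h u * pd m h u = 0.
Proof.
move=> t0 Uu.
have sf := sdot a0 sx; have sh := smooth_h H; have st := smooth_t H.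
have P f' (sf' : smooth_on U f') := is_partial_smooth m sf' Uu.
have e1 v : U v -> 4 * c * eps * h v * h v + t v * t v = c * La * t v - mu + c * mu * f v.
  by move=> Uv; have := two_type_position Uv; rewrite (LL_zero t0 Uv) mulr0 addr0.
have := is_partial_unique oU Uu e1
  (is_partial_add (is_partial_mul (is_partial_mul (is_partial_cst m (4 * c * eps) u) (P _ sh)) (P _ sh))
     (is_partial_mul (P _ st) (P _ st)))
  (is_partial_add (is_partial_sub (is_partial_mul (is_partial_cst m (c * La) u) (P _ st)) (is_partial_cst m mu u))
     (is_partial_mul (is_partial_cst m (c * mu) u) (P _ sf))).
have := two_type_tangent m Uu; rewrite !t0//.
move: (h u) (pd m h u) (pd m f u) (t u) => Hh hm fm T E1 E2.
have k : 14 * (Hh * hm) = 0.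
  apply: (lincomb (congr2 (fun p q => p - q) (congr2 (fun p q => eps * c * q - eps * p) E1 E2)
    (congr2 (fun p q => p * q * 8 * Hh * hm + q * (6 * Hh * hm) - p * eps * mu * fm) hc he))).
  ring.
by move/eqP: k; rewrite mulf_eq0 pnatr_eq0 /= => /eqP.
Qed.

End TwoType.

(** * The gradient of tr S when det S, or an eigenvalue of S, is constant *)

(** The Cayley-Hamilton identity for an eigenvector with eigenvalue r / q, multiplied
    by q^2 so that q may vanish. *)
Lemma char_poly_eigen (R : comPzRingType) (s00 s01 s10 s11 v0 v1 q r : R) :
  q * (s00 * v0 + s01 * v1) = r * v0 -> q * (s10 * v0 + s11 * v1) = r * v1 ->
  let p := r * r - q * r * (s00 + s11) + q * q * (s00 * s11 - s01 * s10) in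
  p * v0 = 0 /\ p * v1 = 0.
Proof.
move=> e0 e1 /=; split.
  by apply: (lincomb (congr2 (fun x y => (q * s11 - r) * x - q * s01 * y) e0 e1)); rewrite /=; ring.
by apply: (lincomb (congr2 (fun x y => (q * s00 - r) * y - q * s10 * x) e0 e1)); rewrite /=; ring.
Qed.

(** The characteristic polynomial of S at the eigenvalue (1 + A/2) T + B/4, where T is its
    trace and h0 its determinant. When h0 (h0 + 2 c eps) is not zero,
    the normal component of the two-type condition already gives this constant. *)
Definition poly_h (R : realType) (c eps La h0 : R) : {poly R} :=
  if h0 * (h0 + 2 * c * eps) == 0 then
    let A := 1 - h0 * h0 - c * eps * h0 in
    let B := La * (eps * h0 - c) in
    Poly [:: B / 4 * (B / 4) + h0; B / 4 * (1 + A); (1 + A / 2) * (A / 2)]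
  else (h0 * (h0 + 2 * c * eps))%:P.

(** The characteristic polynomial of S, with roots k and T - k, at be / al, multiplied by
    al^2: it is (be - al k) (be - al (T - k)), for the polynomials al and be in the
    trace T that occur in the proof of [const_eigenvalue_t]. *)
Definition poly_k (R : realType) (c eps k : R) : {poly R} :=
  Poly [:: - (24 * eps * k * k * k * k); 30 * eps * k * k * k + 2 * c * k; - (6 * eps * k * k)]
  * Poly [:: 8 * c * k * k - 36 * eps * k * k * k * k; 48 * eps * k * k * k - 2 * c * k;
      - (12 * eps * k * k)].

Lemma poly_h_neq0 (R : realType) (c eps La h0 : R) : c * c = 1 -> eps * eps = 1 ->
  poly_h c eps La h0 != 0.
Proof.
move=> hc he; rewrite /poly_h; case: ifPn => [|h1]; last by rewrite polyC_eq0.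
rewrite mulf_eq0 => /orP[] /eqP hh; apply/eqP => /polyP/(_ 2%N); rewrite coef_Poly coef0 /=.
  rewrite hh !(mulr0, subr0) => /eqP; rewrite mulf_eq0 => /orP[] /eqP ? ; lra.
have -> : h0 = - 2 * c * eps by apply: (lincomb hh); ring.
have -> : 1 - - 2 * c * eps * (- 2 * c * eps) - c * eps * (- 2 * c * eps) = -1.
  by apply: (lincomb (congr2 (fun p q => - 2 * p * q) hc he)); ring.
by move=> /eqP; rewrite mulf_eq0 => /orP[] /eqP ?; lra.
Qed.

Lemma poly_k_neq0 (R : realType) (c eps k : R) : eps != 0 -> k != 0 -> poly_k c eps k != 0.
Proof.
move=> e0 k0; rewrite mulf_neq0//; apply/eqP => /polyP/(_ 2%N); rewrite coef_Poly coef0 /= => /eqP;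
  by rewrite oppr_eq0 !mulf_eq0 (negbTE e0) (negbTE k0) pnatr_eq0.
Qed.

Section Gradient.
Context {R : realType}.
Local Notation E := 'rV[R]_2.
Context {c eps : R} {U : set E} {x n : E -> 'rV[R]_4}.
Hypothesis H : immersed_patch c eps U x n.
Let hc := patch_c H.
Let he := patch_eps H.
Let oU := patch_open H.
Let sx := patch_x H.
Let sn := patch_n H.
Let G0 := patch_G H.
Local Notation g := (fg c x).
Local Notation b := (fb c x n).
Local Notation t := (ft c x n).
Local Notation h := (fh c x n).
Local Notation S0 := (fS0 c x n).
Local Notation S1 := (fS1 c x n).
Context {a0 : 'rV[R]_4} {y1 y2 : E -> 'rV[R]_4} {l1 l2 : R}.
Hypothesis sy1 : smooth_on U y1.
Hypothesis sy2 : smooth_on U y2.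
Hypothesis xy : forall u, U u -> x u = a0 + y1 u + y2 u.
Hypothesis eig1 : forall u (j : 'I_4), U u -> L1 c eps x n (fun v => y1 v 0 j) u = l1 * y1 u 0 j.
Hypothesis eig2 : forall u (j : 'I_4), U u -> L1 c eps x n (fun v => y2 v 0 j) u = l2 * y2 u 0 j.
Local Notation mu := (l1 * l2).
Local Notation La := (l1 + l2).
Local Notation f := (fun v => dot c (x v) a0).
Local Notation gg := (fun v => dot c (n v) a0).
Implicit Types (i j k m r : 'I_2).

Let ttan m u := two_type_tangent H sy1 sy2 xy eig1 eig2 m (u := u).
Let tnor u := two_type_normal H sy1 sy2 xy eig1 eig2 (u := u).
Let tpos u := two_type_position H sy1 sy2 xy eig1 eig2 (u := u).
Let st := smooth_t H.
Let sh := smooth_h H.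
Let sf : smooth_on U f. Proof. by apply: smooth_dot => //; exact: smooth_cst. Qed.
Let sgg : smooth_on U gg. Proof. by apply: smooth_dot => //; exact: smooth_cst. Qed.
Let P m f' u (sf' : smooth_on U f') (Uu : U u) := is_partial_smooth m sf' Uu.
Let K m (p : R) (u : E) := is_partial_cst m p u.

Lemma pd_gg m u : U u -> pd m gg u = - (S0 m u * pd i0 f u + S1 m u * pd i1 f u).
Proof. by move=> Uu; rewrite (pd_dot_n H)// !(pd_dotl _ _ sx Uu). Qed.

Lemma const_h_pd m u h0 : (forall v, U v -> h v = h0) -> U u -> pd m h u = 0.
Proof.
move=> hh Uu; exact: (is_partial_unique oU Uu hh (P m sh Uu) (K m h0 u)).
Qed.

Lemma const_h_gradient m u h0 : (forall v, U v -> h v = h0) -> U u ->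
  h0 * (h0 + 2 * c * eps) * pd m t u = 0.
Proof.
move=> hh Uu.
have h_z v i : U v -> pd i h v = 0 by move=> Uv; exact: const_h_pd hh Uv.
have e1 v : U v -> - 2 * t v * h0 * h0 - 2 * c * eps * t v * h0 = - 2 * eps * La * h0 + mu * eps * gg v.
  by move=> Uv; have := tnor Uv; rewrite (LL_zero H (fun w i => h_z w i) Uv) mulr0 subr0 hh.
have := is_partial_unique oU Uu e1
  (is_partial_sub (is_partial_mul (is_partial_mul (is_partial_mul (K m (-2) u) (P m st Uu)) (K m h0 u)) (K m h0 u))
     (is_partial_mul (is_partial_mul (K m (2 * c * eps) u) (P m st Uu)) (K m h0 u)))
  (is_partial_add (K m (- 2 * eps * La * h0) u) (is_partial_mul (K m (mu * eps) u) (P m sgg Uu))).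
rewrite pd_gg//; have := ttan i0 Uu; have := ttan i1 Uu; have [te he'] := S_trdet H Uu.
rewrite !h_z// !mulr0 !add0r; rewrite hh// in he'; rewrite te he'.
case: (ord2E m) => ->; move: (S0 i0 u) (S1 i0 u) (S0 i1 u) (S1 i1 u) (pd i0 t u) (pd i1 t u)
  (pd i0 f u) (pd i1 f u) => s00 s01 s10 s11 v0 v1 f0 f1 T1 T0 e.
  by apply: (lincomb (congr2 (fun p q => - 2^-1 * (p + eps * q)) e
    (congr2 (fun p q => s00 * p + s01 * q) T0 T1))); rewrite /=; field.
by apply: (lincomb (congr2 (fun p q => - 2^-1 * (p + eps * q)) e
  (congr2 (fun p q => s10 * p + s11 * q) T0 T1))); rewrite /=; field.
Qed.

(** By the tangential component the Newton tensor sends grad (tr S) to a multiple of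
    grad <x, a0>, so that L1 (tr S) is a multiple of a Laplacian. *)
Lemma LL_t_const_h u h0 : (forall v, U v -> h v = h0) -> U u ->
  LL c x n t u = c * mu / 2 * (eps * t u * gg u - 2 * c * f u).
Proof.
move=> hh Uu.
have h_z v i : U v -> pd i h v = 0 by move=> Uv; exact: const_h_pd hh Uv.
have ss : smooth_on U (fun v => c * mu / 2 * f v) by apply: smooth_mul => //; exact: smooth_cst.
rewrite (LL_potential H st ss) //; last first.
  move=> v m Uv; have [_ ->] := is_partial_mul (K m (c * mu / 2) v) (P m sf Uv).
  have := ttan m Uv; rewrite h_z// => e.
  by apply: (lincomb (congr2 (fun p q => c / 2 * p - q * (S0 m v * pd i0 t v + S1 m v * pd i1 t v - t v * pd m t v)) e hc)); field.
have HE i j : Hs c x i j (fun v => c * mu / 2 * f v) u = c * mu / 2 * Hs c x i j f u.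
  rewrite /Hs; have e k v : U v -> pd k (fun v => c * mu / 2 * f v) v = c * mu / 2 * pd k f v.
    by move=> Uv; have [_ ->] := is_partial_mul (K k (c * mu / 2) v) (P k sf Uv); ring.
  rewrite (pd_ext i oU (fun v => e j v) Uu) !e//.
  have [_ ->] := is_partial_mul (K i (c * mu / 2) u) (P i (smooth_pd j sf) Uu); ring.
rewrite !HE !(Hs_x H)// /ft; have := G0 Uu; rewrite /fG.
move: (b i0 i0 u) (b i0 i1 u) (b i1 i1 u) (g i0 i0 u) (g i0 i1 u) (g i1 i1 u) (dot c (x u) a0) (dot c (n u) a0) => *.
by field.
Qed.

(** The normal component kills grad (tr S) unless h0 (h0 + 2 c eps) = 0. In that case
    the components along n and x express mu <x, a0> as a quadratic polynomial in tr S;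
    with the tangential component this makes grad (tr S) an eigenvector of S whose
    eigenvalue is a polynomial in tr S. *)
Lemma const_h_t m u h0 : (forall v, U v -> h v = h0) -> U u ->
  (poly_h c eps La h0).[t u] * pd m t u = 0.
Proof.
move=> hh Uu; rewrite /poly_h; case: ifPn => [/eqP h1|_]; last first.
  by rewrite hornerC; exact: const_h_gradient.
have h_z v i : U v -> pd i h v = 0 by move=> Uv; exact: const_h_pd hh Uv.
set A := 1 - _ - _; set B := La * _.
have e1 v : U v -> A * t v * t v + B * t v + (4 * c * eps * h0 * h0 + mu) = 2 * c * mu * f v.
  move=> Uv; have := tpos Uv; have := tnor Uv.
  rewrite (LL_zero H (fun w i => h_z w i) Uv) (LL_t_const_h hh Uv) hh// /A /B.
  move: (t v) (f v) (gg v) => T F Gg eN eX.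
  apply: (lincomb (congr2 (fun p q => p + 2^-1 * T * q) (congr2 (fun p q => p - q * (mu / 2 * (eps * T * Gg - 2 * c * F))) eX hc) eN)).
  by rewrite /=; field.
have D i := is_partial_unique oU Uu e1
  (is_partial_add (is_partial_add (is_partial_mul (is_partial_mul (K i A u) (P i st Uu)) (P i st Uu))
      (is_partial_mul (K i B u) (P i st Uu))) (K i (4 * c * eps * h0 * h0 + mu) u))
  (is_partial_mul (K i (2 * c * mu) u) (P i sf Uu)).
have [te he'] := S_trdet H Uu.
have E i : 4 * (S0 i u * pd i0 t u + S1 i u * pd i1 t u) = (4 * t u + 2 * A * t u + B) * pd i t u.
  have := ttan i Uu; rewrite h_z// => Ti; have Di := D i.
  apply: (lincomb (congr2 (fun p q => p - q * 4 * (S0 i u * pd i0 t u + S1 i u * pd i1 t u - t u * pd i t u))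
    (congr2 (fun p q => q * (2 * c) - p) Di Ti) hc)).
  by rewrite /=; ring.
rewrite hh// in he'.
have [p0 p1] := char_poly_eigen (E i0) (E i1).
rewrite horner_Poly /= -te in p0 p1 *.
have V i : 16 * (((0 * t u + (1 + A / 2) * (A / 2)) * t u + B / 4 * (1 + A)) * t u + (B / 4 * (B / 4) + h0)) * pd i t u = 0.
  by case: (ord2E i) => ->; [apply: (lincomb p0)|apply: (lincomb p1)]; rewrite [in LHS]he'; field.
have := V m; rewrite -mulrA => /eqP; rewrite mulf_eq0 pnatr_eq0 /= => /eqP; exact.
Qed.

(** The two normal components of the two-type condition determine
    mu (<n, a0> + 2 k <x, a0>) as a polynomial in tr S; its differential makes
    grad (tr S) an eigenvector of al S, with eigenvalue be. *)
Lemma const_eigenvalue_t m u (k : R) : (forall v, U v -> h v = k * (t v - k)) -> U u ->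
  (poly_k c eps k).[t u] * pd m t u = 0.
Proof.
move=> hk Uu.
have sk : smooth_on U (fun v => t v - k) by apply: smooth_subr => //; exact: smooth_cst.
have LLh v : U v -> LL c x n h v = k * LL c x n t v.
  move=> Uv; rewrite (LL_ext H hk Uv) (LL_scale H)//; congr (_ * _).
  by apply: etrans (LL_add H st (smooth_cst U (- k)) Uv) _; rewrite LL_cst addr0.
have pdh i v : U v -> pd i h v = k * pd i t v.
  move=> Uv; rewrite (is_partial_unique oU Uv hk (P i sh Uv) (is_partial_mul (K i k v)
    (is_partial_sub (P i st Uv) (K i k v)))); ring.
have e1 v : U v -> mu * (gg v + 2 * k * f v) = 2 * eps * k * k * (t v - k) * (t v - k) * (4 * k - t v)
   + 2 * c * k * k * t v + (2 * c * k * mu - 2 * La * k * k).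
  move=> Uv; have := tpos Uv; have := tnor Uv; rewrite LLh// hk//.
  move: (t v) (f v) (gg v) (LL c x n t v) => T F Gg L eN eX.
  have eN' : mu * Gg = eps * (- 2 * T * (k * (T - k)) * (k * (T - k))) - 2 * k * L - 2 * c * T * (k * (T - k))
     + 2 * La * (k * (T - k)).
    apply: (lincomb (congr2 (fun p q => - eps * p - q * (mu * Gg + 2 * k * L + 2 * c * T * (k * (T - k)) - 2 * La * (k * (T - k)))) eN he)).
    by rewrite /=; ring.
  have eX' : L = c * (c * La * T - mu + c * mu * F - 4 * c * eps * (k * (T - k)) * (k * (T - k)) - T * T).
    apply: (lincomb (congr2 (fun p q => c * p - q * L) eX hc)).
    by rewrite /=; ring.
  rewrite mulrDr eN' eX'.
  apply: (lincomb (congr1 (fun p => p * (- 2 * k * (La * T + mu * F - 4 * eps * (k * (T - k)) * (k * (T - k))))) hc)).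
  by rewrite /=; ring.
have D i := is_partial_unique oU Uu e1
  (is_partial_mul (K i mu u) (is_partial_add (P i sgg Uu) (is_partial_mul (K i (2 * k) u) (P i sf Uu))))
  (is_partial_add (is_partial_add
    (is_partial_mul (is_partial_mul (is_partial_mul (K i (2 * eps * k * k) u)
       (is_partial_sub (P i st Uu) (K i k u))) (is_partial_sub (P i st Uu) (K i k u)))
       (is_partial_sub (K i (4 * k) u) (P i st Uu)))
    (is_partial_mul (K i (2 * c * k * k) u) (P i st Uu))) (K i (2 * c * k * mu - 2 * La * k * k) u)).
have [te he'] := S_trdet H Uu.
pose al := 4 * c * k + 6 * eps * k * k * (t u - k).
pose be := 2 * eps * k * k * (t u - k) * (9 * k - 3 * t u) + 2 * c * k * k + 4 * c * k * t u
  - 2 * c * k * (t u - k) + 12 * eps * k * k * k * (t u - k).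
have E i : al * (S0 i u * pd i0 t u + S1 i u * pd i1 t u) = be * pd i t u.
  have Di := D i; rewrite pd_gg// in Di.
  have := ttan i0 Uu; have := ttan i1 Uu; have := ttan i Uu; rewrite !pdh// !hk// => Ti T1 T0.
  rewrite !hk// in he'; rewrite /al /be te in Di he' T0 T1 Ti *.
  apply: (lincomb (congr2 (fun p q => p + 2 * c * pd i t u * q) (congr2 (fun p q => p + q)
    (congr2 (fun p q => 2 * k * p - q) Ti (congr2 (fun p q => S0 i u * p + S1 i u * q) T0 T1)) Di) he')).
  move: {Di Ti T0 T1} (t u) te he' => T te he'.
  by case: (ord2E i) => ->; move: (S0 i0 u) (S1 i0 u) (S0 i1 u) (S1 i1 u) (pd i0 t u) (pd i1 t u)
    (pd i0 f u) (pd i1 f u) => *; rewrite /=; ring.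
rewrite hk// in he'.
have [p0 p1] := char_poly_eigen (E i0) (E i1).
rewrite /poly_k hornerM !horner_Poly /= -te -he' in p0 p1 *.
by case: (ord2E m) => ->; [apply: (lincomb p0)|apply: (lincomb p1)]; rewrite /al /be; ring.
Qed.

End Gradient.

(** * Constant distinct principal curvatures: flatness *)

(** The cubic form with coefficients T0, ..., T3 is apolar to the quadratic forms g and
    b; the four linear equations have as determinant the resultant of g and b. *)
Lemma apolar_eq0 (R : idomainType) (g0 g1 g2 b0 b1 b2 T0 T1 T2 T3 : R) :
  let u := b0 * g2 - g0 * b2 in let v := b0 * g1 - g0 * b1 in let w := b1 * g2 - g1 * b2 in
  u * u - 4 * v * w != 0 ->
  0 = g2 * T0 - 2 * g1 * T1 + g0 * T2 -> 0 = b2 * T0 - 2 * b1 * T1 + b0 * T2 ->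
  0 = g2 * T1 - 2 * g1 * T2 + g0 * T3 -> 0 = b2 * T1 - 2 * b1 * T2 + b0 * T3 ->
  [/\ T0 = 0, T1 = 0, T2 = 0 & T3 = 0].
Proof.
move=> u v w n0 A0 B0 A1 B1.
have p1 : u * T1 - 2 * v * T2 = 0.
  by apply: (lincomb (congr2 (fun p q => b0 * p - g0 * q) (esym A1) (esym B1))); rewrite /u /v /w /=; ring.
have p2 : 2 * w * T1 - u * T2 = 0.
  by apply: (lincomb (congr2 (fun p q => b2 * p - g2 * q) (esym A0) (esym B0))); rewrite /u /v /w /=; ring.
have z1 : T1 = 0.
  apply: (mulfI n0); apply: (lincomb (congr2 (fun p q => u * p - 2 * v * q) p1 p2)); rewrite /=; ring.
have z2 : T2 = 0.
  apply: (mulfI n0); apply: (lincomb (congr2 (fun p q => 2 * w * p - u * q) p1 p2)); rewrite /=; ring.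
move: A0 B0 A1 B1; rewrite z1 z2 !mulr0 !subr0 !addr0 !add0r => A0 B0 A1 B1.
split=> //.
  apply/eqP; apply: contraNT n0 => T00; apply/eqP.
  have [g20 b20] : g2 = 0 /\ b2 = 0.
    by split; apply/eqP; [move/esym/eqP: A0|move/esym/eqP: B0]; rewrite mulf_eq0 (negbTE T00) orbF.
  by rewrite /u /v /w g20 b20; ring.
apply/eqP; apply: contraNT n0 => T30; apply/eqP.
have [g00 b00] : g0 = 0 /\ b0 = 0.
  by split; apply/eqP; [move/esym/eqP: A1|move/esym/eqP: B1]; rewrite mulf_eq0 (negbTE T30) orbF.
by rewrite /u /v /w g00 b00; ring.
Qed.

Section ConstantCurvatures.
Context {R : realType}.
Local Notation E := 'rV[R]_2.
Context {c eps : R} {U : set E} {x n : E -> 'rV[R]_4}.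
Hypothesis H : immersed_patch c eps U x n.
Let hc := patch_c H.
Let he := patch_eps H.
Let oU := patch_open H.
Let sx := patch_x H.
Let sn := patch_n H.
Let G0 := patch_G H.
Local Notation g := (fg c x).
Local Notation b := (fb c x n).
Local Notation G := (fG c x).
Local Notation gam0 := (gam0 c x).
Local Notation gam1 := (gam1 c x).
Local Notation t := (ft c x n).
Local Notation h := (fh c x n).
Local Notation S0 := (fS0 c x n).
Local Notation S1 := (fS1 c x n).
Local Notation Db := (Db (c := c) (x := x) (n := n)).
Local Notation X i := (pd i x).
Implicit Types (i j k m r : 'I_2) (a d : 'rV[R]_4).
Let P m f' u (sf' : smooth_on U f') (Uu : U u) := is_partial_smooth m sf' Uu.
Let sx' i : smooth_on U (X i). Proof. exact: smooth_pd. Qed.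
Let sn' i : smooth_on U (pd i n). Proof. exact: smooth_pd. Qed.

(** The minors of the pencil spanned by the two fundamental forms. *)
Definition min0 u := b i0 i0 u * g i0 i1 u - g i0 i0 u * b i0 i1 u.
Definition min1 u := b i0 i0 u * g i1 i1 u - g i0 i0 u * b i1 i1 u.
Definition min2 u := b i0 i1 u * g i1 i1 u - g i0 i1 u * b i1 i1 u.

Lemma discr_minors u : U u ->
  G u * G u * (t u * t u - 4 * h u) = min1 u * min1 u - 4 * min0 u * min2 u.
Proof.
move=> Uu; rewrite /ft /fh /min0 /min1 /min2; have := G0 Uu; rewrite /fG.
move: (b i0 i0 u) (b i0 i1 u) (b i1 i1 u) (g i0 i0 u) (g i0 i1 u) (g i1 i1 u) => *.
by field.
Qed.

Hypothesis t_const : forall u m, U u -> pd m t u = 0.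
Hypothesis h_const : forall u m, U u -> pd m h u = 0.
Hypothesis discr : forall u, U u -> t u * t u - 4 * h u != 0.

Lemma minors_neq0 u : U u -> min1 u * min1 u - 4 * min0 u * min2 u != 0.
Proof. by move=> Uu; rewrite -discr_minors// !mulf_neq0 ?G0 ?discr. Qed.

(** The covariant derivative of the second fundamental form is a symmetric cubic form,
    by Codazzi; that tr S and det S are constant makes it apolar to both fundamental
    forms. *)
Lemma Db_eq0 k j r u : U u -> Db k j r u = 0.
Proof.
move=> Uu.
have A k' := pd_t H k' Uu; have B k' := pd_h H k' Uu.
have := A i0; have := B i0; have := A i1; have := B i1.
rewrite !t_const// !h_const// !mulr0 (DbC H i1 i0 i0 Uu) (DbC H i1 i0 i1 Uu).
rewrite (DbC23 H i0 i1 i0 Uu) => B1 A1 B0 A0.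
have [T0 T1 T2 T3] := apolar_eq0 (minors_neq0 Uu) A0 B0 A1 B1.
case: (ord2E k) => ->; case: (ord2E j) => ->; case: (ord2E r) => -> //;
  rewrite ?(DbC23 H i0 i1 i0 Uu) ?(DbC23 H i1 i1 i0 Uu) ?(DbC H i1 i0 _ Uu) ?(DbC23 H i0 i1 i0 Uu) //.
Qed.

(** The third fundamental form. *)
Definition SB k j u := S0 j u * b i0 k u + S1 j u * b i1 k u.

Lemma n_kj k j u : U u -> pd k (pd j n) u = gam0 k j u *: pd i0 n u + gam1 k j u *: pd i1 n u
  - (eps * SB k j u) *: n u + (c * b k j u) *: x u.
Proof.
move=> Uu; apply/eqP; rewrite -subr_eq0; apply/eqP; apply: (frame_ext H Uu).
- rewrite !dot_lin (ip_nkj_xr H)// ![dot c (pd _ n u) _]dotC !(ip_xi_nj H)//.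
  rewrite (patch_nt H)// [dot c (x u) _]dotC (ip_xi_x H)//.
  by apply: (lincomb (congr1 -%R (Db_eq0 k j i0 Uu))); rewrite /Db; ring.
- rewrite !dot_lin (ip_nkj_xr H)// ![dot c (pd _ n u) _]dotC !(ip_xi_nj H)//.
  rewrite (patch_nt H)// [dot c (x u) _]dotC (ip_xi_x H)//.
  by apply: (lincomb (congr1 -%R (Db_eq0 k j i1 Uu))); rewrite /Db; ring.
- rewrite !dot_lin (ip_nkj_n H)// ![dot c (pd _ n u) _]dotC !(ip_n_ni H)// [dot c (x u) _]dotC.
  rewrite (patch_nn H)// (patch_nx H)// /SB.
  by apply: (lincomb (congr1 (fun p => p * SB k j u) he)); rewrite /SB; ring.
- rewrite !dot_lin (ip_nkj_x H)// !(ip_ni_x H)// (patch_nx H)// (patch_xx H)//.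
  by apply: (lincomb (congr1 (fun p => - p * b k j u) hc)); ring.
Qed.

Lemma smooth_gam0 k j : smooth_on U (gam0 k j).
Proof.
have sC m : smooth_on U (fC c x k j m) by apply: smooth_dot => //; apply: smooth_pd.
have := smooth_g H; have := smooth_Ginv H => sG sg.
by apply: smooth_mul => //; apply: smooth_subr => //; apply: smooth_mul.
Qed.

Lemma smooth_gam1 k j : smooth_on U (gam1 k j).
Proof.
have sC m : smooth_on U (fC c x k j m) by apply: smooth_dot => //; apply: smooth_pd.
have := smooth_g H; have := smooth_Ginv H => sG sg.
by apply: smooth_mul => //; apply: smooth_subr => //; apply: smooth_mul.
Qed.

Lemma smooth_S0 k : smooth_on U (S0 k).
Proof.
have := smooth_g H; have := smooth_Ginv H; have := smooth_b H => sb sG sg.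
by apply: smooth_mul => //; apply: smooth_subr => //; apply: smooth_mul.
Qed.

Lemma smooth_S1 k : smooth_on U (S1 k).
Proof.
have := smooth_g H; have := smooth_Ginv H; have := smooth_b H => sb sG sg.
by apply: smooth_mul => //; apply: smooth_subr => //; apply: smooth_mul.
Qed.

Let sdot (F : E -> 'rV[R]_4) a : smooth_on U F -> smooth_on U (fun v => dot c (F v) a).
Proof. by move=> sF; apply: smooth_dot => //; exact: smooth_cst. Qed.

(** The product rule, tested against a vector a, for the right-hand side of a Gauss
    formula for the second derivatives of x or of n. *)
Lemma third_derivative (Y F0 F1 : E -> 'rV[R]_4) (p q s w : E -> R) i a u :
  smooth_on U F0 -> smooth_on U F1 -> smooth_on U p -> smooth_on U q -> smooth_on U s ->
  smooth_on U w -> smooth_on U Y ->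
  (forall v, U v -> Y v = p v *: F0 v + q v *: F1 v + s v *: n v + w v *: x v) -> U u ->
  dot c (pd i Y u) a = pd i p u * dot c (F0 u) a + p u * dot c (pd i F0 u) a
   + pd i q u * dot c (F1 u) a + q u * dot c (pd i F1 u) a
   + pd i s u * dot c (n u) a + s u * dot c (pd i n u) a
   + pd i w u * dot c (x u) a + w u * dot c (pd i x u) a.
Proof.
move=> sF0 sF1 sp sq ss sw sY YE Uu.
have e v : U v -> dot c (Y v) a = p v * dot c (F0 v) a + q v * dot c (F1 v) a + s v * dot c (n v) a + w v * dot c (x v) a.
  by move=> Uv; rewrite YE// !dot_lin.
have := is_partial_unique oU Uu e (P i (sdot a sY) Uu) (is_partial_add (is_partial_add (is_partial_add
  (is_partial_mul (P i sp Uu) (P i (sdot a sF0) Uu)) (is_partial_mul (P i sq Uu) (P i (sdot a sF1) Uu)))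
  (is_partial_mul (P i ss Uu) (P i (sdot a sn) Uu))) (is_partial_mul (P i sw Uu) (P i (sdot a sx) Uu))).
by rewrite (pd_dotl _ _ sY Uu) (pd_dotl _ _ sF0 Uu) (pd_dotl _ _ sF1 Uu) (pd_dotl _ _ sn Uu) (pd_dotl _ _ sx Uu) => ->; ring.
Qed.

Let sSB k j : smooth_on U (SB k j).
Proof.
have := smooth_b H => sb.
by apply: smooth_add => //; apply: smooth_mul => //; [exact: smooth_S0|exact: smooth_S1].
Qed.

(** The Gauss equation, for a parallel second fundamental form: the curvature
    computed from x and the one computed from n agree, which forces flatness. *)
Lemma gauss_flat u : U u -> eps * h u + c = 0.
Proof.
move=> Uu.
have sgx := smooth_gam0; have sgy := smooth_gam1; have sb := smooth_b H; have sg := smooth_g H.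
have ex k j v : U v -> pd k (X j) v = gam0 k j v *: X i0 v + gam1 k j v *: X i1 v
   + (eps * b k j v) *: n v + (- c * g k j v) *: x v.
  by move=> Uv; rewrite (gauss H)// mulNr scaleNr.
have en k j v : U v -> pd k (pd j n) v = gam0 k j v *: pd i0 n v + gam1 k j v *: pd i1 n v
   + (- eps * SB k j v) *: n v + (c * b k j v) *: x v.
  by move=> Uv; rewrite n_kj// !mulNr scaleNr.
have sZ (p : R) (f : E -> R) : smooth_on U f -> smooth_on U (fun v => p * f v).
  by move=> sf; apply: smooth_mul => //; exact: smooth_cst.
have Tx i k j a := third_derivative i a (sx' i0) (sx' i1) (sgx k j) (sgy k j) (sZ eps _ (sb k j))
  (sZ (- c) _ (sg k j)) (smooth_pd k (sx' j)) (ex k j) Uu.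
have Tn i k j a := third_derivative i a (sn' i0) (sn' i1) (sgx k j) (sgy k j) (sZ (- eps) _ (sSB k j))
  (sZ c _ (sb k j)) (smooth_pd k (sn' j)) (en k j) Uu.
have swx j a : dot c (pd i0 (pd i1 (X j)) u) a = dot c (pd i1 (pd i0 (X j)) u) a.
  by rewrite (schwarz_rV i0 i1 oU (sx' j) Uu).
have swn j a : dot c (pd i0 (pd i1 (pd j n)) u) a = dot c (pd i1 (pd i0 (pd j n)) u) a.
  by rewrite (schwarz_rV i0 i1 oU (sn' j) Uu).
have Ex j r := swx j (X r u); have En j r := swn j (X r u).
have bS i m := fb_S H i m Uu.
have SBE k j : SB k j u = t u * b k j u - h u * g k j u.
  rewrite /SB /ft /fh /fS0 /fS1; have := G0 Uu; rewrite /fG.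
  case: (ord2E k) => ->; case: (ord2E j) => ->; rewrite ?(fbC H i1 i0 Uu) ?(fgC i1 i0);
  move: (b i0 i0 u) (b i0 i1 u) (b i1 i1 u) (g i0 i0 u) (g i0 i1 u) (g i1 i1 u) => *; by field.
have key j r : (eps * h u + c) * (b i1 j u * g i0 r u - g i1 j u * b i0 r u - b i0 j u * g i1 r u + g i0 j u * b i1 r u) = 0.
  have E0 := Ex j i0; have E1 := Ex j i1; have E2 := En j r.
  have nX m : dot c (n u) (X m u) = 0 by exact: (patch_nt H).
  have xX m : dot c (x u) (X m u) = 0 by rewrite dotC (ip_xi_x H).
  have niX i m : dot c (pd i n u) (X m u) = - b m i u by rewrite dotC (ip_xi_nj H).
  have nijX i l m : dot c (pd i (pd l n) u) (X m u) = - (gam0 i l u * b m i0 u + gam1 i l u * b m i1 u).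
    by rewrite n_kj// !dot_lin !niX nX xX; ring.
  have XijX i l m : dot c (pd i (X l) u) (X m u) = gam0 i l u * g i0 m u + gam1 i l u * g i1 m u.
    by rewrite -(fC_gam H).
  have gE i m : dot c (pd i x u) (X m u) = g i m u by [].
  rewrite !Tx !nX !xX !niX !XijX !gE in E0 E1; rewrite !Tn !nX !xX !niX !nijX !gE in E2.
  (* the components of the curvature tensor, common to both formulas, get eliminated *)
  pose q0 := pd i0 (gam0 i1 j) u - pd i1 (gam0 i0 j) u + gam0 i1 j u * gam0 i0 i0 u
    + gam1 i1 j u * gam0 i0 i1 u - gam0 i0 j u * gam0 i1 i0 u - gam1 i0 j u * gam0 i1 i1 u
    - c * g i1 j u.
  pose q1 := pd i0 (gam1 i1 j) u - pd i1 (gam1 i0 j) u + gam0 i1 j u * gam1 i0 i0 u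
    + gam1 i1 j u * gam1 i0 i1 u - gam0 i0 j u * gam1 i1 i0 u - gam1 i0 j u * gam1 i1 i1 u
    + c * g i0 j u.
  apply: (lincomb (congr2 (fun p q => p + q)
    (congr2 (fun p q => p + q) (congr2 (fun p q => S0 r u * p + S1 r u * q) E0 E1) E2)
    (congr2 (fun p q => p + q) (congr2 (fun p q => q0 * p + q1 * q) (bS r i0) (bS r i1))
      (congr2 (fun p q => p + q)
        (congr2 (fun p q => eps * b i1 j u * p - eps * b i0 j u * q) (SBE i0 r) (SBE i1 r))
        (congr2 (fun p q => eps * b r i1 u * p - eps * b r i0 u * q) (SBE i0 j) (SBE i1 j)))))).
  rewrite /q0 /q1 /SB /=; move: (pd i0 (gam0 i1 j) u) (pd i1 (gam0 i0 j) u) (pd i0 (gam1 i1 j) u) (pd i1 (gam1 i0 j) u) => *.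
  move: {E0 E1 E2} (t u) (h u); case: (ord2E j) => ->; case: (ord2E r) => ->;
  rewrite ?(fbC H i1 i0 Uu) ?(fgC i1 i0); have [-> ->] := gamC H i1 i0 Uu;
  move: (b i0 i0 u) (b i0 i1 u) (b i1 i1 u) (g i0 i0 u) (g i0 i1 u) (g i1 i1 u)
    (gam0 i0 i0 u) (gam0 i0 i1 u) (gam0 i1 i1 u) (gam1 i0 i0 u) (gam1 i0 i1 u) (gam1 i1 i1 u)
    (S0 i0 u) (S1 i0 u) (S0 i1 u) (S1 i1 u) => *; ring.
apply/eqP; apply: contraNT (minors_neq0 Uu) => n0; apply/eqP.
have k00 := key i0 i0; have k01 := key i0 i1; have k11 := key i1 i1.
rewrite ?(fbC H i1 i0 Uu) ?(fgC i1 i0) in k00 k01 k11.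
have m0 : min0 u = 0 by apply: (mulfI n0); apply: (lincomb (congr1 (fun p => - p / 2) k00)); rewrite /min0 /=; field.
have m1 : min1 u = 0 by apply: (mulfI n0); apply: (lincomb (congr1 -%R k01)); rewrite /min1 /=; ring.
by rewrite m0 m1; ring.
Qed.

End ConstantCurvatures.

(** * The focal map of a surface with two constant principal curvatures *)

Section Isoparametric.
Context {R : realType}.
Local Notation E := 'rV[R]_2.
Context {c eps : R} {U : set E} {x n : E -> 'rV[R]_4}.
Hypothesis H : immersed_patch c eps U x n.
Let hc := patch_c H.
Let he := patch_eps H.
Let oU := patch_open H.
Let sx := patch_x H.
Let sn := patch_n H.
Let G0 := patch_G H.
Local Notation g := (fg c x).
Local Notation b := (fb c x n).
Local Notation G := (fG c x).
Local Notation gam0 := (gam0 c x).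
Local Notation gam1 := (gam1 c x).
Local Notation t := (ft c x n).
Local Notation h := (fh c x n).
Local Notation S0 := (fS0 c x n).
Local Notation S1 := (fS1 c x n).
Local Notation SB := (SB (c := c) (x := x) (n := n)).
Local Notation X i := (pd i x).
Implicit Types (i j k m r : 'I_2) (a d : 'rV[R]_4) (f : E -> R).
Let P m f' u (sf' : smooth_on U f') (Uu : U u) := is_partial_smooth m sf' Uu.
Let K m (p : R) (u : E) := is_partial_cst m p u.

Lemma SBE k j u : U u -> SB k j u = t u * b k j u - h u * g k j u.
Proof.
move=> Uu; rewrite /SB /ft /fh /fS0 /fS1; have := G0 Uu; rewrite /fG.
case: (ord2E k) => ->; case: (ord2E j) => ->; rewrite ?(fbC H i1 i0 Uu) ?(fgC i1 i0);
move: (b i0 i0 u) (b i0 i1 u) (b i1 i1 u) (g i0 i0 u) (g i0 i1 u) (g i1 i1 u) => *; by field.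
Qed.

(** The inverse metric paired with two covectors. *)
Definition copair p0 p1 q0 q1 u : R :=
  (g i1 i1 u * (p0 * q0) - g i0 i1 u * (p0 * q1 + p1 * q0) + g i0 i0 u * (p1 * q1)) / G u.

Definition gradpair f f' u := copair (pd i0 f u) (pd i1 f u) (pd i0 f' u) (pd i1 f' u) u.

Lemma smooth_gradpair f f' : smooth_on U f -> smooth_on U f' -> smooth_on U (gradpair f f').
Proof.
move=> sf sf'; have sg := smooth_g H; have sG := smooth_Ginv H.
have sp i : smooth_on U (pd i f) by exact: smooth_pd.
have sp' i : smooth_on U (pd i f') by exact: smooth_pd.
apply: smooth_mul => //; apply: smooth_add => //; first apply: smooth_subr => //.
- by apply: smooth_mul => //; apply: smooth_mul.
- by apply: smooth_mul => //; apply: smooth_add => //; apply: smooth_mul.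
- by apply: smooth_mul => //; apply: smooth_mul.
Qed.

Lemma pd_gradpair k f f' u : smooth_on U f -> smooth_on U f' -> U u ->
  pd k (gradpair f f') u =
    copair (Hs c x k i0 f u) (Hs c x k i1 f u) (pd i0 f' u) (pd i1 f' u) u
  + copair (pd i0 f u) (pd i1 f u) (Hs c x k i0 f' u) (Hs c x k i1 f' u) u.
Proof.
move=> sf sf' Uu; have Q i j := is_partial_g H k i j Uu.
have Pf i := P k (smooth_pd i sf) Uu; have Pf' i := P k (smooth_pd i sf') Uu.
have E1 v : U v -> gradpair f f' v * G v = g i1 i1 v * (pd i0 f v * pd i0 f' v)
   - g i0 i1 v * (pd i0 f v * pd i1 f' v + pd i1 f v * pd i0 f' v) + g i0 i0 v * (pd i1 f v * pd i1 f' v).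
  by move=> Uv; rewrite /gradpair /copair divfK// G0.
have := is_partial_unique oU Uu E1 (is_partial_mul (P k (smooth_gradpair sf sf') Uu) (is_partial_G H k Uu))
  (is_partial_add (is_partial_sub (is_partial_mul (Q i1 i1) (is_partial_mul (Pf i0) (Pf' i0)))
     (is_partial_mul (Q i0 i1) (is_partial_add (is_partial_mul (Pf i0) (Pf' i1)) (is_partial_mul (Pf i1) (Pf' i0)))))
     (is_partial_mul (Q i0 i0) (is_partial_mul (Pf i1) (Pf' i1)))).
have := E1 u Uu; rewrite !(fC_gam H)// !(fgC i1 i0) => e1 e2.
apply: (mulIf (G0 Uu)); rewrite mulrDl /copair !divfK ?G0//.
apply: (lincomb (congr2 (fun p q => p - 2 * (gam0 k i0 u + gam1 k i1 u) * q) e2 e1)).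
rewrite /Hs /=; move: {e1 e2} (gradpair f f' u) (pd k (gradpair f f') u) (G u).
move: (gam0 k i0 u) (gam0 k i1 u) (gam1 k i0 u) (gam1 k i1 u) (pd k (pd i0 f) u) (pd k (pd i1 f) u)
  (pd k (pd i0 f') u) (pd k (pd i1 f') u).
move: (pd i0 f u) (pd i1 f u) (pd i0 f' u) (pd i1 f' u) (g i0 i0 u) (g i0 i1 u) (g i1 i1 u) => *.
ring.
Qed.

Lemma copair_S k p0 p1 q0 q1 (k2 : R) u : U u ->
  p0 = b k i0 u - k2 * g k i0 u -> p1 = b k i1 u - k2 * g k i1 u ->
  copair p0 p1 q0 q1 u = S0 k u * q0 + S1 k u * q1 - k2 * (if k == i0 then q0 else q1).
Proof.
move=> Uu -> ->; rewrite /copair /fS0 /fS1; have := G0 Uu; rewrite /fG.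
have n10 : (i1 == i0) = false by [].
by case: (ord2E k) => ->; rewrite ?eqxx ?n10 ?(fbC H i1 i0 Uu) ?(fgC i1 i0);
  move: (b i0 i0 u) (b i0 i1 u) (b i1 i1 u) (g i0 i0 u) (g i0 i1 u) (g i1 i1 u) => *; field.
Qed.

Lemma copairC p0 p1 q0 q1 u : copair p0 p1 q0 q1 u = copair q0 q1 p0 p1 u.
Proof. by rewrite /copair; ring. Qed.

Lemma copairZ s p0 p1 q0 q1 u : copair (s * p0) (s * p1) q0 q1 u = s * copair p0 p1 q0 q1 u.
Proof. by rewrite /copair; ring. Qed.

Lemma copair_selfadj p0 p1 q0 q1 (k2 : R) u : U u ->
  copair p0 p1 (S0 i0 u * q0 + S1 i0 u * q1 - k2 * q0) (S0 i1 u * q0 + S1 i1 u * q1 - k2 * q1) u =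
  copair (S0 i0 u * p0 + S1 i0 u * p1 - k2 * p0) (S0 i1 u * p0 + S1 i1 u * p1 - k2 * p1) q0 q1 u.
Proof.
move=> Uu; rewrite /copair /fS0 /fS1 (fbC H i1 i0 Uu).
move: ((G u)^-1) (b i0 i0 u) (b i0 i1 u) (b i1 i1 u) (g i0 i0 u) (g i0 i1 u) (g i1 i1 u) => *; ring.
Qed.

Section TwoCurvatures.
Context {k1 k2 : R}.
Hypothesis t_const : forall u, U u -> t u = k1 + k2.
Hypothesis h_const : forall u, U u -> h u = k1 * k2.
Hypothesis k12 : k1 != k2.

Let t0 u m : U u -> pd m t u = 0.
Proof. by move=> Uu; exact: (is_partial_unique oU Uu t_const (P m (smooth_t H) Uu) (K m _ u)). Qed.
Let h0 u m : U u -> pd m h u = 0.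
Proof. by move=> Uu; exact: (is_partial_unique oU Uu h_const (P m (smooth_h H) Uu) (K m _ u)). Qed.
Let discr u : U u -> t u * t u - 4 * h u != 0.
Proof.
move=> Uu; rewrite t_const// h_const//.
have -> : (k1 + k2) * (k1 + k2) - 4 * (k1 * k2) = (k1 - k2) * (k1 - k2) by ring.
by rewrite mulf_neq0// subr_eq0.
Qed.

(** The focal map has differential -(S - k2), of rank one: it runs along a curve,
    whose velocity is a principal direction for k1. *)
Definition focal v := n v + k2 *: x v.
Let phi a := fun v => dot c (focal v) a.

Lemma smooth_focal : smooth_on U focal.
Proof.
apply: smooth_rV => // j; apply: smooth_ext (smooth_add oU (smooth_coord j oU sn)
  (smooth_mul oU (smooth_cst U k2) (smooth_coord j oU sx))) => // u _.
by rewrite !mxE.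
Qed.

Lemma pd_focal i u : U u -> pd i focal u = pd i n u + k2 *: pd i x u.
Proof.
move=> Uu; apply/rowP => j.
rewrite -partial_coord; last exact: smooth_differentiable smooth_focal Uu.
have := is_partial_add (is_partial_coord i j sn Uu) (is_partial_mul (K i k2 u) (is_partial_coord i j sx Uu)).
move=> [_ E1]; rewrite (pd_ext i (g := fun v => n v 0 j + k2 * x v 0 j) oU)// ?E1 ?mxE; first ring.
by move=> v _; rewrite !mxE.
Qed.

Lemma focalS i u : U u -> pd i focal u = - (S0 i u *: X i0 u + S1 i u *: X i1 u - k2 *: X i u).
Proof. by move=> Uu; rewrite pd_focal// (weingarten H)// opprB addrC. Qed.

Let sphi a : smooth_on U (phi a).
Proof. by apply: smooth_dot => //; [exact: smooth_focal|exact: smooth_cst]. Qed.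

Let pd_phi a i u : U u -> pd i (phi a) u = dot c (pd i focal u) a.
Proof. by move=> Uu; rewrite (pd_dotl _ _ smooth_focal Uu). Qed.

Lemma flat u : U u -> c = - eps * (k1 * k2).
Proof. by move=> Uu; have := gauss_flat H t0 h0 discr Uu; rewrite h_const// => e; apply: (lincomb e); ring. Qed.

Lemma Hs_phi a k j u : U u ->
  Hs c x k j (phi a) u = - eps * k1 * phi a u * (b k j u - k2 * g k j u).
Proof.
move=> Uu.
have snd : pd k (pd j focal) u = pd k (pd j n) u + k2 *: pd k (X j) u.
  apply/rowP => l; rewrite -partial_coord; last exact: smooth_differentiable (smooth_pd j smooth_focal) Uu.
  have [_ E1] := is_partial_add (is_partial_coord k l (smooth_pd j sn) Uu)
    (is_partial_mul (K k k2 u) (is_partial_coord k l (smooth_pd j sx) Uu)).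
  rewrite (pd_ext k (g := fun v => pd j n v 0 l + k2 * pd j x v 0 l) oU)// ?E1 ?mxE; first ring.
  by move=> v Uv; rewrite pd_focal// !mxE.
rewrite /phi (Hs_dotl H a k j smooth_focal Uu) snd (n_kj H t0 h0 discr)// (gauss H)// !pd_focal//.
rewrite !dot_lin SBE// t_const// h_const//.
by apply: (lincomb (congr1 (fun p => p * (b k j u - k2 * g k j u) * dot c (x u) a) (flat Uu))); ring.
Qed.

Lemma S_k1k2 u : U u -> S0 i0 u + S1 i1 u = k1 + k2 /\
  S0 i0 u * S1 i1 u - S1 i0 u * S0 i1 u = k1 * k2.
Proof. by move=> Uu; have [<- <-] := S_trdet H Uu; rewrite t_const// h_const. Qed.

(** S - k2 acts as k1 - k2 on its own image. *)
Lemma S_pd_phi a k u : U u -> S0 k u * pd i0 (phi a) u + S1 k u * pd i1 (phi a) u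
  - k2 * pd k (phi a) u = (k1 - k2) * pd k (phi a) u.
Proof.
move=> Uu; rewrite !pd_phi// !focalS// !dot_lin; have [e1 e2] := S_k1k2 Uu.
have e1' : S1 i1 u = k1 + k2 - S0 i0 u by rewrite -e1; ring.
rewrite e1' in e2 *; case: (ord2E k) => ->; rewrite ?e1';
move: (S0 i0 u) (S1 i0 u) (S0 i1 u) (dot c (X i0 u) a) (dot c (X i1 u) a) e2 => s00 s01 s10 f0 f1 e2.
  by apply: (lincomb (congr1 (fun p => p * f0) e2)); ring.
by apply: (lincomb (congr1 (fun p => p * f1) e2)); ring.
Qed.

(** A parallel symmetric form on the flat space: up to the factor (k1 - k2)^2 it is
    the inner product followed by the projection on the plane of the curve traced
    by the focal map. *)
Definition theta a d u := gradpair (phi a) (phi d) u + eps * k1 * (k1 - k2) * phi a u * phi d u.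

Lemma smooth_theta a d : smooth_on U (theta a d).
Proof.
apply: smooth_add => //; first exact: smooth_gradpair.
by repeat apply: smooth_mul => //; exact: smooth_cst.
Qed.

(** The Hessians of phi a and phi d are multiples of the second fundamental form shifted
    by k2, and the shift by k2 of S multiplies their gradients by k1 - k2. *)
Lemma theta_const a d k u : U u -> pd k (theta a d) u = 0.
Proof.
move=> Uu; have [_ ->] := is_partial_add (P k (smooth_gradpair (sphi a) (sphi d)) Uu)
  (is_partial_mul (is_partial_mul (K k (eps * k1 * (k1 - k2)) u) (P k (sphi a) Uu)) (P k (sphi d) Uu)).
rewrite pd_gradpair// !Hs_phi//.
have W s q0 q1 : copair (s * (b k i0 u - k2 * g k i0 u)) (s * (b k i1 u - k2 * g k i1 u)) q0 q1 u
    = s * (S0 k u * q0 + S1 k u * q1 - k2 * (if k == i0 then q0 else q1)).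
  by rewrite copairZ (copair_S _ _ Uu erefl erefl).
have V f : (if k == i0 then pd i0 f u else pd i1 f u) = pd k f u.
  by case: (ord2E k) => ->; rewrite ?eqxx.
rewrite [copair (pd i0 _ u) _ _ _ _]copairC !W !V !S_pd_phi//; ring.
Qed.

Lemma theta_rep a d u : U u -> theta a d u =
  copair (dot c (pd i0 focal u) a) (dot c (pd i1 focal u) a) (dot c (pd i0 focal u) d) (dot c (pd i1 focal u) d) u
  + eps * k1 * (k1 - k2) * dot c (focal u) a * dot c (focal u) d.
Proof. by move=> Uu; rewrite /theta /gradpair !pd_phi. Qed.

Lemma focal_norm u : U u -> eps * k1 * dot c (focal u) (focal u) = k1 - k2.
Proof.
move=> Uu; rewrite /focal !dot_lin [dot c (x u) (n u)]dotC (patch_nn H)// (patch_nx H)// (patch_xx H)//.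
have e := flat Uu.
apply: (lincomb (congr2 (fun p q => p * k1 + k2 * q) he (congr2 (fun p q => q - p) hc (congr1 (fun p => c * p) e)))).
by rewrite /=; ring.
Qed.

Lemma focal_orth i u : U u -> dot c (pd i focal u) (focal u) = 0.
Proof.
move=> Uu; rewrite focalS// /focal !dot_lin ![dot c (X _ u) (n u)]dotC !(patch_nt H)// !(ip_xi_x H)//; ring.
Qed.

(** On the plane spanned by the focal map and its velocity, theta reproduces the inner
    product up to the factor (k1 - k2)^2. *)
Lemma theta_focal a u : U u -> theta a (focal u) u = (k1 - k2) * (k1 - k2) * dot c (focal u) a.
Proof.
move=> Uu; rewrite theta_rep// !focal_orth//.
by apply: (lincomb (congr1 (fun p => (k1 - k2) * dot c (focal u) a * p) (focal_norm Uu))); rewrite /copair; ring.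
Qed.

(** S - k1 vanishes on the image of S - k2. *)
Lemma focal_eigen u v0 v1 : U u ->
  let w0 := v0 * (S0 i0 u - k2) + v1 * S0 i1 u in
  let w1 := v0 * S1 i0 u + v1 * (S1 i1 u - k2) in
  [/\ v0 *: pd i0 focal u + v1 *: pd i1 focal u = - (w0 *: X i0 u + w1 *: X i1 u),
      w0 * S0 i0 u + w1 * S0 i1 u = k1 * w0 & w0 * S1 i0 u + w1 * S1 i1 u = k1 * w1].
Proof.
move=> Uu w0 w1; have [e1 e2] := S_k1k2 Uu; split.
- rewrite !focalS// /w0 /w1; apply/rowP => j; rewrite !mxE; ring.
- have e1' : S1 i1 u = k1 + k2 - S0 i0 u by rewrite -e1; ring.
  by rewrite /w0 /w1 e1' in e2 *; apply: (lincomb (congr1 (fun p => - v0 * p) e2)); ring.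
- have e1' : S1 i1 u = k1 + k2 - S0 i0 u by rewrite -e1; ring.
  by rewrite /w0 /w1 e1' in e2 *; apply: (lincomb (congr1 (fun p => - v1 * p) e2)); ring.
Qed.

Lemma theta_dfocal a l u : U u -> theta a (pd l focal u) u = (k1 - k2) * (k1 - k2) * dot c (pd l focal u) a.
Proof.
move=> Uu; rewrite theta_rep// [dot c (focal u) (pd l _ u)]dotC focal_orth// mulr0 addr0.
have XF i : dot c (X i u) (pd l focal u) = - (b l i u - k2 * g l i u).
  by rewrite dotC focalS// !dot_lin (fb_S H) //; ring.
have FF m : dot c (pd m focal u) (pd l focal u) = S0 m u * (b l i0 u - k2 * g l i0 u)
    + S1 m u * (b l i1 u - k2 * g l i1 u) - k2 * (b l m u - k2 * g l m u).
  by rewrite (focalS m Uu) !dot_lin !XF; ring.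
rewrite !FF copair_selfadj// -!pd_phi// !S_pd_phi//.
rewrite copairZ copairC (copair_S _ _ Uu erefl erefl).
have V f : (if l == i0 then pd i0 f u else pd i1 f u) = pd l f u.
  by case: (ord2E l) => ->; rewrite ?eqxx.
by rewrite V S_pd_phi//; ring.
Qed.

End TwoCurvatures.
End Isoparametric.

(** * The discriminant of S *)

Section ComplexCurvatures.
Context {R : realType}.
Local Notation E := 'rV[R]_2.
Context {c eps : R} {U : set E} {x n : E -> 'rV[R]_4}.
Hypothesis H : immersed_patch c eps U x n.
Let hc := patch_c H.
Let he := patch_eps H.
Let oU := patch_open H.
Let sx := patch_x H.
Let c0 := patch_c0 H.
Let e0 := patch_eps0 H.
Local Notation g := (fg c x).
Local Notation b := (fb c x n).
Local Notation min0 := (min0 (c := c) (x := x) (n := n)).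
Local Notation min1 := (min1 (c := c) (x := x) (n := n)).
Local Notation min2 := (min2 (c := c) (x := x) (n := n)).
Local Notation t := (ft c x n).
Local Notation h := (fh c x n).
Context {a0 : 'rV[R]_4} {y1 y2 : E -> 'rV[R]_4} {l1 l2 : R}.
Hypothesis sy1 : smooth_on U y1.
Hypothesis sy2 : smooth_on U y2.
Hypothesis xy : forall u, U u -> x u = a0 + y1 u + y2 u.
Hypothesis eig1 : forall u (j : 'I_4), U u -> L1 c eps x n (fun v => y1 v 0 j) u = l1 * y1 u 0 j.
Hypothesis eig2 : forall u (j : 'I_4), U u -> L1 c eps x n (fun v => y2 v 0 j) u = l2 * y2 u 0 j.
Context {t0 h0 : R}.
Hypothesis t_const : forall u, U u -> t u = t0.
Hypothesis h_const : forall u, U u -> h u = h0.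
Hypothesis discr : t0 * t0 - 4 * h0 != 0.
Local Notation mu := (l1 * l2).
Local Notation La := (l1 + l2).
Local Notation f := (fun v => dot c (x v) a0).
Local Notation gg := (fun v => dot c (n v) a0).
Implicit Types (i j k m r : 'I_2).

Let dt u m : U u -> pd m t u = 0.
Proof. by move=> Uu; exact: (is_partial_unique oU Uu t_const (is_partial_smooth m (smooth_t H) Uu) (is_partial_cst m _ u)). Qed.
Let dh u m : U u -> pd m h u = 0.
Proof. by move=> Uu; exact: (is_partial_unique oU Uu h_const (is_partial_smooth m (smooth_h H) Uu) (is_partial_cst m _ u)). Qed.
Let discru u : U u -> t u * t u - 4 * h u != 0.
Proof. by move=> Uu; rewrite t_const// h_const. Qed.

Let df m u : U u -> mu * pd m f u = 0.
Proof.
move=> Uu; rewrite -(two_type_tangent H sy1 sy2 xy eig1 eig2 m Uu) !dt// !dh//; ring.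
Qed.

(** The function mu <x, a0> has zero differential, hence zero Hessian, which
    is a combination of the two independent fundamental forms. *)
Lemma const_components u : U u -> mu * f u = 0 /\ mu * gg u = 0.
Proof.
move=> Uu.
have sf : smooth_on U f by apply: smooth_dot => //; exact: smooth_cst.
have d2 k j : mu * pd k (pd j f) u = 0.
  have [_ e] := is_partial_mul (is_partial_cst k mu u) (is_partial_smooth k (smooth_pd j sf) Uu).
  have z : pd k (fun=> 0 : R) u = 0 by have [] := is_partial_cst k (0 : R) u.
  by move: e; rewrite (pd_ext k oU (fun v => @df j v) Uu) z => ->; ring.
have Hf k j : mu * (eps * b k j u * gg u - c * g k j u * f u) = 0.
  rewrite -(Hs_x H)// /Hs; apply: (lincomb (congr2 (fun p q => p - q) (d2 k j)
    (congr2 (fun p q => gam0 c x k j u * p + gam1 c x k j u * q) (df i0 Uu) (df i1 Uu)))).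
  by rewrite /=; ring.
have h00 := Hf i0 i0; have h01 := Hf i0 i1; have h11 := Hf i1 i1.
have n0 := minors_neq0 H discru Uu.
have Z (z : R) : z * min0 u = 0 -> z * min1 u = 0 -> z * min2 u = 0 -> z = 0.
  move=> z0 z1 z2; apply: (mulIf n0); rewrite mul0r.
  by apply: (lincomb (congr2 (fun p q => p * min1 u - 4 * min0 u * q) z1 z2)); rewrite /=; ring.
split.
  apply: (mulfI c0); rewrite mulr0; apply: Z; rewrite /min0 /min1 /min2.
  - by apply: (lincomb (congr2 (fun p q => p * b i0 i1 u - q * b i0 i0 u) h00 h01)); rewrite /=; ring.
  - by apply: (lincomb (congr2 (fun p q => p * b i1 i1 u - q * b i0 i0 u) h00 h11)); rewrite /=; ring.
  - by apply: (lincomb (congr2 (fun p q => p * b i1 i1 u - q * b i0 i1 u) h01 h11)); rewrite /=; ring.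
apply: (mulfI e0); rewrite mulr0; apply: Z; rewrite /min0 /min1 /min2.
- by apply: (lincomb (congr2 (fun p q => p * g i0 i1 u - q * g i0 i0 u) h00 h01)); rewrite /=; ring.
- by apply: (lincomb (congr2 (fun p q => p * g i1 i1 u - q * g i0 i0 u) h00 h11)); rewrite /=; ring.
- by apply: (lincomb (congr2 (fun p q => p * g i1 i1 u - q * g i0 i1 u) h01 h11)); rewrite /=; ring.
Qed.

(** Constant principal curvatures of a two-type surface are not complex: by
    flatness the two eigenvalues of the two-type condition are opposite, and the
    discriminant of S is their common square. *)
Lemma discr_square u : U u -> t0 * t0 - 4 * h0 = l1 * l1.
Proof.
move=> Uu; have [mf mg] := const_components Uu.
have fl := gauss_flat H dt dh discru Uu.
have eN := two_type_normal H sy1 sy2 xy eig1 eig2 Uu.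
have eX := two_type_position H sy1 sy2 xy eig1 eig2 Uu.
rewrite (LL_zero H (fun v m => @dh v m) Uu) t_const// h_const// in eN fl.
rewrite (LL_zero H (fun v m => @dt v m) Uu) t_const// h_const// in eX.
have h00 : h0 != 0.
  by apply: contra_eq_neq fl => ->; rewrite mulr0 add0r.
have La0 : La = 0.
  apply: (mulfI (mulf_neq0 e0 h00)); rewrite mulr0.
  apply: (lincomb (congr2 (fun p q => p + q) (congr1 (fun p => p / 2) eN) (congr2 (fun p q => eps / 2 * p + (t0 * h0) * q) mg
    (congr2 (fun p q => eps * p - h0 * q) fl he)))).
  by rewrite /=; field.
have l2E : l2 = - l1 by apply: (lincomb La0); ring.
rewrite l2E in eX mf *.
apply: (lincomb (congr2 (fun p q => p + q) eX (congr2 (fun p q => c * p - 4 * h0 * q) mf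
   (congr2 (fun p q => c * p - q) fl hc)))).
by rewrite /=; ring.
Qed.

End ComplexCurvatures.

Section Umbilic.
Context {R : realType}.

(** After subtracting k g from b the trace and the determinant vanish; in a definite
    metric the product p r of the diagonal entries is then both a square and
    nonpositive. *)
Lemma umbilic_definite (g00 g01 g11 b00 b01 b11 k : R) : 0 < g00 -> 0 < g00 * g11 - g01 * g01 ->
  b11 * g00 - 2 * b01 * g01 + b00 * g11 = 2 * k * (g00 * g11 - g01 * g01) ->
  b00 * b11 - b01 * b01 = k * k * (g00 * g11 - g01 * g01) ->
  [/\ b00 = k * g00, b01 = k * g01 & b11 = k * g11].
Proof.
move=> g0 G0 et eh.
pose p := b00 - k * g00; pose q := b01 - k * g01; pose r := b11 - k * g11.
have e1 : r * g00 - 2 * q * g01 + p * g11 = 0 by apply: (lincomb et); rewrite /p /q /r; ring.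
have e2 : p * r = q * q.
  by apply: (lincomb (congr2 (fun x y => y - k * x) et eh)); rewrite /p /q /r /=; ring.
have z : p * r = 0.
  have s1 : 0 <= p * r by rewrite e2 -expr2 sqr_ge0.
  have s2 : (g00 * g11 - g01 * g01) * (p * r) <= 0.
    have -> : (g00 * g11 - g01 * g01) * (p * r) = - ((r * g00 - p * g11) / 2) ^+ 2.
      apply: (lincomb (congr2 (fun x y => (r * g00 + p * g11 + 2 * q * g01) / 4 * x - g01 * g01 * y) e1 e2)).
      by rewrite /=; field.
    by rewrite oppr_le0 sqr_ge0.
  by apply/eqP; rewrite eq_le s1 andbT -(pmulr_rle0 _ G0).
have q0 : q = 0 by apply/eqP; move: z; rewrite e2 => /eqP; rewrite mulf_eq0 orbb.
have g11p : 0 < g11.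
  rewrite -(pmulr_rgt0 _ g0); apply: lt_le_trans G0 _; rewrite gerBl -expr2; exact: sqr_ge0.
have [p0 r0] : p = 0 /\ r = 0.
  move: e1; rewrite q0 mulr0 mul0r subr0 => e1.
  move/eqP: z; rewrite mulf_eq0 => /orP[] /eqP z; rewrite z ?mul0r ?addr0 ?add0r in e1 *; split=> //;
    by apply/eqP; move/eqP: e1; rewrite mulf_eq0 ?(gt_eqF g0) ?(gt_eqF g11p) orbF.
by split; apply/eqP; rewrite -subr_eq0; apply/eqP.
Qed.

End Umbilic.

(** * Functions on a connected surface *)

Section ConnectedSurface.
Context {R : realType} {M : topologicalType} {A : set (chart R M)}.
Local Notation E := 'rV[R]_2.
Implicit Types (phi chi : chart R M) (p : M).

Lemma open_cmap_preimage phi (D : set E) p : open D -> cdom phi p -> D (cmap phi p) ->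
  \forall q \near p, cdom phi q /\ D (cmap phi q).
Proof.
move=> oD dp Dp; near=> q; split; near: q.
  by apply: open_nbhs_nbhs; split=> //; exact: open_cdom.
by apply: (continuous_cmap dp); exact: open_nbhs_nbhs.
Unshelve. all: by end_near. Qed.

Lemma open_overlap phi chi : open (overlap phi chi).
Proof.
rewrite openE => u [Uu Du]; rewrite /interior.
near=> v; split; near: v; first by apply: open_nbhs_nbhs; split=> //; exact: open_cimg.
by apply: (continuous_cinv Uu); apply: open_nbhs_nbhs; split=> //; exact: open_cdom.
Unshelve. all: by end_near. Qed.

Lemma root_isolated (q : {poly R}) (v : R) : q != 0 ->
  exists2 d, 0 < d & forall y, `|v - y| < d -> q.[y] = 0 -> y = v.
Proof.
move=> q0; have [m [q' q'v qE]] := multiplicity_XsubC q v.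
rewrite q0 /= /root in q'v.
have : \forall y \near v, q'.[y] != 0.
  have cq : {for v, continuous (horner q')} by exact: continuous_horner.
  have /cvgrPdist_lt/(_ `|q'.[v]|) := cq; rewrite normr_gt0 => /(_ q'v).
  apply: filterS => y; apply: contraTneq => ->; by rewrite subr0 ltxx.
move=> /nbhs_ballP[d /= d0 dv]; exists d => // y yd; rewrite qE hornerM horner_exp !hornerE.
move/eqP; rewrite mulf_eq0 (negbTE (dv _ _)) /=; last by rewrite -ball_normE.
by rewrite expf_eq0 subr_eq0 => /andP[_ /eqP].
Qed.

(** A level of F where q does not vanish is open, since grad F = 0 around it; if q
    vanishes on all values of F, these are isolated. Some level is thus open and closed.
    The function is given in charts, with values that do not depend on the chart. *)
Lemma constant_of_gradient (F : chart R M -> E -> R) (q : {poly R}) :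
  connected [set: M] -> (forall p, exists2 phi, A phi & cdom phi p) ->
  (forall phi, A phi -> smooth_on (cimg phi) (F phi)) ->
  (forall phi chi p, A phi -> A chi -> cdom phi p -> cdom chi p ->
     F phi (cmap phi p) = F chi (cmap chi p)) ->
  q != 0 ->
  (forall phi u i, A phi -> cimg phi u -> q.[F phi u] * pd i (F phi) u = 0) ->
  exists v, forall phi p, A phi -> cdom phi p -> F phi (cmap phi p) = v.
Proof.
move=> cM cov sF agree q0 qF.
have [[p0 _]|noM] := pselect (exists p0 : M, True); last first.
  by exists 0 => phi p; exfalso; apply: noM; exists p.
have /choice[ch chP] : forall p, exists phi, A phi /\ cdom phi p.
  by move=> p; have [phi] := cov p; exists phi.
pose f p := F (ch p) (cmap (ch p) p).
have fE phi p : A phi -> cdom phi p -> F phi (cmap phi p) = f p.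
  by move=> Aphi dp; have [Ac dc] := chP p; exact: agree.
have cf p : {for p, continuous f}.
  have [Ac dc] := chP p.
  have cc : {for p, continuous (F (ch p) \o cmap (ch p))}.
    apply: continuous_comp; first exact: continuous_cmap.
    exact: smooth_continuous (sF _ Ac) (cmap_cimg dc).
  change (f @ p --> F (ch p) (cmap (ch p) p)); apply: cvg_trans cc.
  apply: near_eq_cvg; near=> r => /=; rewrite fE//.
  by near: r; apply: open_nbhs_nbhs; split=> //; exact: open_cdom.
have stuck v : (exists2 p, f p = v & q.[v] != 0) \/ (forall p, q.[f p] = 0) ->
    open [set p | f p = v].
  move=> alt; rewrite openE => p /= fpv; rewrite /interior.
  have [qv|qv] := eqVneq q.[v] 0.
    have all0 r : q.[f r] = 0 by case: alt => [[? _]|]; [rewrite qv eqxx|exact].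
    have [d d0 dv] := root_isolated v q0.
    have /cvgrPdist_lt/(_ _ d0) := cf p; rewrite fpv.
    by apply: filterS => r rd /=; exact: dv.
  have [Ac dc] := chP p; set phi := ch p in Ac dc.
  have Uu := cmap_cimg dc.
  have Fu : F phi (cmap phi p) = v by rewrite fE.
  have : \forall w \near cmap phi p, cimg phi w /\ q.[F phi w] != 0.
    near=> w; split; near: w; first by apply: open_nbhs_nbhs; split=> //; exact: open_cimg.
    have cq : {for cmap phi p, continuous (horner q \o F phi)}.
      by apply: continuous_comp; [exact: smooth_continuous (sF _ Ac) Uu|exact: continuous_horner].
    have /cvgrPdist_lt/(_ `|q.[v]|) := cq; rewrite normr_gt0 => /(_ qv).
    by apply: filterS => y /=; rewrite Fu; apply: contraTneq => ->; rewrite subr0 ltxx.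
  move=> /nbhs_ballP[r /= r0 rB].
  have := @open_cmap_preimage phi (ball (cmap phi p) r) p (ball_open _ _) dc (ballxx _ r0).
  apply: filterS => x [dx Bx] /=; rewrite -(fE phi)// -Fu.
  apply: (zero_partials_ball _ _ Bx) => w; first by move=> /rB[Uw _]; exact: smooth_differentiable (sF _ Ac) Uw.
  move=> i /rB[Uw qw]; rewrite -pdE; apply/eqP; move/eqP: (qF _ _ i Ac Uw).
  by rewrite mulf_eq0 (negbTE qw).
have closedW v : closed [set p | f p = v].
  have -> : [set p | f p = v] = f @^-1` [set v] by [].
  by apply: closed_comp => [p _|]; [exact: cf|exact: closed_eq].
have clopen v p : f p = v -> open [set p | f p = v] -> forall r, f r = v.
  move=> fp oW r.
  have : [set p | f p = v] = [set: M].
    apply: cM; first by exists p.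
      by exists [set p | f p = v] => //; rewrite setTI.
    by exists [set p | f p = v] => //; rewrite setTI.
  by move/seteqP => [_ /(_ r I)].
have [[p1 qp1]|allz] := pselect (exists p, q.[f p] != 0).
  exists (f p1) => phi p Aphi dp; rewrite fE//; apply: (clopen _ p1) => //.
  by apply: stuck; left; exists p1.
exists (f p0) => phi p Aphi dp; rewrite fE//; apply: (clopen _ p0) => //.
apply: stuck; right => r; apply/eqP; apply: contra_notT allz => qr; by exists r.
Unshelve. all: by end_near. Qed.

(** The change of charts acts linearly on first derivatives, by the same matrix for
    all functions. *)
Lemma chart_change phi chi p : compatible A A -> A phi -> A chi -> cdom phi p -> cdom chi p ->
  exists T : 'I_2 -> 'I_2 -> R, forall m (F : M -> 'rV[R]_m), smooth A F -> forall i,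
    pd i (F \o cinv phi) (cmap phi p) =
      T i i0 *: pd i0 (F \o cinv chi) (cmap chi p) + T i i1 *: pd i1 (F \o cinv chi) (cmap chi p).
Proof.
move=> cA Aphi Achi dp dq.
have [sT _] := cA _ _ Aphi Achi; set t := transition phi chi in sT.
have Ou : overlap phi chi (cmap phi p) by split; [exact: cmap_cimg|rewrite /= cmapK].
exists (fun i j => pd i t (cmap phi p) 0 j) => m F sF i.
have tu : t (cmap phi p) = cmap chi p by rewrite /t /transition /= cmapK.
have dF : differentiable (F \o cinv chi) (t (cmap phi p)).
  by rewrite tu; apply: smooth_differentiable (sF _ Achi) (cmap_cimg dq).
have dt : differentiable t (cmap phi p) by exact: smooth_differentiable sT Ou.
rewrite (pd_ext i (g := (F \o cinv chi) \o t) (@open_overlap phi chi)) //; last first.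
  by move=> v [Uv Dv] /=; rewrite /t /transition /= cmapK.
rewrite pdE partialE; last exact: differentiable_comp.
rewrite diff_comp //= -partialE// diff_partial// sum2 -!pdE.
by rewrite tu.
Qed.

End ConnectedSurface.

(** * From charts to the surface *)

Section Index.
Context {R : realType}.

Lemma has_index_det (s : nat) (B : 'M[R]_2) : has_index s B ->
  exists2 d : R, d != 0 & d * d * \det B = (if (i0 < s)%N then -1 else 1) * (if (i1 < s)%N then -1 else 1).
Proof.
move=> [Q uQ E]; exists (\det Q); first by rewrite -unitfE -unitmxE.
move/(congr1 determinant): E; rewrite !det_mulmx det_tr mulrAC => ->.
by rewrite det_mx22 !mxE !eqxx (_ : (i0 == i1) = false)// mulr0n mul0r subr0 !mulr1n.
Qed.

Lemma has_index0_pos (B : 'M[R]_2) : has_index 0 B -> 0 < B i0 i0.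
Proof.
move=> [Q uQ E].
have {E} E : B = invmx Q *m (invmx Q)^T.
  have d1 : diag_mx (\row_(i < 2) (if (i < 0)%N then -1 else 1 : R)) = 1%:M.
    by apply/matrixP => i j; rewrite !mxE; case: eqP.
  rewrite d1 in E; rewrite -[LHS](mulKmx uQ) -[B in LHS](mulmxK (_ : Q^T \in unitmx)) ?unitmx_tr//.
  by rewrite (mulmxA Q) (mulmxA Q) E mul1mx trmx_inv.
have : invmx Q i0 i0 != 0 \/ invmx Q i0 i1 != 0.
  have [z0|n0] := eqVneq (invmx Q i0 i0) 0; last by left.
  have [z1|n1] := eqVneq (invmx Q i0 i1) 0; last by right.
  have : \det (invmx Q) != 0 by rewrite -unitfE -unitmxE unitmx_inv.
  by rewrite det_mx22 z0 z1 !mul0r subrr eqxx.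
rewrite E mxE sum2 !mxE => -[] n0.
  by rewrite ltr_pwDl// -expr2 ?exprn_even_gt0 ?sqr_ge0.
by rewrite ltr_wpDl// -expr2 ?exprn_even_gt0 ?sqr_ge0.
Qed.

End Index.

Lemma div_scale (F : fieldType) (D P Q P' Q' : F) : D != 0 -> Q' != 0 ->
  P = D * D * P' -> Q = D * D * Q' -> P / Q = P' / Q'.
Proof. by move=> D0 Q0 -> ->; field; rewrite Q0 D0. Qed.

Lemma copair_change (R : realType) (c : R) (y y' : 'rV[R]_2 -> 'rV[R]_4) u v
    (T : 'I_2 -> 'I_2 -> R) (p0 p1 q0 q1 : R) :
  T i0 i0 * T i1 i1 - T i0 i1 * T i1 i0 != 0 -> fG c y' v != 0 ->
  (forall i j, fg c y i j u = T i i0 * (T j i0 * fg c y' i0 i0 v + T j i1 * fg c y' i0 i1 v)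
                            + T i i1 * (T j i0 * fg c y' i0 i1 v + T j i1 * fg c y' i1 i1 v)) ->
  copair (c := c) (x := y) (T i0 i0 * p0 + T i0 i1 * p1) (T i1 i0 * p0 + T i1 i1 * p1)
    (T i0 i0 * q0 + T i0 i1 * q1) (T i1 i0 * q0 + T i1 i1 * q1) u =
  copair (c := c) (x := y') p0 p1 q0 q1 v.
Proof.
move=> D0 G0 gT; rewrite /copair /fG !gT; move: G0; rewrite /fG => G0.
by apply: (div_scale D0) => //; ring.
Qed.

Section Surface.
Context {R : realType} {M : topologicalType} {A : set (chart R M)} {c eps : R} {s : nat}.
Context {psi N : M -> 'rV[R]_4}.
Hypothesis hc : c = 1 \/ c = -1.
Hypothesis heps : eps = 1 \/ eps = -1.
Hypothesis hM : smooth_surface A.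
Hypothesis hpsi : immersed_in_Mc A c psi s.
Hypothesis hN : unit_normal A c eps psi N.
Local Notation E := 'rV[R]_2.
Implicit Types (phi chi : chart R M) (p : M).
Local Notation X phi := (psi \o cinv phi).
Local Notation Y phi := (N \o cinv phi).

Let sq1 (r : R) : r = 1 \/ r = -1 -> r * r = 1.
Proof. by case=> ->; rewrite ?mulr1 ?mulrN1 ?opprK. Qed.

Lemma patchP phi : A phi -> immersed_patch c eps (cimg phi) (X phi) (Y phi).
Proof.
move=> Aphi; have [spsi hMc himm] := hpsi; have [sN nn nx nt] := hN.
have dx u : cimg phi u -> differentiable (X phi) u.
  by move=> Uu; exact: smooth_differentiable (spsi _ Aphi) Uu.
have dotE' a d : dot c a d = ip c a d by rewrite dot.unlock.
split.
- exact: sq1.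
- exact: sq1.
- exact: open_cimg.
- exact: spsi.
- exact: sN.
- by move=> u _ /=; rewrite dotE'; exact: hMc.
- by move=> u _ /=; rewrite dotE' ?nn ?nx.
- by move=> u _ /=; rewrite dotE' ?nn ?nx.
- by move=> u i Uu; rewrite dotE' -row_jacobian ?rowE; [exact: nt|exact: dx].
- move=> u Uu; have [_ ind] := himm _ _ Aphi Uu.
  rewrite -det_first_formE; last exact: dx.
  have [d d0 dd] := has_index_det ind; apply: contra_eq_neq dd => ->; rewrite mulr0 eq_sym.
  by case: ifP; case: ifP; rewrite ?mulr1 ?mulrN1 ?oppr_eq0 ?oner_eq0// mulN1r oppr_eq0 oner_eq0.
Qed.

Let cov p : exists2 phi, A phi & cdom phi p.
Proof. by have [_ _ _ [cov _]] := hM; exact: cov. Qed.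

Let cA : compatible A A.
Proof. by have [_ _ _ []] := hM. Qed.

Let spsi : smooth A psi. Proof. by have [] := hpsi. Qed.
Let sN : smooth A N. Proof. by have [] := hN. Qed.

Lemma forms_change phi chi p : A phi -> A chi -> cdom phi p -> cdom chi p ->
  exists T : 'I_2 -> 'I_2 -> R, T i0 i0 * T i1 i1 - T i0 i1 * T i1 i0 != 0 /\
   forall i, [/\ pd i (X phi) (cmap phi p) = T i i0 *: pd i0 (X chi) (cmap chi p) + T i i1 *: pd i1 (X chi) (cmap chi p),
    pd i (Y phi) (cmap phi p) = T i i0 *: pd i0 (Y chi) (cmap chi p) + T i i1 *: pd i1 (Y chi) (cmap chi p),
   forall j, fg c (X phi) i j (cmap phi p) =
      T i i0 * (T j i0 * fg c (X chi) i0 i0 (cmap chi p) + T j i1 * fg c (X chi) i0 i1 (cmap chi p))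
    + T i i1 * (T j i0 * fg c (X chi) i0 i1 (cmap chi p) + T j i1 * fg c (X chi) i1 i1 (cmap chi p)) &
   forall j, fb c (X phi) (Y phi) i j (cmap phi p) =
      T i i0 * (T j i0 * fb c (X chi) (Y chi) i0 i0 (cmap chi p) + T j i1 * fb c (X chi) (Y chi) i0 i1 (cmap chi p))
    + T i i1 * (T j i0 * fb c (X chi) (Y chi) i0 i1 (cmap chi p) + T j i1 * fb c (X chi) (Y chi) i1 i1 (cmap chi p))].
Proof.
move=> Aphi Achi dp dq; have [T TP] := chart_change cA Aphi Achi dp dq.
have Hphi := patchP Aphi; have Hchi := patchP Achi.
have Up := cmap_cimg dp; have Uq := cmap_cimg dq.
have gT i j : fg c (X phi) i j (cmap phi p) =
      T i i0 * (T j i0 * fg c (X chi) i0 i0 (cmap chi p) + T j i1 * fg c (X chi) i0 i1 (cmap chi p))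
    + T i i1 * (T j i0 * fg c (X chi) i0 i1 (cmap chi p) + T j i1 * fg c (X chi) i1 i1 (cmap chi p)).
  by rewrite /fg !(TP _ _ spsi) !dot_lin [dot c (pd i1 _ _) (pd i0 _ _)]dotC; ring.
exists T; split.
  apply: contraNneq (patch_G Hphi Up) => D0; rewrite /fG !gT.
  apply/eqP; move: D0; move: (fg c _ i0 i0 _) (fg c _ i0 i1 _) (fg c _ i1 i1 _) (T i0 i0) (T i0 i1) (T i1 i0) (T i1 i1) => g0 g1 g2 a b d e D0.
  by apply: (lincomb (congr1 (fun z => z * (a * e - b * d) * (g0 * g2 - g1 * g1)) D0)); ring.
move=> i; split=> [| |//|j]; [exact: TP|exact: TP|].
have bE chi' i' j' : A chi' -> cdom chi' p -> fb c (X chi') (Y chi') i' j' (cmap chi' p) =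
    - dot c (pd i' (X chi') (cmap chi' p)) (pd j' (Y chi') (cmap chi' p)).
  by move=> A' d'; rewrite (ip_xi_nj (patchP A') i' j' (cmap_cimg d')) opprK.
have := fbC Hchi i1 i0 Uq; rewrite !bE// !(TP _ _ spsi) !(TP _ _ sN) !dot_lin => /oppr_inj e.
by rewrite e; ring.
Qed.

Lemma t_agree phi chi p : A phi -> A chi -> cdom phi p -> cdom chi p ->
  ft c (X phi) (Y phi) (cmap phi p) = ft c (X chi) (Y chi) (cmap chi p).
Proof.
move=> Aphi Achi dp dq; have [T [D0 TP]] := forms_change Aphi Achi dp dq.
have [_ _ g0 b0] := TP i0; have [_ _ g1 b1] := TP i1.
have := patch_G (patchP Achi) (cmap_cimg dq); rewrite /ft /fG !g0 !g1 !b0 !b1; move: D0.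
move: (fg c _ i0 i0 _) (fg c _ i0 i1 _) (fg c _ i1 i1 _) (fb c _ _ i0 i0 _) (fb c _ _ i0 i1 _) (fb c _ _ i1 i1 _)
 (T i0 i0) (T i0 i1) (T i1 i0) (T i1 i1) => a b d e f g h k l m D0 G0; set D := h * m - k * l in D0.
by apply: (div_scale D0) => //; rewrite /D; ring.
Qed.

Lemma h_agree phi chi p : A phi -> A chi -> cdom phi p -> cdom chi p ->
  fh c (X phi) (Y phi) (cmap phi p) = fh c (X chi) (Y chi) (cmap chi p).
Proof.
move=> Aphi Achi dp dq; have [T [D0 TP]] := forms_change Aphi Achi dp dq.
have [_ _ g0 b0] := TP i0; have [_ _ g1 b1] := TP i1.
have := patch_G (patchP Achi) (cmap_cimg dq); rewrite /fh /fG !g0 !g1 !b0 !b1; move: D0.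
move: (fg c _ i0 i0 _) (fg c _ i0 i1 _) (fg c _ i1 i1 _) (fb c _ _ i0 i0 _) (fb c _ _ i0 i1 _) (fb c _ _ i1 i1 _)
 (T i0 i0) (T i0 i1) (T i1 i0) (T i1 i1) => a b d e f g h k l m D0 G0; set D := h * m - k * l in D0.
by apply: (div_scale D0) => //; rewrite /D; ring.
Qed.

Definition constant_t (t0 : R) := forall phi u, A phi -> cimg phi u -> ft c (X phi) (Y phi) u = t0.
Definition constant_h (h0 : R) := forall phi u, A phi -> cimg phi u -> fh c (X phi) (Y phi) u = h0.

Let at_chart (Q : chart R M -> E -> Prop) :
  (forall phi p, A phi -> cdom phi p -> Q phi (cmap phi p)) <->
  (forall phi u, A phi -> cimg phi u -> Q phi u).
Proof.
split=> H phi u Aphi Uu; last by apply: H => //; exact: cmap_cimg.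
by rewrite -(cinvK Uu); apply: H => //; exact: cinv_cdom.
Qed.

Lemma constant_mean_curvatureP :
  constant_mean_curvature A eps psi N <-> exists t0, constant_t t0.
Proof.
have e0 : eps != 0 by case: heps => ->; rewrite ?oppr_eq0 oner_neq0.
split=> -[v Hv].
  exists (2 * v / eps) => phi u Aphi Uu.
  have := (at_chart (fun phi u => mean_curv eps (X phi) (Y phi) u = v)).1 Hv phi u Aphi Uu.
  by rewrite (mean_curvE (patchP Aphi))// => <-; field.
exists (eps / 2 * v); apply/(at_chart (fun phi u => mean_curv eps (X phi) (Y phi) u = _)) => phi u Aphi Uu.
by rewrite (mean_curvE (patchP Aphi))// Hv.
Qed.

Lemma constant_second_mean_curvatureP :
  constant_second_mean_curvature A psi N <-> exists h0, constant_h h0.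
Proof.
split=> -[v Hv]; exists v.
  move=> phi u Aphi Uu; rewrite -(second_mean_curvE (patchP Aphi))//.
  exact: (at_chart (fun phi u => second_mean_curv (X phi) (Y phi) u = v)).1 Hv phi u Aphi Uu.
apply/(at_chart (fun phi u => second_mean_curv (X phi) (Y phi) u = _)) => phi u Aphi Uu.
by rewrite (second_mean_curvE (patchP Aphi))// Hv.
Qed.

Let cM : connected [set: M]. Proof. by have [] := hM. Qed.

Lemma t_constant (q : {poly R}) : q != 0 ->
  (forall phi u i, A phi -> cimg phi u ->
     q.[ft c (X phi) (Y phi) u] * pd i (ft c (X phi) (Y phi)) u = 0) ->
  exists t0, constant_t t0.
Proof.
move=> q0 qt; have [v Hv] := constant_of_gradient cM cov
  (fun phi Aphi => smooth_t (patchP Aphi)) t_agree q0 qt.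
by exists v; apply/(at_chart (fun phi u => ft c (X phi) (Y phi) u = v)).
Qed.

Lemma h_constant (q : {poly R}) : q != 0 ->
  (forall phi u i, A phi -> cimg phi u ->
     q.[fh c (X phi) (Y phi) u] * pd i (fh c (X phi) (Y phi)) u = 0) ->
  exists h0, constant_h h0.
Proof.
move=> q0 qt; have [v Hv] := constant_of_gradient cM cov
  (fun phi Aphi => smooth_h (patchP Aphi)) h_agree q0 qt.
by exists v; apply/(at_chart (fun phi u => fh c (X phi) (Y phi) u = v)).
Qed.

Hypothesis htype : L1_2_type A c eps psi N.

Lemma two_type_charts : exists (a : 'rV[R]_4) (psi1 psi2 : M -> 'rV[R]_4) (l1 l2 : R), forall phi, A phi ->
  [/\ smooth_on (cimg phi) (psi1 \o cinv phi), smooth_on (cimg phi) (psi2 \o cinv phi),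
      forall u, cimg phi u -> X phi u = a + (psi1 \o cinv phi) u + (psi2 \o cinv phi) u,
      forall u (j : 'I_4), cimg phi u ->
        L1 c eps (X phi) (Y phi) (fun v => (psi1 \o cinv phi) v 0 j) u = l1 * (psi1 \o cinv phi) u 0 j &
      forall u (j : 'I_4), cimg phi u ->
        L1 c eps (X phi) (Y phi) (fun v => (psi2 \o cinv phi) v 0 j) u = l2 * (psi2 \o cinv phi) u 0 j].
Proof.
have [a [psi1 [psi2 [l1 [l2 [_ [s1 s2] _ [e1 e2] xE]]]]]] := htype.
exists a, psi1, psi2, l1, l2 => phi Aphi; split=> //.
- exact: s1.
- exact: s2.
- by move=> u Uu; exact: xE.
- by move=> u j Uu; have := e1 phi _ Aphi (cinv_cdom Uu) j; rewrite cinvK.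
- by move=> u j Uu; have := e2 phi _ Aphi (cinv_cdom Uu) j; rewrite cinvK.
Qed.

Lemma h_of_t t0 : constant_t t0 -> exists h0, constant_h h0.
Proof.
move=> tc; have [a [psi1 [psi2 [l1 [l2 typ]]]]] := two_type_charts.
apply: (@h_constant 'X); first by rewrite polyX_eq0.
move=> phi u i Aphi Uu; rewrite hornerX; have [s1 s2 xE e1 e2] := typ _ Aphi.
apply: (const_t_h (patchP Aphi) s1 s2 xE e1 e2) => // v m Uv.
exact: (is_partial_unique (open_cimg (c := phi)) Uv (fun w => @tc phi w Aphi)
   (is_partial_smooth m (smooth_t (patchP Aphi)) Uv) (is_partial_cst m t0 v)).
Qed.

Lemma t_of_h h0 : constant_h h0 -> exists t0, constant_t t0.
Proof.
move=> hcst; have [a [psi1 [psi2 [l1 [l2 typ]]]]] := two_type_charts.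
apply: (@t_constant (poly_h c eps (l1 + l2) h0)); first by apply: poly_h_neq0; exact: sq1.
move=> phi u i Aphi Uu; have [s1 s2 xE e1 e2] := typ _ Aphi.
by apply: (const_h_t (patchP Aphi) s1 s2 xE e1 e2) => // v Uv; exact: hcst.
Qed.

Lemma t_of_eigenvalue : has_constant_principal_curvature A psi N -> exists t0, constant_t t0.
Proof.
move=> [V [k [_ _ V0 Vk]]]; have [a [psi1 [psi2 [l1 [l2 typ]]]]] := two_type_charts.
have hk phi u : A phi -> cimg phi u -> fh c (X phi) (Y phi) u = k * (ft c (X phi) (Y phi) u - k).
  move=> Aphi Uu; have [v Vv eig] := Vk phi _ Aphi (cinv_cdom Uu).
  rewrite !cinvK// in Vv eig; have H := patchP Aphi.
  have v0 : v != 0 by apply: contraNneq (V0 (cinv phi u)) => v0; rewrite Vv v0 mul0mx.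
  have ev : v *m (Defs.shape (X phi) (Y phi) u - k%:M) = 0.
    apply: (row_free_inj (row_free_jacobian H Uu)).
    by rewrite mul0mx mulmxBr mulmxBl eig Vv mul_mx_scalar scalemxAl subrr.
  have d0 : \det (Defs.shape (X phi) (Y phi) u - k%:M) = 0.
    apply/eqP; apply: contraNT v0 => dn; apply/eqP.
    by rewrite -(mulmxK (_ : Defs.shape (X phi) (Y phi) u - k%:M \in unitmx) v) ?ev ?mul0mx// unitmxE unitfE.
  rewrite -(det_shape H Uu) -(tr_shape H Uu) det_mx22 /mxtrace sum2.
  have n01 : (i0 == i1) = false by [].
  have n10 : (i1 == i0) = false by [].
  move: d0; rewrite det_mx22; move: (Defs.shape _ _ u) => B.
  rewrite !mxE !eqxx n01 n10 !mulr1n !mulr0n => d0.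
  by apply: (lincomb d0); ring.
have [k0|k0] := eqVneq k 0.
  by apply: (@t_of_h 0) => phi u Aphi Uu; rewrite hk// k0 mul0r.
apply: (@t_constant (poly_k c eps k)).
  by apply: poly_k_neq0 => //; case: heps => ->; rewrite ?oppr_eq0 oner_neq0.
move=> phi u i Aphi Uu; have [s1 s2 xE e1 e2] := typ _ Aphi.
by apply: (const_eigenvalue_t (patchP Aphi) s1 s2 xE e1 e2) => // v Uv; exact: hk.
Qed.

End Surface.

(** * Principal fields and umbilic surfaces *)

Section Constant.
Context {R : realType} {M : topologicalType} {A : set (chart R M)} {c eps : R} {s : nat}.
Context {psi N : M -> 'rV[R]_4}.
Hypothesis hc : c = 1 \/ c = -1.
Hypothesis heps : eps = 1 \/ eps = -1.
Hypothesis hM : smooth_surface A.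
Hypothesis hpsi : immersed_in_Mc A c psi s.
Hypothesis hN : unit_normal A c eps psi N.
Local Notation E := 'rV[R]_2.
Implicit Types (phi chi : chart R M) (p : M).
Local Notation X phi := (psi \o cinv phi).
Local Notation Y phi := (N \o cinv phi).
Local Notation const_t := (constant_t (A := A) (c := c) (psi := psi) (N := N)).
Local Notation const_h := (constant_h (A := A) (c := c) (psi := psi) (N := N)).
Let patch phi := @patchP _ _ _ _ _ _ _ _ hc heps hpsi hN phi.
Let cov p : exists2 phi, A phi & cdom phi p.
Proof. by have [_ _ _ [cov _]] := hM; exact: cov. Qed.
Let cM : connected [set: M]. Proof. by have [] := hM. Qed.
Let spsi : smooth A psi. Proof. by have [] := hpsi. Qed.
Let sN : smooth A N. Proof. by have [] := hN. Qed.

Lemma constant_vector m (F : M -> 'rV[R]_m) : smooth A F ->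
  (forall phi u i, A phi -> cimg phi u -> pd i (F \o cinv phi) u = 0) ->
  exists v, forall p, F p = v.
Proof.
move=> sF dF.
have one0 : (1 : {poly R}) != 0 by exact: oner_neq0.
have /choice[v vP] : forall j : 'I_m, exists v, forall p, F p 0 j = v.
  move=> j; pose f := fun phi (u : E) => F (cinv phi u) 0 j.
  have [|||v vP] := @constant_of_gradient _ _ A f 1 cM cov _ _ one0.
  - move=> phi Aphi; exact: smooth_coord (@open_cimg _ _ phi) (sF _ Aphi).
  - by move=> phi chi p _ _ dp dq; rewrite /f !cmapK.
  - move=> phi u i Aphi Uu; rewrite hornerC mul1r.
    rewrite (_ : f phi = fun w => (F \o cinv phi) w 0 j)// partial_coord; last first.
      exact: smooth_differentiable (sF _ Aphi) Uu.
    by rewrite dF// mxE.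
  - by exists v => p; have [phi Aphi dp] := cov p; rewrite -(vP phi p)// /f cmapK.
by exists (\row_j v j) => p; apply/rowP => j; rewrite vP mxE.
Qed.

Lemma principal_field (V : M -> 'rV[R]_4) (k : R) : smooth A V -> (forall p, V p != 0) ->
  (forall phi u, A phi -> cimg phi u -> exists v0 v1,
     [/\ V (cinv phi u) = v0 *: pd i0 (X phi) u + v1 *: pd i1 (X phi) u,
       v0 * fS0 c (X phi) (Y phi) i0 u + v1 * fS0 c (X phi) (Y phi) i1 u = k * v0 &
       v0 * fS1 c (X phi) (Y phi) i0 u + v1 * fS1 c (X phi) (Y phi) i1 u = k * v1]) ->
  has_constant_principal_curvature A psi N.
Proof.
move=> sV V0 eigV; exists V, k; split=> // [phi _|phi p Aphi dp /=]; first exact: smooth_cst.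
have Uu := cmap_cimg dp; have H := patch Aphi.
have [v0 [v1 [Vp e0 e1]]] := eigV _ _ Aphi Uu; rewrite cmapK// in Vp.
have n10 : (i1 == i0) = false by [].
pose v : E := \row_j if j == i0 then v0 else v1.
have dx : differentiable (X phi) (cmap phi p) := smooth_differentiable (spsi Aphi) Uu.
have vJ : v *m 'J (X phi) (cmap phi p) = V p.
  by rewrite mulmx_sum_row sum2 !row_jacobian// !mxE eqxx n10 Vp.
exists v; first by rewrite vJ.
have vS : v *m Defs.shape (X phi) (Y phi) (cmap phi p) = k *: v.
  rewrite (shapeE H Uu); apply/rowP => j; rewrite !mxE sum2 !mxE eqxx n10.
  by case: (ord2E j) => ->; rewrite ?eqxx ?n10.
by rewrite vS -scalemxAl vJ.
Qed.

Lemma principal_field_empty : (M -> False) -> has_constant_principal_curvature A psi N.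
Proof.
move=> noM; apply: (@principal_field (fun=> 0) 0).
- by move=> phi _; exact: smooth_cst.
- by move=> p; case: (noM p).
- by move=> phi u; case: (noM (cinv phi u)).
Qed.

(** Since N + k psi is constant, L1 psi is al psi plus a constant for some number al.
    Comparing this with l1 psi1 + l2 psi2, and applying L1 once more, one finds that
    (l1 - al) psi1 and (l2 - al) psi2 are constant, although l1 and l2 differ. *)
Lemma two_type_not_umbilic (t0 h0 k : R) : L1_2_type A c eps psi N ->
  const_t t0 ->
  const_h h0 ->
  (forall phi u i, A phi -> cimg phi u -> pd i (Y phi) u = - k *: pd i (X phi) u) -> False.
Proof.
move=> [a0 [psi1 [psi2 [l1 [l2 [l12 [s1 s2] [nc1 nc2] [e1 e2] xE]]]]]] tc hcst umb.
have c0 : c != 0 by case: hc => ->; rewrite ?oppr_eq0 oner_neq0.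
pose F p := N p + k *: psi p.
have sF : smooth A F.
  move=> phi Aphi; have oU := @open_cimg _ _ phi; apply: smooth_rV => // j.
  apply: smooth_ext (smooth_add oU (smooth_coord j oU (sN Aphi))
    (smooth_mul oU (smooth_cst _ k) (smooth_coord j oU (spsi Aphi)))) => // u _.
  by rewrite !mxE.
have [w wP] : exists w, forall p, F p = w.
  apply: constant_vector => // phi u i Aphi Uu; have oU := @open_cimg _ _ phi.
  apply/rowP => j; rewrite -partial_coord; last exact: smooth_differentiable (sF _ Aphi) Uu.
  have [_ d] := is_partial_add (is_partial_coord i j (sN Aphi) Uu)
    (is_partial_mul (is_partial_cst i k u) (is_partial_coord i j (spsi Aphi) Uu)).
  rewrite (pd_ext i (g := fun v => Y phi v 0 j + k * X phi v 0 j) oU)//; last by move=> v _; rewrite !mxE.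
  by rewrite d umb// !mxE; ring.
pose al := 2 * eps * h0 * k + c * t0.
pose be a := - 2 * eps * h0 * dot c w a.
have eigc (y : M -> 'rV[R]_4) l phi : L1_eigen A c eps psi N l y -> A phi -> forall v (j : 'I_4), cimg phi v ->
    L1 c eps (X phi) (Y phi) (fun w => (y \o cinv phi) w 0 j) v = l * (y \o cinv phi) v 0 j.
  by move=> e Aphi v j Uv; have := e phi _ Aphi (cinv_cdom Uv) j; rewrite cinvK.
have key a p : (l1 - al) * dot c (psi1 p) a + (l2 - al) * dot c (psi2 p) a
    = al * dot c a0 a + be a.
  have [phi Aphi dp] := cov p; have Uu := cmap_cimg dp.
  have := LLx_eig (patch Aphi) (s1 _ Aphi) (s2 _ Aphi) (fun u _ => xE (cinv phi u))
    (eigc _ _ _ e1 Aphi) (eigc _ _ _ e2 Aphi) a Uu.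
  have nE : N p = w - k *: psi p by rewrite -(wP p) /F addrK.
  rewrite tc// hcst//= !cmapK// nE xE !dot_lin => e.
  by rewrite /al /be; apply/esym; apply: (lincomb e); ring.
have key2 a p : l1 * (l1 - al) * dot c (psi1 p) a + l2 * (l2 - al) * dot c (psi2 p) a = 0.
  have [phi Aphi dp] := cov p; have Uu := cmap_cimg dp; have H := patch Aphi.
  have oU := @open_cimg _ _ phi.
  have d1 : smooth_on (cimg phi) (fun v => dot c ((psi1 \o cinv phi) v) a).
    by apply: smooth_dot => //; [exact: s1|exact: smooth_cst].
  have d2 : smooth_on (cimg phi) (fun v => dot c ((psi2 \o cinv phi) v) a).
    by apply: smooth_dot => //; [exact: s2|exact: smooth_cst].
  have := LL_ext H (f := fun v => (l1 - al) * dot c ((psi1 \o cinv phi) v) a + (l2 - al) * dot c ((psi2 \o cinv phi) v) a)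
     (f' := fun=> al * dot c a0 a + be a) (fun v Uv => key a (cinv phi v)) Uu.
  rewrite LL_cst (LL_add H)//; [|by apply: smooth_mul => //; exact: smooth_cst|by apply: smooth_mul => //; exact: smooth_cst].
  rewrite !(LL_scale H)// (eig1_dot H (s1 _ Aphi) (eigc _ _ _ e1 Aphi))// (eig2_dot H (s2 _ Aphi) (eigc _ _ _ e2 Aphi))//= cmapK// => e.
  by apply: (lincomb e); ring.
have dl : l1 - l2 != 0 by rewrite subr_eq0.
have flat1 a p : (l1 - al) * dot c (psi1 p) a = - l2 * (al * dot c a0 a + be a) / (l1 - l2).
  apply: (mulIf dl); rewrite divfK//.
  by apply: (lincomb (congr2 (fun y z => y - l2 * z) (key2 a p) (key a p))); rewrite /=; ring.
have flat2 a p : (l2 - al) * dot c (psi2 p) a = l1 * (al * dot c a0 a + be a) / (l1 - l2).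
  apply: (mulIf dl); rewrite divfK//.
  by apply: (lincomb (congr2 (fun y z => l1 * z - y) (key2 a p) (key a p))); rewrite /=; ring.
have [[p0 _]|noM] := pselect (exists p0 : M, True); last first.
  by apply: nc1; exists 0 => p; exfalso; apply: noM; exists p.
have cst (y : M -> 'rV[R]_4) l (C : 'rV[R]_4 -> R) : l != 0 -> (forall a p, l * dot c (y p) a = C a) -> exists v, forall p, y p = v.
  move=> l0 yC; exists (y p0) => p; apply/eqP; rewrite -subr_eq0; apply/eqP/(dot_nondeg c0) => a.
  by apply: (mulfI l0); rewrite !dot_lin mulrDr mulrN !yC; ring.
have [a1|n1] := eqVneq (l1 - al) 0; last by apply: nc1; exact: cst n1 flat1.
have [a2|n2] := eqVneq (l2 - al) 0; last by apply: nc2; exact: cst n2 flat2.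
by move/eqP: l12; apply; apply: (lincomb (congr2 (fun y z => y - z) a1 a2)); rewrite /=; ring.
Qed.

End Constant.

(** * Two distinct constant principal curvatures *)

Section Distinct.
Context {R : realType} {M : topologicalType} {A : set (chart R M)} {c eps : R} {s : nat}.
Context {psi N : M -> 'rV[R]_4}.
Hypothesis hc : c = 1 \/ c = -1.
Hypothesis heps : eps = 1 \/ eps = -1.
Hypothesis hM : smooth_surface A.
Hypothesis hpsi : immersed_in_Mc A c psi s.
Hypothesis hN : unit_normal A c eps psi N.
Local Notation E := 'rV[R]_2.
Implicit Types (phi chi : chart R M) (p : M).
Local Notation X phi := (psi \o cinv phi).
Local Notation Y phi := (N \o cinv phi).
Local Notation const_t := (constant_t (A := A) (c := c) (psi := psi) (N := N)).
Local Notation const_h := (constant_h (A := A) (c := c) (psi := psi) (N := N)).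
Let patch phi := @patchP _ _ _ _ _ _ _ _ hc heps hpsi hN phi.
Let cov p : exists2 phi, A phi & cdom phi p.
Proof. by have [_ _ _ [cov _]] := hM; exact: cov. Qed.
Let cM : connected [set: M]. Proof. by have [] := hM. Qed.
Context {k1 k2 : R}.
Hypothesis k12 : k1 != k2.
Hypothesis tc : const_t (k1 + k2).
Hypothesis hcst : const_h (k1 * k2).
Let F p := N p + k2 *: psi p.
Local Notation FF phi := (focal (x := X phi) (n := Y phi) (k2 := k2)).
Local Notation th phi := (theta (c := c) (eps := eps) (x := X phi) (n := Y phi) (k1 := k1) (k2 := k2)).
Let kap := (k1 - k2) * (k1 - k2).
Let kap0 : kap != 0. Proof. by rewrite mulf_neq0// subr_eq0. Qed.
Let tl phi (Aphi : A phi) u (Uu : cimg phi u) := tc Aphi Uu.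
Let hl phi (Aphi : A phi) u (Uu : cimg phi u) := hcst Aphi Uu.

Lemma theta_agree a d phi chi p : A phi -> A chi -> cdom phi p -> cdom chi p ->
  th phi a d (cmap phi p) = th chi a d (cmap chi p).
Proof.
move=> Aphi Achi dp dq; have Up := cmap_cimg dp; have Uq := cmap_cimg dq.
have [T [D0 TP]] := forms_change hc heps hM hpsi hN Aphi Achi dp dq.
have [x0 n0 _ _] := TP i0; have [x1 n1 _ _] := TP i1.
rewrite (theta_rep (patch Aphi))// (theta_rep (patch Achi))//.
have foc chi' : A chi' -> cdom chi' p -> FF chi' (cmap chi' p) = F p.
  by move=> _ d'; rewrite /focal /= cmapK.
rewrite !foc//; congr (_ + _).
rewrite !(pd_focal (patch Aphi))// !(pd_focal (patch Achi))// x0 x1 n0 n1.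
have e a' b' y0 y1 z0 z1 : dot c (a' *: y0 + b' *: y1 + k2 *: (a' *: z0 + b' *: z1)) =1
    fun w => a' * dot c (y0 + k2 *: z0) w + b' * dot c (y1 + k2 *: z1) w.
  by move=> w; rewrite !dot_lin; ring.
rewrite !e; apply: (@copair_change _ c _ _ _ _ T _ _ _ _ D0 (patch_G (patch Achi) Uq)) => i j.
by have [_ _ ->] := TP i.
Qed.

Lemma theta_constant a d : exists v, forall phi p, A phi -> cdom phi p -> th phi a d (cmap phi p) = v.
Proof.
have one0 : (1 : {poly R}) != 0 by exact: oner_neq0.
have [||v vP] := @constant_of_gradient _ _ A (fun phi => th phi a d) 1 cM cov _ (@theta_agree a d) one0.
- by move=> phi Aphi; exact: (smooth_theta (patch Aphi) a d).
- move=> phi u i Aphi Uu; rewrite hornerC mul1r.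
  exact: (theta_const (patch Aphi) (@tl _ Aphi) (@hl _ Aphi) k12 a d i Uu).
- by exists v.
Qed.

Lemma focal_not_critical phi u : A phi -> cimg phi u -> exists l, pd l (FF phi) u != 0.
Proof.
move=> Aphi Uu; have H := patch Aphi.
have [z0|n0] := eqVneq (pd i0 (FF phi) u) 0; last by exists i0.
have [z1|n1] := eqVneq (pd i1 (FF phi) u) 0; last by exists i1.
have nE i : pd i (Y phi) u = - (k2 *: pd i (X phi) u).
  apply/eqP; rewrite -addr_eq0 -(pd_focal H)//; apply/eqP.
  by case: (ord2E i) => ->.
have bE i j : fb c (X phi) (Y phi) i j u = k2 * fg c (X phi) i j u.
  by apply: oppr_inj; rewrite -(ip_xi_nj H)// nE !dot_lin.
exfalso; move: (tl Aphi Uu); have := patch_G H Uu; rewrite /ft /fG !bE.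
move: (fg c _ i0 i0 _) (fg c _ i0 i1 _) (fg c _ i1 i1 _) => a b d G0 e.
move/eqP: k12; apply; apply: (lincomb (esym e)); by field.
Qed.

(** The focal curve lies in one plane, since theta does not depend on the point, and
    its velocity is orthogonal to its value F p. Let F0 be the value and Y0 a nonzero
    velocity at a base point: turning F p by a right angle in that plane gives
    <F p, F0> Y0 - <F p, Y0> F0, a velocity at p, hence a principal direction, which
    does not vanish because F p is a nonzero vector of the plane. *)
Lemma distinct_curvatures_principal : has_constant_principal_curvature A psi N.
Proof.
have [[p0 _]|noM] := pselect (exists p0 : M, True); last first.
  by apply: (principal_field_empty hc heps hpsi hN) => p; apply: noM; exists p.
have [ph0 A0 d0] := cov p0; have U0 := cmap_cimg d0; set u0 := cmap ph0 p0 in U0.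
have H0 := patch A0.
have [l Y0n] := focal_not_critical A0 U0; set Y0 := pd l (FF ph0) u0 in Y0n.
pose F0 := F p0.
have fF0 : FF ph0 u0 = F0 by rewrite /focal /= cmapK.
have foc phi u : FF phi u = F (cinv phi u) by [].
have trans a d phi u : A phi -> cimg phi u -> th phi a d u = th ph0 a d u0.
  move=> Aphi Uu; have [v vP] := theta_constant a d.
  by rewrite (vP ph0)// -(cinvK Uu) (vP phi)//; exact: cinv_cdom.
(* all velocities of the focal curve at the base point are multiples of Y0 *)
have prop j z : dot c Y0 z = 0 -> dot c (pd j (FF ph0) u0) z = 0.
  have [e1 e2] := S_k1k2 H0 (@tl _ A0) (@hl _ A0) U0.
  pose r0 (i : 'I_2) := fS0 c (X ph0) (Y ph0) i u0 - k2 *+ (i == i0).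
  pose r1 (i : 'I_2) := fS1 c (X ph0) (Y ph0) i u0 - k2 *+ (i == i1).
  have n10 : (i1 == i0) = false by [].
  have n01 : (i0 == i1) = false by [].
  have FE i : pd i (FF ph0) u0 = - (r0 i *: pd i0 (X ph0) u0 + r1 i *: pd i1 (X ph0) u0).
    rewrite (focalS H0)// /r0 /r1; apply/rowP => m; case: (ord2E i) => ->;
      rewrite ?eqxx ?n10 ?n01 ?mulr1n ?mulr0n !mxE; ring.
  have e1' : fS1 c (X ph0) (Y ph0) i1 u0 = k1 + k2 - fS0 c (X ph0) (Y ph0) i0 u0 by rewrite -e1; ring.
  have rr i i' : r0 i * r1 i' = r1 i * r0 i'.
    rewrite e1' in e2.
    case: (ord2E i) => ->; case: (ord2E i') => ->; rewrite /r0 /r1 ?e1' ?eqxx ?n10 ?n01 ?mulr1n ?mulr0n; try ring.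
      by apply: (lincomb e2); ring.
    by apply: (lincomb (esym e2)); ring.
  move: Y0n; rewrite /Y0 !FE !dot_lin => Y0n e.
  have e0 : r0 l * dot c (pd i0 (X ph0) u0) z + r1 l * dot c (pd i1 (X ph0) u0) z = 0.
    by apply: (lincomb (congr1 -%R e)); ring.
  have c0' : r0 l * - (r0 j * dot c (pd i0 (X ph0) u0) z + r1 j * dot c (pd i1 (X ph0) u0) z) = 0.
    apply: (lincomb (congr2 (fun y w => - r0 j * y - w * dot c (pd i1 (X ph0) u0) z) e0 (rr l j))).
    by rewrite /=; ring.
  have c1' : r1 l * - (r0 j * dot c (pd i0 (X ph0) u0) z + r1 j * dot c (pd i1 (X ph0) u0) z) = 0.
    apply: (lincomb (congr2 (fun y w => - r1 j * y + w * dot c (pd i0 (X ph0) u0) z) e0 (rr l j))).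
    by rewrite /=; ring.
  have [rl0|rl0] := eqVneq (r0 l) 0; last by apply: (mulfI rl0); rewrite c0' mulr0.
  have [rl1|rl1] := eqVneq (r1 l) 0; last by apply: (mulfI rl1); rewrite c1' mulr0.
  by move: Y0n; rewrite rl0 rl1 !scale0r addr0 oppr0 eqxx.
have sF phi : A phi -> smooth_on (cimg phi) (F \o cinv phi).
  by move=> Aphi; exact: (smooth_focal (patch Aphi)).
clearbody F.
pose V p := dot c (F p) F0 *: Y0 - dot c (F p) Y0 *: F0.
apply: (principal_field hc heps hpsi hN (V := V) (k := k1)).
- move=> phi Aphi; have oU := @open_cimg _ _ phi; apply: smooth_rV => // j.
  have sd a : smooth_on (cimg phi) (fun u => dot c ((F \o cinv phi) u) a).
    by apply: smooth_dot => //; [exact: sF|exact: smooth_cst].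
  apply: smooth_ext (smooth_subr oU (smooth_mul oU (sd F0) (smooth_cst _ (Y0 0 j)))
    (smooth_mul oU (sd Y0) (smooth_cst _ (F0 0 j)))) => // u _.
  by rewrite !mxE.
- move=> p; apply/negP => /eqP Vp.
  have F00 : dot c F0 F0 != 0.
    have := focal_norm H0 (@tl _ A0) (@hl _ A0) k12 U0; rewrite fF0 => e.
    by apply: contraNneq k12 => z; rewrite -subr_eq0 -e z mulr0.
  have Y0F : dot c Y0 F0 = 0 by rewrite -fF0; exact: (focal_orth H0).
  have FY : dot c (F p) Y0 = 0.
    have := congr1 (fun v => dot c v F0) Vp.
    rewrite /V dotDl dotNl !dotZl Y0F mulr0 add0r dot0l => /eqP.
    by rewrite oppr_eq0 mulf_eq0 (negbTE F00) orbF => /eqP.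
  have FF0 : dot c (F p) F0 = 0.
    have /eqP := Vp; rewrite /V FY scale0r subr0 scaler_eq0 (negbTE Y0n) orbF => /eqP; exact.
  have [phi Aphi dp] := cov p; have Uu := cmap_cimg dp; have H := patch Aphi.
  have fp : FF phi (cmap phi p) = F p by rewrite foc cmapK.
  have Fp0 : F p = 0.
    apply: (dot_nondeg (patch_c0 H)) => a; apply: (mulfI kap0); rewrite mulr0.
    have := theta_focal H (@tl _ Aphi) (@hl _ Aphi) k12 a Uu; rewrite fp -/kap => <-.
    have pF j : dot c (pd j (FF ph0) u0) (F p) = 0 by apply: prop; rewrite dotC.
    rewrite trans// (theta_rep H0)//.
    rewrite fF0 (dotC c F0 (F p)) FF0 !pF.
    by rewrite /copair; ring.
  have := focal_norm H (@tl _ Aphi) (@hl _ Aphi) k12 Uu; rewrite fp Fp0 dot0l mulr0 => /esym/eqP.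
  by rewrite subr_eq0 (negbTE k12).
- move=> phi u Aphi Uu; have H := patch Aphi.
  pose q i := dot c (F (cinv phi u)) F0 * dot c (pd i (FF phi) u) Y0
            - dot c (F (cinv phi u)) Y0 * dot c (pd i (FF phi) u) F0.
  pose v0 := (fg c (X phi) i1 i1 u * q i0 - fg c (X phi) i0 i1 u * q i1) / fG c (X phi) u.
  pose v1 := (fg c (X phi) i0 i0 u * q i1 - fg c (X phi) i0 i1 u * q i0) / fG c (X phi) u.
  have kV : kap *: V (cinv phi u) = v0 *: pd i0 (FF phi) u + v1 *: pd i1 (FF phi) u.
    apply/eqP; rewrite -subr_eq0; apply/eqP/(dot_nondeg (patch_c0 H)) => a; rewrite !dot_lin.
    have := theta_focal H0 (@tl _ A0) (@hl _ A0) k12 a U0.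
    have := theta_dfocal H0 (@tl _ A0) (@hl _ A0) a l U0.
    rewrite fF0 -/Y0 -!(trans _ _ phi u)// !(theta_rep H)// !foc -/kap => eY eF.
    apply: (lincomb (congr2 (fun y z => dot c (F (cinv phi u)) Y0 * z - dot c (F (cinv phi u)) F0 * y) eY eF)).
    by rewrite /v0 /v1 /q /copair /=; ring.
  have := focal_eigen H (@tl _ Aphi) (@hl _ Aphi) v0 v1 Uu; move=> /=.
  move: (v0 * (_ - k2) + _) (v0 * fS1 c _ _ _ _ + _) => w0 w1 [vX ev0 ev1].
  rewrite vX in kV.
  exists (- w0 / kap), (- w1 / kap); split.
  - apply: (scalerI kap0); rewrite kV; apply/rowP => j; rewrite !mxE.
    by field.
  - by apply: (lincomb (congr1 (fun y => - y / kap) ev0)); ring.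
  - by apply: (lincomb (congr1 (fun y => - y / kap) ev1)); ring.
Qed.

End Distinct.

(** * Functions of separate coordinates *)

HB.instance Definition _ (R : realType) := Complete.on 'rV[R]_2.

Section LocalInverse.
Context {R : realType}.
Local Notation E := 'rV[R]_2.
Implicit Types (U B : set E) (f u w K : E -> R) (p q y z : E).

Lemma rV2_coord_le y i : `|y 0 i| <= `|y|.
Proof.
change (`|y 0 i| <= mx_norm y); rewrite mx_normrE.
exact: (le_bigmax _ (fun ij : 'I_1 * 'I_2 => `|y ij.1 ij.2|) (0, i)).
Qed.

Lemma rV2_norm_le y (e : R) : `|y 0 i0| <= e -> `|y 0 i1| <= e -> `|y| <= e.
Proof.
move=> e0 e1; have [->|y0] := eqVneq y 0.
  by rewrite normr0; apply: le_trans e0.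
have : mx_norm y != 0 by apply: contra_neq y0; exact: mx_norm_eq0.
move=> /mx_norm_neq0[[i j] /= yE]; change (mx_norm y <= e); rewrite yE ord1.
by case: (ord2E j) => ->.
Qed.

Lemma small_partials_lipschitz f p (r e : R) :
  (forall v, ball p r v -> differentiable f v) ->
  (forall v i, ball p r v -> `|pd i f v| <= e) ->
  forall y z, ball p r y -> ball p r z -> `|f y - f z| <= 2 * e * `|y - z|.
Proof.
move=> df pf y z; rewrite -!ball_normE/= => py pz.
have seg (s : R) : 0 <= s <= 1 -> ball p r (z + s *: (y - z)).
  move=> /andP[s0 s1]; rewrite -ball_normE/=.
  have -> : p - (z + s *: (y - z)) = s *: (p - y) + (1 - s) *: (p - z).
    by apply/rowP => j; rewrite !mxE; ring.
  apply: le_lt_trans (ler_normD _ _) _; rewrite !normrZ (ger0_norm s0) ger0_norm ?subr_ge0//.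
  apply: (@le_lt_trans _ _ (Num.max `|p - y| `|p - z|)); last by rewrite gt_max py.
  have m0 : `|p - y| <= Num.max `|p - y| `|p - z| by rewrite le_max lexx.
  have m1 : `|p - z| <= Num.max `|p - y| `|p - z| by rewrite le_max lexx orbT.
  move: (Num.max _ _) m0 m1 => m m0 m1.
  have := ler_wpM2l s0 m0; have s1' : 0 <= 1 - s by rewrite subr_ge0.
  have := ler_wpM2l s1' m1; lra.
have D (s : R) : 0 <= s <= 1 -> is_derive s 1 (fun t : R => f (z + t *: (y - z))) ('d f (z + s *: (y - z)) (y - z)).
  by move=> s01; apply: line_derive; exact: df (seg _ s01).
have [s s01] : exists2 s : R, s \in `]0, 1[%R &
   (fun t : R => f (z + t *: (y - z))) 1 - (fun t : R => f (z + t *: (y - z))) 0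
    = (fun s => 'd f (z + s *: (y - z)) (y - z)) s * (1 - 0).
  apply: (@MVT R (fun t : R => f (z + t *: (y - z))) (fun s => 'd f (z + s *: (y - z)) (y - z)) 0 1).
  - exact: ltr01.
  - by move=> s; rewrite in_itv/= => /andP[/ltW s0 /ltW s1]; apply: D; rewrite s0 s1.
  - apply: derivable_within_continuous => s; rewrite in_itv/= => s01.
    by have [] := D _ s01.
rewrite scale1r scale0r addr0 [z + (y - z)]addrC subrK subr0 mulr1 => ->.
have s01' : 0 <= s <= 1 by move: s01; rewrite in_itv/= => /andP[/ltW -> /ltW ->].
rewrite diff_partial ?sum2; last exact: df (seg _ s01').
rewrite -!pdE; have p0 := pf _ i0 (seg _ s01'); have p1 := pf _ i1 (seg _ s01').
apply: le_trans (ler_normD _ _) _.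
rewrite !normrM.
have c0 := rV2_coord_le (y - z) i0; have c1 := rV2_coord_le (y - z) i1.
have := ler_pM (normr_ge0 _) (normr_ge0 _) c0 p0.
have := ler_pM (normr_ge0 _) (normr_ge0 _) c1 p1.
have -> : 2 * e * `|y - z| = `|y - z| * e + `|y - z| * e by ring.
by move=> ? ?; rewrite lerD.
Qed.

Lemma nbhs_small f p (e : R) : 0 < e -> {for p, continuous f} -> f p = 0 ->
  \forall v \near p, `|f v| <= e.
Proof.
move=> e0 cf f0; have /cvgrPdist_le/(_ _ e0) := cf; rewrite f0.
by apply: filterS => v; rewrite sub0r normrN.
Qed.

(** Composed with the inverse of its differential at p, the pair (u, w) differs from the
    identity by a contraction t near p: the fixed point theorem solves for (u, w), and
    the contraction estimate bounds the distance of two solutions. *)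
Lemma local_coordinates U u w p : open U -> U p -> smooth_on U u -> smooth_on U w ->
  pd i0 u p * pd i1 w p - pd i1 u p * pd i0 w p != 0 ->
  exists B (r C : R), [/\ nbhs p B /\ B `<=` U, 0 < r, 0 <= C,
    forall a b, `|a - u p| < r -> `|b - w p| < r -> exists y, [/\ B y, u y = a & w y = b] &
    forall y z, B y -> B z -> `|y - z| <= C * (`|u y - u z| + `|w y - w z|)].
Proof.
move=> oU Up su sw; set D := _ - _ => D0.
pose u0 := pd i0 u p; pose u1 := pd i1 u p; pose w0 := pd i0 w p; pose w1 := pd i1 w p.
have DE : D = u0 * w1 - u1 * w0 by [].
(* the coordinates corrected so that their differential at p is the identity *)
pose P0 (v : E) := D^-1 * (w1 * u v - u1 * w v); pose P1 (v : E) := D^-1 * (u0 * w v - w0 * u v).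
have Dv : D^-1 * (u0 * w1 - u1 * w0) = 1 by rewrite -DE mulVf.
have n01 : (i0 == i1) = false by [].
have n10 : (i1 == i0) = false by [].
pose t (i : 'I_2) (v : E) := v 0 i - (if i == i0 then P0 v else P1 v).
have sid := @smooth_id R U.
have sP0 : smooth_on U P0.
  apply: smooth_mul => //; first exact: smooth_cst.
  by apply: smooth_subr => //; apply: smooth_mul => //; exact: smooth_cst.
have sP1 : smooth_on U P1.
  apply: smooth_mul => //; first exact: smooth_cst.
  by apply: smooth_subr => //; apply: smooth_mul => //; exact: smooth_cst.
have st i : smooth_on U (t i).
  rewrite /t; apply: smooth_subr => //; first exact: (smooth_coord i oU sid).
  by case: (i == i0).
have dP0 j : pd j P0 p = (j == i0)%:R.
  have [_ ->] := is_partial_mul (is_partial_cst j D^-1 p) (is_partial_sub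
    (is_partial_mul (is_partial_cst j w1 p) (is_partial_smooth j su Up))
    (is_partial_mul (is_partial_cst j u1 p) (is_partial_smooth j sw Up))).
  case: (ord2E j) => ->; rewrite ?eqxx ?n10 -/u0 -/u1 -/w0 -/w1 /=; last by ring.
  by apply: (lincomb Dv); ring.
have dP1 j : pd j P1 p = (j == i1)%:R.
  have [_ ->] := is_partial_mul (is_partial_cst j D^-1 p) (is_partial_sub
    (is_partial_mul (is_partial_cst j u0 p) (is_partial_smooth j sw Up))
    (is_partial_mul (is_partial_cst j w0 p) (is_partial_smooth j su Up))).
  case: (ord2E j) => ->; rewrite ?eqxx ?n01 -/u0 -/u1 -/w0 -/w1 /=; first by ring.
  by apply: (lincomb Dv); ring.
have dt i j : pd j (t i) p = 0.
  have did : pd j (fun v : E => v 0 i) p = (j == i)%:R.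
    rewrite (@partial_coord _ _ (fun v : E => v)); last exact: smooth_differentiable sid Up.
    by rewrite pdE /partial derive_id mxE eqxx/= eq_sym.
  have := is_partial_sub (is_partial_smooth j (smooth_coord i oU sid) Up)
     (is_partial_smooth j (if i == i0 as b return smooth_on U (fun v => if b then P0 v else P1 v) then sP0 else sP1) Up).
  move=> [_]; rewrite /t => ->; rewrite did.
  by case: (ord2E i) => ->; rewrite ?eqxx ?n10 ?dP0 ?dP1 subrr.
have near_small : \forall v \near p, U v /\ forall i j, `|pd j (t i) v| <= 4^-1.
  have e4 : (0 : R) < 4^-1 by rewrite invr_gt0.
  have sm i j : \forall v \near p, `|pd j (t i) v| <= 4^-1.
    by apply: nbhs_small => //; exact: smooth_continuous (smooth_pd j (st i)) Up.
  near=> v; split; first by near: v; exact: open_nbhs_nbhs.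
  by move=> i j; case: (ord2E i) => ->; case: (ord2E j) => ->; near: v; exact: sm.
have [r0 /= r00 rB] := (nbhs_ballP _ _).1 near_small.
have tl i y z : ball p r0 y -> ball p r0 z -> `|t i y - t i z| <= 2^-1 * `|y - z|.
  move=> By Bz; have -> : (2^-1 : R) = 2 * 4^-1 by field.
  apply: (small_partials_lipschitz _ _ By Bz) => v.
    by move=> /rB[Uv _]; exact: smooth_differentiable (st i) Uv.
  by move=> j /rB[_]; exact.
pose rho := r0 / 2.
have rho0 : 0 < rho by rewrite divr_gt0.
pose B := [set v : E | `|p - v| <= rho].
have Bball v : B v -> ball p r0 v.
  by rewrite -ball_normE/= => /le_lt_trans; apply; rewrite ltr_pdivrMr// ltr_pMr// ltr1n.
have Pt i y : (if i == i0 then P0 y else P1 y) = y 0 i - t i y by rewrite /t; ring.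
pose C0 := `|D^-1| * (`|w1| + `|u1| + `|u0| + `|w0|).
have C00 : 0 <= C0 by rewrite mulr_ge0// !addr_ge0.
have bound (x y : R) i : `|if i == i0 then D^-1 * (w1 * x - u1 * y) else D^-1 * (u0 * y - w0 * x)| <= C0 * (`|x| + `|y|).
  have aux (a b d e x' y' : R) : 0 <= a -> 0 <= b -> 0 <= d -> 0 <= e -> 0 <= x' -> 0 <= y' ->
      a * x' + b * y' <= (a + b + d + e) * (x' + y') by nra.
  case: ifP => _; rewrite normrM /C0 -mulrA; apply: ler_wpM2l => //; apply: le_trans (ler_normB _ _) _; rewrite !normrM.
    exact: aux.
  rewrite addrC (_ : `|w1| + `|u1| + `|u0| + `|w0| = `|w0| + `|u0| + `|w1| + `|u1|); last by ring.
  exact: aux.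
have Pd i y z : (if i == i0 then D^-1 * (w1 * (u y - u z) - u1 * (w y - w z)) else D^-1 * (u0 * (w y - w z) - w0 * (u y - u z)))
    = (y 0 i - t i y) - (z 0 i - t i z).
  by rewrite -!Pt /P0 /P1; case: (i == i0); ring.
have up y z : B y -> B z -> `|y - z| <= 2 * C0 * (`|u y - u z| + `|w y - w z|).
  move=> /Bball By /Bball Bz.
  suff : `|y - z| <= C0 * (`|u y - u z| + `|w y - w z|) + 2^-1 * `|y - z| by lra.
  have co i : `|(y - z) 0 i| <= C0 * (`|u y - u z| + `|w y - w z|) + 2^-1 * `|y - z|.
    have -> : (y - z) 0 i = ((y 0 i - t i y) - (z 0 i - t i z)) + (t i y - t i z) by rewrite !mxE; ring.
    apply: le_trans (ler_normD _ _) _; apply: lerD; last exact: tl.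
    by rewrite -Pd; exact: bound.
  exact: rV2_norm_le.
exists B, (rho / (4 * (C0 + 1))), (2 * C0); split=> //.
- split=> [|v /Bball/rB[]//].
  by apply/nbhs_ballP; exists rho => //= v; rewrite -ball_normE/= /B/= => /ltW; exact.
- by rewrite divr_gt0// mulr_gt0// ltr_wpDl.
- by rewrite mulr_ge0.
move=> a b au bw.
pose ze : E := \row_i (if i == i0 then D^-1 * (w1 * (a - u p) - u1 * (b - w p)) else D^-1 * (u0 * (b - w p) - w0 * (a - u p))).
pose tau y : E := \row_i t i y.
have Bp : B p by rewrite /B/= subrr normr0 ltW.
have zeB : `|ze| <= rho / 2.
  have lim : C0 * (`|a - u p| + `|b - w p|) <= rho / 2.
    have k0 : 0 < C0 + 1 by rewrite ltr_wpDl.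
    have -> : rho / 2 = (C0 + 1) * (rho / (4 * (C0 + 1)) + rho / (4 * (C0 + 1))).
      by field; rewrite gt_eqF.
    apply: ler_pM => //.
      by rewrite lerDl.
    by rewrite lerD// ltW.
  by apply: rV2_norm_le; rewrite mxE; apply: le_trans lim; [exact: (bound _ _ i0)|exact: (bound _ _ i1)].
have tauB y z : B y -> B z -> `|tau y - tau z| <= 2^-1 * `|y - z|.
  by move=> /Bball By /Bball Bz; apply: rV2_norm_le; rewrite !mxE; exact: tl.
pose T y : E := p + ze + (tau y - tau p).
have TB : {homo T : y / B y >-> B y}.
  move=> y By; rewrite /B/= /T.
  have -> : p - (p + ze + (tau y - tau p)) = - (ze + (tau y - tau p)).
    by apply/rowP => i; rewrite !mxE; ring.
  rewrite normrN; apply: le_trans (ler_normD _ _) _.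
  have := tauB _ _ By Bp; have : `|y - p| <= rho by rewrite distrC.
  move: zeB; lra.
have clB : closed B.
  have -> : B = closed_ball p rho by rewrite closed_ballE.
  exact: closed_ball_closed.
have ctr : is_contraction (mkfun_fun TB).
  have h0 : (0 : R) <= 2^-1 by rewrite invr_ge0.
  exists (NngNum h0); split=> /=; first by rewrite invf_lt1// ltr1n.
  move=> [y z] /= [By Bz].
  have -> : T y - T z = tau y - tau z by apply/rowP => i; rewrite !mxE; ring.
  exact: tauB.
have [|y By yT] := banach_fixed_point ctr clB; first by exists p.
have e i : y 0 i - t i y - (p 0 i - t i p) = ze 0 i.
  have := congr1 (fun v : E => v 0 i) yT; rewrite /= /T !mxE => ey.
  by apply: (lincomb ey); ring.
exists y; have e0 := e i0; have e1 := e i1; rewrite -!Pd !mxE !eqxx !n10 in e0 e1.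
have {}e0 := mulfI (invr_neq0 D0) e0; have {}e1 := mulfI (invr_neq0 D0) e1.
split=> //.
  apply: (mulfI D0); apply: (lincomb (congr2 (fun k m => u0 * k + u1 * m) e0 e1)).
  by rewrite DE /=; ring.
apply: (mulfI D0); apply: (lincomb (congr2 (fun k m => w0 * k + w1 * m) e0 e1)).
by rewrite DE /=; ring.
Unshelve. all: by end_near. Qed.

Lemma is_derive_zero (h : R -> R) (b : R) :
  (forall e, 0 < e -> \forall t \near (0 : R), `|h (b + t) - h b| <= e * `|t|) -> is_derive b 1 h 0.
Proof.
move=> H.
have cv : (fun t : R => t^-1 *: (h (t *: 1 + b) - h b)) @ 0^' --> (0 : R).
  apply/cvgrPdist_le => e e0.
  have := H _ e0; move=> /nbhs_ballP[d /= d0 dH]; apply/nbhs_ballP; exists d => //= t /dH td t0.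
  rewrite sub0r normrN normrZ normfV ler_pdivrMl ?normr_gt0//.
  by rewrite [t *: 1]mulr1 [t + b]addrC mulrC.
have dh : derivable h b 1 by apply/cvg_ex; exists 0.
by apply: DeriveDef => //; exact: cvg_lim cv.
Qed.

Lemma zero_derive_constant (h : R -> R) (b0 r : R) (x z : R) :
  (forall b, `|b - b0| < r -> is_derive b 1 h 0) -> `|x - b0| < r -> `|z - b0| < r -> h x = h z.
Proof.
move=> dh; wlog xz : x z / x < z => [W xr zr|xr zr].
  have [xz|zx|->] := ltgtP x z => //; [exact: W|apply/esym; exact: W].
have seg m : x <= m <= z -> `|m - b0| < r.
  by move: xr zr; rewrite !ltr_distl; lra.
have [m _] : exists2 m : R, m \in `]x, z[%R & h z - h x = (fun=> 0) m * (z - x).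
  apply: (@MVT R h (fun=> 0) x z xz) => [m|].
    by rewrite in_itv/= => /andP[/ltW m0 /ltW m1]; apply: dh; apply: seg; rewrite m0.
  apply: derivable_within_continuous => m; rewrite in_itv/= => mi.
  by have [] := dh _ (seg _ mi).
by rewrite mul0r => /eqP; rewrite subr_eq0 => /eqP ->.
Qed.

(** Along a level curve of u, parametrized by w, a function whose gradient is
    proportional to that of u does not change. The level curve is only known to be
    Lipschitz, which suffices: subtracting from K the right multiple of u leaves a
    function that is stationary to first order and has the same increments. *)
Lemma level_constant U B u w K (r C a0 b0 : R) y z : open U -> B `<=` U -> 0 <= C ->
  smooth_on U u -> smooth_on U K ->
  (forall v, U v -> pd i0 K v * pd i1 u v = pd i1 K v * pd i0 u v) ->
  (forall v, U v -> pd i0 u v != 0 \/ pd i1 u v != 0) ->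
  (forall a b, `|a - a0| < r -> `|b - b0| < r -> exists y, [/\ B y, u y = a & w y = b]) ->
  (forall y z, B y -> B z -> `|y - z| <= C * (`|u y - u z| + `|w y - w z|)) ->
  B y -> B z -> u y = u z -> `|u y - a0| < r -> `|w y - b0| < r -> `|w z - b0| < r -> K y = K z.
Proof.
move=> oU BU C0 su sK dKu du0 onto lip By Bz uyz ur wyr wzr.
have /choice[ga gaP] : forall b, exists q, `|b - b0| < r -> [/\ B q, u q = u y & w q = b].
  move=> b; have [br|] := pselect (`|b - b0| < r); last by move=> nb; exists y.
  by have [q qP] := onto _ _ ur br; exists q.
have gaE q : B q -> u q = u y -> `|w q - b0| < r -> ga (w q) = q.
  move=> Bq uq wq; have [Bg ug wg] := gaP _ wq.
  apply/eqP; rewrite -subr_eq0 -normr_le0; apply: le_trans (lip _ _ Bg Bq) _.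
  by rewrite ug wg uq !subrr normr0 addr0 mulr0.
suff : (K \o ga) (w y) = (K \o ga) (w z) by rewrite /= !gaE.
apply: (@zero_derive_constant _ b0 r) => // b br; apply: is_derive_zero => e e0.
have [Bq uq wq] := gaP _ br; set q := ga b in Bq uq wq *; have Uq := BU _ Bq.
have [la laP] : exists la, forall i, pd i K q = la * pd i u q.
  have e1 := dKu _ Uq; have [n0|n0] := du0 _ Uq.
    exists (pd i0 K q / pd i0 u q) => i; case: (ord2E i) => ->; first by rewrite divfK.
    by apply: (mulIf n0); rewrite -e1 mulrAC divfK.
  exists (pd i1 K q / pd i1 u q) => i; case: (ord2E i) => ->; last by rewrite divfK.
  by apply: (mulIf n0); rewrite e1 mulrAC divfK.
pose Q v := K v - la * u v.
have sQ : smooth_on U Q by apply: smooth_subr => //; apply: smooth_mul => //; exact: smooth_cst.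
have dQ i : pd i Q q = 0.
  have [_ ->] := is_partial_sub (is_partial_smooth i sK Uq)
    (is_partial_mul (is_partial_cst i la q) (is_partial_smooth i su Uq)).
  by rewrite laP; ring.
have C1 : 0 < C + 1 by rewrite ltr_wpDl.
have e'0 : 0 < e / (2 * (C + 1)) by rewrite divr_gt0// mulr_gt0.
have near_small : \forall v \near q, U v /\ forall i, `|pd i Q v| <= e / (2 * (C + 1)).
  have sm i : \forall v \near q, `|pd i Q v| <= e / (2 * (C + 1)).
    by apply: nbhs_small => //; exact: smooth_continuous (smooth_pd i sQ) Uq.
  near=> v; split; first by near: v; exact: open_nbhs_nbhs.
  by move=> i; case: (ord2E i) => ->; near: v; exact: sm.
have [r0 /= r00 rB] := (nbhs_ballP _ _).1 near_small.
have tr : 0 < Num.min (r - `|b - b0|) (r0 / (C + 1)).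
  by rewrite lt_min subr_gt0 br divr_gt0.
apply/nbhs_ballP; exists (Num.min (r - `|b - b0|) (r0 / (C + 1))) => //= t.
rewrite -ball_normE/= sub0r normrN lt_min => /andP[t1 t2].
have btr : `|b + t - b0| < r.
  by rewrite addrAC; apply: le_lt_trans (ler_normD _ _) _; rewrite -ltrBrDl.
have [Bg ug wg] := gaP _ btr.
have dist : `|ga (b + t) - q| <= C * `|t|.
  apply: le_trans (lip _ _ Bg Bq) _.
  by rewrite ug uq wg wq subrr normr0 add0r [b + t]addrC addrK.
have Bt : ball q r0 (ga (b + t)).
  rewrite -ball_normE/= distrC; apply: le_lt_trans dist _.
  apply: (@le_lt_trans _ _ ((C + 1) * `|t|)); first by rewrite ler_wpM2r// lerDl.
  by rewrite mulrC -ltr_pdivlMr.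
have -> : K (ga (b + t)) - K q = Q (ga (b + t)) - Q q by rewrite /Q ug uq; ring.
have := @small_partials_lipschitz Q q r0 (e / (2 * (C + 1))) _ _ _ _ Bt (ballxx _ r00).
move=> /(_ _ _)/le_trans; apply.
- by move=> v /rB[Uv _]; exact: smooth_differentiable sQ Uv.
- by move=> v i /rB[_]; exact.
have -> : 2 * (e / (2 * (C + 1))) = e / (C + 1) by field; rewrite gt_eqF.
apply: le_trans (ler_wpM2l _ dist) _; first by rewrite divr_ge0 ?ltW.
rewrite mulrA; apply: ler_wpM2r => //; rewrite mulrAC ler_pdivrMr// ler_wpM2l ?ltW//.
by rewrite ltrDl.
Unshelve. all: by end_near. Qed.

(** K depends on u alone and L on w alone. If K is not zero at y1, then every v near p
    shares w with a point that shares u with y1, where L must vanish. *)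
Lemma separate_product_zero U u w K (L : E -> R) p : open U -> U p -> smooth_on U u -> smooth_on U w ->
  smooth_on U K -> smooth_on U L ->
  (forall v, U v -> pd i0 u v * pd i1 w v - pd i1 u v * pd i0 w v != 0) ->
  (forall v, U v -> pd i0 K v * pd i1 u v = pd i1 K v * pd i0 u v) ->
  (forall v, U v -> pd i0 L v * pd i1 w v = pd i1 L v * pd i0 w v) ->
  (forall v, U v -> K v * L v = 0) ->
  (\forall v \near p, K v = 0) \/ (\forall v \near p, L v = 0).
Proof.
move=> oU Up su sw sK sL D0 dK dL KL.
have [B [r [C [[pB BU] r0 C0 onto lip]]]] := local_coordinates oU Up su sw (D0 _ Up).
have du v : U v -> pd i0 u v != 0 \/ pd i1 u v != 0.
  move=> Uv; have [z0|] := eqVneq (pd i0 u v) 0; last by left.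
  have [z1|] := eqVneq (pd i1 u v) 0; last by right.
  by move: (D0 _ Uv); rewrite z0 z1 !mul0r subrr eqxx.
have dw v : U v -> pd i0 w v != 0 \/ pd i1 w v != 0.
  move=> Uv; have [z0|] := eqVneq (pd i0 w v) 0; last by left.
  have [z1|] := eqVneq (pd i1 w v) 0; last by right.
  by move: (D0 _ Uv); rewrite z0 z1 !mulr0 subrr eqxx.
have onto' a b : `|a - w p| < r -> `|b - u p| < r -> exists y, [/\ B y, w y = a & u y = b].
  by move=> ar br; have [y []] := onto _ _ br ar; exists y.
have lip' y z : B y -> B z -> `|y - z| <= C * (`|w y - w z| + `|u y - u z|).
  by move=> By Bz; rewrite [`|w y - _| + _]addrC; exact: lip.
have near_close : \forall v \near p, [/\ B v, `|u v - u p| < r & `|w v - w p| < r].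
  have cu : \forall v \near p, `|u v - u p| < r.
    have /cvgrPdist_lt/(_ _ r0) := smooth_continuous su Up.
    by apply: filterS => v; rewrite distrC.
  have cw : \forall v \near p, `|w v - w p| < r.
    have /cvgrPdist_lt/(_ _ r0) := smooth_continuous sw Up.
    by apply: filterS => v; rewrite distrC.
  by near=> v; split; near: v.
have [[y1 [By1 uy1 wy1 Ky1]]|noK] := pselect (exists y, [/\ B y, `|u y - u p| < r, `|w y - w p| < r & K y != 0]); last first.
  left; move: near_close; apply: filterS => v [Bv uv wv].
  by apply/eqP; apply: contra_notT noK => Kv; exists v.
right; move: near_close; apply: filterS => v [Bv uv wv].
have [y [By uy wy]] := onto _ _ uy1 wv.
have Ky : K y = K y1.
  by apply: (level_constant oU BU C0 su sK dK du onto lip) => //; rewrite ?uy ?wy.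
have Ly : L y = L v.
  by apply: (level_constant oU BU C0 sw sL dL dw onto' lip') => //; rewrite ?uy ?wy.
have /eqP := KL _ (BU _ By); rewrite Ky Ly mulf_eq0 (negbTE Ky1) /= => /eqP; exact.
Unshelve. all: by end_near. Qed.

End LocalInverse.

(** * Null directions of a surface with a double principal curvature *)

Section NullPair.
Context {R : realType}.
Local Notation E := 'rV[R]_2.
Context {c eps : R} {U : set E} {x n : E -> 'rV[R]_4}.
Hypothesis H : immersed_patch c eps U x n.
Let oU := patch_open H.
Let sx := patch_x H.
Let sn := patch_n H.
Let G0 := patch_G H.
Local Notation g := (fg c x).
Local Notation b := (fb c x n).
Local Notation G := (fG c x).
Local Notation X i := (pd i x).
Implicit Types (i j : 'I_2) (a d : 'rV[R]_4) (f : E -> R) (B Z : E -> 'rV[R]_4).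
Let P m f' u (sf' : smooth_on U f') (Uu : U u) := is_partial_smooth m sf' Uu.

(** The coefficients of a tangent field on the coordinate vectors. *)
Definition cof0 B u := (g i1 i1 u * dot c (B u) (X i0 u) - g i0 i1 u * dot c (B u) (X i1 u)) / G u.
Definition cof1 B u := (g i0 i0 u * dot c (B u) (X i1 u) - g i0 i1 u * dot c (B u) (X i0 u)) / G u.

Definition dir B f u := cof0 B u * pd i0 f u + cof1 B u * pd i1 f u.
Definition dirv B Z u := cof0 B u *: pd i0 Z u + cof1 B u *: pd i1 Z u.

Definition tangent_field B := [/\ smooth_on U B, (forall u, U u -> dot c (B u) (n u) = 0) &
  (forall u, U u -> dot c (B u) (x u) = 0)].

Lemma dirv_x B u : tangent_field B -> U u -> dirv B x u = B u.
Proof.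
move=> [sB Bn Bx] Uu; have n0 := G0 Uu.
apply/eqP; rewrite eq_sym -subr_eq0; apply/eqP; apply: (frame_ext H Uu).
- rewrite /dirv /cof0 /cof1 !dot_lin -/(g i0 i0 u) -/(g i1 i0 u) (fgC i1 i0).
  move: n0; rewrite /fG; move: (g i0 i0 u) (g i0 i1 u) (g i1 i1 u) (dot c (B u) _) (dot c (B u) _) => *; by field.
- rewrite /dirv /cof0 /cof1 !dot_lin -/(g i0 i1 u) -/(g i1 i1 u).
  move: n0; rewrite /fG; move: (g i0 i0 u) (g i0 i1 u) (g i1 i1 u) (dot c (B u) _) (dot c (B u) _) => *; by field.
- by rewrite /dirv !dot_lin Bn// ![dot c (X _ u) (n u)]dotC !(patch_nt H)//; ring.
- by rewrite /dirv !dot_lin Bx// !(ip_xi_x H)//; ring.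
Qed.

Lemma smooth_cof B : tangent_field B -> smooth_on U (cof0 B) /\ smooth_on U (cof1 B).
Proof.
move=> [sB _ _]; have sg i j := smooth_g H i j; have sG := smooth_Ginv H.
have sX i : smooth_on U (fun u => dot c (B u) (X i u)).
  by apply: smooth_dot => //; exact: smooth_pd.
by split; apply: smooth_mul => //; apply: smooth_subr => //; apply: smooth_mul.
Qed.

Lemma dir_dot B Z Z' u : smooth_on U Z -> smooth_on U Z' -> U u ->
  dir B (fun v => dot c (Z v) (Z' v)) u = dot c (dirv B Z u) (Z' u) + dot c (Z u) (dirv B Z' u).
Proof.
move=> sZ sZ' Uu; rewrite /dir /dirv.
have [_ ->] := is_partial_dot c i0 sZ sZ' Uu; have [_ ->] := is_partial_dot c i1 sZ sZ' Uu.
by rewrite !dot_lin; ring.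
Qed.

Lemma dir_cst B Z Z' (r : R) u : smooth_on U Z -> smooth_on U Z' -> U u ->
  (forall v, U v -> dot c (Z v) (Z' v) = r) -> dot c (dirv B Z u) (Z' u) + dot c (Z u) (dirv B Z' u) = 0.
Proof.
move=> sZ sZ' Uu e; rewrite -dir_dot// /dir.
have z i : pd i (fun v => dot c (Z v) (Z' v)) u = 0.
  rewrite (pd_ext i (g := fun=> r) oU)//; by have [] := is_partial_cst i r u.
by rewrite !z; ring.
Qed.

(** The second fundamental form on tangent fields. *)
Definition sff B B' u := - dot c (dirv B n u) (B' u).

Lemma sffE B B' u : tangent_field B' -> U u -> sff B B' u =
  cof0 B u * (cof0 B' u * b i0 i0 u + cof1 B' u * b i0 i1 u)
  + cof1 B u * (cof0 B' u * b i0 i1 u + cof1 B' u * b i1 i1 u).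
Proof.
move=> tB' Uu; rewrite /sff -(dirv_x tB' Uu) /dirv !dot_lin ![dot c (pd _ n u) _]dotC.
by rewrite !(ip_xi_nj H)// (fbC H i1 i0)//; ring.
Qed.

Lemma tangent_dot B B' u : tangent_field B -> tangent_field B' -> U u -> dot c (B u) (B' u) =
  cof0 B u * (cof0 B' u * g i0 i0 u + cof1 B' u * g i0 i1 u)
  + cof1 B u * (cof0 B' u * g i0 i1 u + cof1 B' u * g i1 i1 u).
Proof.
move=> tB tB' Uu; rewrite -{1}(dirv_x tB Uu) -{1}(dirv_x tB' Uu) /dirv !dot_lin.
by rewrite -/(g i0 i0 u) -/(g i0 i1 u) -/(g i1 i0 u) -/(g i1 i1 u) (fgC i1 i0); ring.
Qed.

Definition null_pair B B' := [/\ tangent_field B, tangent_field B',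
  forall u, U u -> dot c (B u) (B u) = 0, forall u, U u -> dot c (B' u) (B' u) = 0 &
  forall u, U u -> dot c (B u) (B' u) != 0].

Lemma null_pairC B B' : null_pair B B' -> null_pair B' B.
Proof. by move=> [tB tB' nB nB' n0]; split=> // u Uu; rewrite dotC n0. Qed.

Definition cofdet B B' u := cof0 B u * cof1 B' u - cof1 B u * cof0 B' u.

Lemma cofdet_square B B' u : null_pair B B' -> U u ->
  cofdet B B' u * cofdet B B' u * G u = - (dot c (B u) (B' u) * dot c (B u) (B' u)).
Proof.
move=> [tB tB' nB nB' n0] Uu; have := nB _ Uu; have := nB' _ Uu.
rewrite !tangent_dot// /fG /cofdet.
move: (cof0 B u) (cof1 B u) (cof0 B' u) (cof1 B' u) (g i0 i0 u) (g i0 i1 u) (g i1 i1 u) => a0 a1 d0 d1 g00 g01 g11 e' e.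
by apply: (lincomb (congr1 (fun z => z * (d0 * (d0 * g00 + d1 * g01) + d1 * (d0 * g01 + d1 * g11))) e)); ring.
Qed.

Lemma cofdet_neq0 B B' u : null_pair B B' -> U u -> cofdet B B' u != 0.
Proof.
move=> np Uu; have := cofdet_square np Uu; have [_ _ _ _ /(_ _ Uu) n0] := np.
apply: contra_eq_neq => ->; rewrite !mul0r eq_sym oppr_eq0; exact: mulf_neq0.
Qed.

Lemma null_ext B B' u a : null_pair B B' -> U u -> dot c a (B u) = 0 -> dot c a (B' u) = 0 ->
  dot c a (n u) = 0 -> dot c a (x u) = 0 -> a = 0.
Proof.
move=> np Uu aB aB' an ax; have [tB tB' _ _ _] := np; have D0 := cofdet_neq0 np Uu.
move: aB aB'; rewrite -(dirv_x tB Uu) -(dirv_x tB' Uu) /dirv !dot_lin => e e'.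
apply: (frame_ext H Uu) => //; apply: (mulfI D0); rewrite mulr0 /cofdet.
  by apply: (lincomb (congr2 (fun y z => cof1 B' u * y - cof1 B u * z) e e')); rewrite /=; ring.
by apply: (lincomb (congr2 (fun y z => cof0 B u * z - cof0 B' u * y) e e')); rewrite /=; ring.
Qed.

Section DoubleRoot.
Context {k : R}.
Hypothesis t_const : forall u, U u -> ft c x n u = 2 * k.
Hypothesis h_const : forall u, U u -> fh c x n u = k * k.

Lemma sff_cross B B' u : null_pair B B' -> U u -> sff B B' u = k * dot c (B u) (B' u).
Proof.
move=> np Uu; have [tB tB' nB nB' /(_ _ Uu) n0] := np; have sq := cofdet_square np Uu.
have := t_const Uu; have gn := G0 Uu; rewrite /ft => /(congr1 (fun z => z * G u)); rewrite divfK// => e.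
apply: (mulIf n0); move: (nB _ Uu) (nB' _ Uu) sq.
rewrite sffE// !tangent_dot// /cofdet.
move: e; move: (cof0 B u) (cof1 B u) (cof0 B' u) (cof1 B' u) (g i0 i0 u) (g i0 i1 u) (g i1 i1 u)
  (b i0 i0 u) (b i0 i1 u) (b i1 i1 u) (G u) => a0 a1 d0 d1 g00 g01 g11 b00 b01 b11 GG e eB eB' sq.
set D := (a0 * d1 - a1 * d0) in sq.
apply: (lincomb (congr2 (fun y z => - (D * D / 2) * y + z) e
  (congr2 (fun y z => (d0 * (d0 * b00 + d1 * b01) + d1 * (d0 * b01 + d1 * b11)) / 2 * y + z) eB
  (congr2 (fun y z => (a0 * (a0 * b00 + a1 * b01) + a1 * (a0 * b01 + a1 * b11)) / 2 * y - k * z) eB' sq)))).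
by rewrite /= /D; field.
Qed.

Lemma sff_product B B' u : null_pair B B' -> U u -> sff B B u * sff B' B' u = 0.
Proof.
move=> np Uu; have [tB tB' nB nB' /(_ _ Uu) n0] := np; have sq := cofdet_square np Uu.
have := h_const Uu; have gn := G0 Uu; rewrite /fh => /(congr1 (fun z => z * G u)); rewrite divfK// => e.
have := sff_cross np Uu; move: sq; rewrite !sffE// /cofdet.
move: e; move: (dot c (B u) (B' u)) (cof0 B u) (cof1 B u) (cof0 B' u) (cof1 B' u)
  (b i0 i0 u) (b i0 i1 u) (b i1 i1 u) (G u) => nu a0 a1 d0 d1 b00 b01 b11 GG e sq cr.
set D := (a0 * d1 - a1 * d0) in sq; set m := (X in X = k * nu) in cr.
apply: (lincomb (congr2 (fun y z => D * D * y + z) e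
  (congr2 (fun y z => k * k * y + (m + k * nu) * z) sq cr))).
by rewrite /= /m /D; ring.
Qed.

(** In a basis of null vectors, the trace and self-adjointness leave undetermined only
    the component of S B on the other null direction. *)
Lemma dirv_n B B' u : null_pair B B' -> U u ->
  dirv B n u = - (k *: B u + (sff B B u / dot c (B u) (B' u)) *: B' u).
Proof.
move=> np Uu; have [tB tB' nB nB' /(_ _ Uu) n0] := np.
have [sB Bn Bx] := tB; have [sB' B'n B'x] := tB'.
have dB : dot c (dirv B n u) (B u) = - sff B B u by rewrite /sff opprK.
have dB' : dot c (dirv B n u) (B' u) = - (k * dot c (B u) (B' u)).
  by rewrite -(sff_cross np Uu) /sff opprK.
have dn : dot c (dirv B n u) (n u) = 0.
  by rewrite /dirv !dot_lin ![dot c (pd _ n u) _]dotC !(ip_n_ni H)//; ring.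
have dx : dot c (dirv B n u) (x u) = 0 by rewrite /dirv !dot_lin !(ip_ni_x H)//; ring.
move: (dirv B n u) (sff B B u) dB dB' dn dx => d r dB dB' dn dx.
apply/eqP; rewrite -subr_eq0; apply/eqP; apply: (null_ext np Uu).
- rewrite !dot_lin nB// [dot c (B' u) _]dotC dB.
  move: n0; move: (dot c _ _) => *; by field.
- by rewrite !dot_lin nB'// dB'; ring.
- by rewrite !dot_lin Bn// B'n// dn; ring.
- by rewrite !dot_lin Bx// B'x// dx; ring.
Qed.

(** The integral lines of a null asymptotic direction are straight lines of the flat
    space. *)
Lemma dirv_asymptotic B B' u : null_pair B B' -> U u -> sff B B u = 0 ->
  dirv B B u = (dot c (dirv B B u) (B' u) / dot c (B u) (B' u)) *: B u.
Proof.
move=> np Uu BB0; have [tB tB' nB nB' /(_ _ Uu) n0] := np; have [sB Bn Bx] := tB.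
have dB : dot c (dirv B B u) (B u) = 0.
  have := dir_cst B sB sB Uu nB; rewrite [dot c (B u) (dirv _ _ _)]dotC => /eqP.
  by rewrite -mulr2n mulrn_eq0 /= => /eqP.
have dn : dot c (dirv B B u) (n u) = 0.
  have := dir_cst B sB sn Uu Bn.
  by rewrite [dot c (B u) (dirv _ _ _)]dotC -[dot c (dirv B n u) _]opprK -/(sff B B u) BB0 oppr0 addr0.
have dx : dot c (dirv B B u) (x u) = 0.
  by have := dir_cst B sB sx Uu Bx; rewrite dirv_x// nB// addr0.
move: (dirv B B u) dB dn dx => d dB dn dx.
apply/eqP; rewrite -subr_eq0; apply/eqP; apply: (null_ext np Uu).
- by rewrite !dot_lin nB// dB; ring.
- by rewrite !dot_lin divfK// subrr.
- by rewrite !dot_lin Bn// dn; ring.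
- by rewrite !dot_lin Bx// dx; ring.
Qed.

Lemma smooth_dir V B f : open V -> V `<=` U -> tangent_field B -> smooth_on V f -> smooth_on V (dir B f).
Proof.
move=> oV VU tB sf; have [c0 c1] := smooth_cof tB.
by apply: smooth_add => //; apply: smooth_mul => //;
  [exact: smooth_sub VU c0|exact: smooth_pd|exact: smooth_sub VU c1|exact: smooth_pd].
Qed.

Lemma open_nonzero V f : open V -> smooth_on V f -> open [set v | V v /\ f v != 0].
Proof.
move=> oV sf; rewrite openE => v [Vv fv]; rewrite /interior.
near=> w; split; near: w; first exact: open_nbhs_nbhs.
have /cvgrPdist_lt/(_ `|f v|) := smooth_continuous sf Vv; rewrite normr_gt0 => /(_ fv).
by apply: filterS => w; apply: contraTneq => ->; rewrite subr0 ltxx.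
Unshelve. all: by end_near. Qed.

(** The direction of B in the flat space, read as the ratio u of two of its components,
    is constant along the lines of B where these are asymptotic: it serves as a null
    coordinate. The map n + k x moves only across those lines, and the ratio kap of its
    derivative to that of u vanishes exactly where the second fundamental form does on
    B'. Where it does not vanish, df = kap du for a projection f of the map, so that
    dkap and du are proportional; squaring kap extends this to its zeros. *)
Lemma null_coordinate B B' p : null_pair B B' -> U p -> exists (V : set E) (u K : E -> R),
  [/\ open V, V p, V `<=` U, smooth_on V u & smooth_on V K] /\
  [/\ forall v, V v -> dir B' u v != 0, forall v, V v -> sff B B v = 0 -> dir B u v = 0,
      forall v, V v -> (K v = 0 <-> sff B' B' v = 0) &
      forall v, V v -> pd i0 K v * pd i1 u v = pd i1 K v * pd i0 u v].
Proof.
move=> np Up; have [tB tB' nB nB' n0] := np; have [sB Bn Bx] := tB; have [sB' B'n B'x] := tB'.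
(* with this choice the derivative of u along B' is -1 at p *)
pose a := x p; pose d := B' p.
have scst (r : 'rV[R]_4) : smooth_on U (fun=> r) by exact: smooth_cst.
pose q v := dot c (B v) d.
have sq : smooth_on U q by exact: smooth_dot.
pose V0 := [set v | U v /\ q v != 0].
have oV0 : open V0 by exact: open_nonzero.
have V0U : V0 `<=` U by move=> v [].
pose u v := dot c (B v) a * (q v)^-1.
have su0 : smooth_on V0 u.
  apply: smooth_mul => //; first by apply: smooth_sub V0U _; exact: smooth_dot.
  by apply: smooth_inv => //; [move=> v []|exact: smooth_sub V0U sq].
have dirB Z v : V0 v -> dir Z u v =
    (dot c (dirv Z B v) a * q v - dot c (B v) a * dot c (dirv Z B v) d) / (q v * q v).
  move=> [Uv qv]; rewrite /dir /dirv !dot_lin.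
  have D i : pd i u v = dot c (pd i B v) a * (q v)^-1 + dot c (B v) a * (- dot c (pd i B v) d / (q v * q v)).
    have pa r : is_partial i (fun v => dot c (B v) r) v (dot c (pd i B v) r).
      by apply: is_partial_eq (P i (smooth_dot c oU sB (scst r)) Uv) _; rewrite (pd_dotl _ _ sB Uv).
    by have [_ ->] := is_partial_mul (pa a) (is_partial_inv qv (pa d)).
  rewrite !D; move: qv; move: (q v) => r r0; by field.
pose V := [set v | V0 v /\ dir B' u v != 0].
have oV : open V by apply: open_nonzero => //; exact: smooth_dir.
have VV0 : V `<=` V0 by move=> v [].
have VU : V `<=` U by move=> v /VV0/V0U.
have qp : q p = dot c (B p) (B' p) by [].
have V0p : V0 p by split=> //; rewrite qp; exact: n0.
have Vp : V p.
  split=> //; rewrite dirB// /a Bx// mul0r subr0.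
  have := dir_cst B' sB sx Up Bx; rewrite (dirv_x tB' Up) -qp => /eqP; rewrite addr_eq0 => /eqP ->.
  have [_ q0] := V0p; by rewrite mulNr mulNr oppr_eq0 mulfV ?oner_neq0// mulf_neq0.
pose f v := dot c (n v) d + k * dot c (x v) d.
have sf : smooth_on U f.
  by apply: smooth_add => //; [exact: smooth_dot|apply: smooth_mul; [exact: oU|exact: smooth_cst|exact: smooth_dot]].
have dirf Z v : tangent_field Z -> U v -> dir Z f v = dot c (dirv Z n v + k *: Z v) d.
  move=> tZ Uv; rewrite -[in RHS](dirv_x tZ Uv) /dir /dirv !dot_lin.
  have D i : pd i f v = dot c (pd i n v) d + k * dot c (pd i x v) d.
    have [_ ->] := is_partial_add (P i (smooth_dot c oU sn (scst d)) Uv)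
      (is_partial_mul (is_partial_cst i k v) (P i (smooth_dot c oU sx (scst d)) Uv)).
    by rewrite !(pd_dotl _ _ _ Uv)//; ring.
  by rewrite !D; ring.
have df' v : U v -> dir B' f v = - (sff B' B' v / dot c (B v) (B' v)) * q v.
  by move=> Uv; rewrite dirf// (dirv_n (null_pairC np) Uv) dotC !dot_lin dotC [dot c d _]dotC [dot c (B' v) (B v)]dotC -/(q v); ring.
have df v : U v -> sff B B v = 0 -> dir B f v = 0.
  by move=> Uv s0; rewrite dirf// (dirv_n np Uv) s0 mul0r scale0r addr0 addNr dot0l.
pose kap v := dir B' f v * (dir B' u v)^-1.
have skap : smooth_on V kap.
  apply: smooth_mul => //; first by apply: smooth_sub VU _; exact: smooth_dir.
  apply: smooth_inv => //; first by move=> v [].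
  by apply: smooth_dir => //; exact: smooth_sub VV0 su0.
have su : smooth_on V u by exact: smooth_sub VV0 su0.
have kap0 v : V v -> kap v = 0 <-> sff B' B' v = 0.
  move=> Vv; have [[Uv qv] du0] := Vv; rewrite /kap df'//; split=> [/eqP|->]; last by rewrite !mul0r oppr0 !mul0r.
  by rewrite !mulf_eq0 oppr_eq0 mulf_eq0 !invr_eq0 (negbTE (n0 _ Uv)) (negbTE qv) (negbTE du0) !orbF => /eqP.
have asym v : V v -> sff B B v = 0 -> dir B u v = 0.
  move=> Vv s0; have [V0v _] := Vv; have [Uv qv] := V0v; rewrite dirB// (dirv_asymptotic np Uv s0).
  by rewrite !dot_lin -/(q v); ring.
exists V, u, (fun v => kap v * kap v); split.
  by split=> //; exact: smooth_mul.
split=> //; first by move=> v [].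
  by move=> v Vv; rewrite -kap0//; split=> [/eqP|->]; [rewrite mulf_eq0 orbb => /eqP|rewrite mulr0].
move=> v Vv.
have DK i : pd i (fun v => kap v * kap v) v = pd i kap v * kap v + kap v * pd i kap v.
  by have [_ ->] := is_partial_mul (is_partial_smooth i skap Vv) (is_partial_smooth i skap Vv).
rewrite !DK; have [->|kv] := eqVneq (kap v) 0; first by ring.
pose W := [set v | V v /\ kap v != 0].
have oW : open W by exact: open_nonzero.
have Wv : W v by [].
have fu i w : W w -> pd i f w = kap w * pd i u w.
  move=> [Vw kw]; have Uw := VU _ Vw.
  have s0 : sff B B w = 0.
    have /eqP := sff_product np Uw; rewrite mulf_eq0 => /orP[/eqP//|/eqP s'].
    by move: kw; rewrite (kap0 _ Vw).2// eqxx.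
  have e1 : dir B f w - kap w * dir B u w = 0 by rewrite df// asym//; ring.
  have e2 : dir B' f w - kap w * dir B' u w = 0.
    by have [_ du0] := Vw; rewrite /kap divfK// subrr.
  move: e1 e2; rewrite /dir => e1 e2.
  apply: (mulfI (cofdet_neq0 np Uw)); rewrite /cofdet.
  case: (ord2E i) => ->.
    by apply: (lincomb (congr2 (fun y z => cof1 B' w * y - cof1 B w * z) e1 e2)); rewrite /=; ring.
  by apply: (lincomb (congr2 (fun y z => cof0 B w * z - cof0 B' w * y) e1 e2)); rewrite /=; ring.
have WV : W `<=` V by move=> w [].
have fW : smooth_on W f by apply: smooth_sub sf => w /WV/VU.
have uW : smooth_on W u by exact: smooth_sub WV su.
have kW : smooth_on W kap by exact: smooth_sub WV skap.
have second i j : pd j (pd i f) v = pd j kap v * pd i u v + kap v * pd j (pd i u) v.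
  have [_ <-] := is_partial_mul (is_partial_smooth j kW Wv) (is_partial_smooth j (smooth_pd i uW) Wv).
  exact: (pd_ext j oW (fu i)).
have := schwarz i0 i1 oW fW Wv; have := schwarz i0 i1 oW uW Wv; rewrite !second => e1 e2.
by apply: (lincomb (congr2 (fun y z => 2 * kap v * (y - kap v * z)) e2 e1)); rewrite /=; ring.
Qed.

(** In null coordinates the second fundamental form on B depends on one coordinate
    and that on B' on the other; their product vanishes, so locally one of them does. *)
Lemma null_alternative B B' p : null_pair B B' -> U p ->
  (\forall v \near p, sff B B v = 0) \/ (\forall v \near p, sff B' B' v = 0).
Proof.
move=> np Up; have np' := null_pairC np; have [tB tB' _ _ _] := np.
have [V [u [K [[oV Vp VU su sK] [u'0 uB K0 dK]]]]] := null_coordinate np Up.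
have [V' [w [L [[oV' V'p V'U sw sL] [w'0 wB L0 dL]]]]] := null_coordinate np' Up.
have ssff Z : tangent_field Z -> smooth_on U (sff Z Z).
  move=> tZ; have [c0 c1] := smooth_cof tZ; have sb i j := smooth_b H i j.
  apply: smooth_ext oU (fun v Uv => esym (sffE Z tZ Uv)) _.
  by repeat first [apply: smooth_add => //|apply: smooth_mul => //].
have alt Z Z' : null_pair Z Z' -> sff Z Z p != 0 -> \forall v \near p, sff Z' Z' v = 0.
  move=> npZ s0; have [tZ _ _ _ _] := npZ.
  near=> v; have [Uv sv] : [set v | U v /\ sff Z Z v != 0] v.
    near: v; apply: open_nbhs_nbhs; split=> //; apply: open_nonzero => //; exact: ssff.
  have /eqP := sff_product npZ Uv; rewrite mulf_eq0 (negbTE sv) => /eqP; exact.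
have [s0|s0] := eqVneq (sff B B p) 0; last by right; exact: alt np s0.
have [s'0|s'0] := eqVneq (sff B' B' p) 0; last by left; exact: alt np' s'0.
pose W0 := V `&` V'.
have oW0 : open W0 by exact: openI.
have W0V : W0 `<=` V by move=> v [].
have W0V' : W0 `<=` V' by move=> v [].
pose D v := pd i0 u v * pd i1 w v - pd i1 u v * pd i0 w v.
have sD : smooth_on W0 D.
  apply: smooth_subr => //; apply: smooth_mul => //; apply: smooth_pd;
    [exact: smooth_sub W0V su|exact: smooth_sub W0V' sw|exact: smooth_sub W0V su|exact: smooth_sub W0V' sw].
have Dp : D p != 0.
  have : cofdet B B' p * D p = dir B u p * dir B' w p - dir B' u p * dir B w p.
    by rewrite /cofdet /D /dir; ring.
  rewrite uB// mul0r sub0r; apply: contra_eq_neq => ->; rewrite mulr0 eq_sym oppr_eq0.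
  by apply: mulf_neq0; [exact: u'0|exact: w'0].
pose W := [set v | W0 v /\ D v != 0].
have oW : open W by exact: open_nonzero.
have WV : W `<=` V by move=> v [] /W0V.
have WV' : W `<=` V' by move=> v [] /W0V'.
have Wp : W p by [].
have KL v : W v -> K v * L v = 0.
  move=> Wv; have Uv := VU _ (WV _ Wv).
  have /eqP := sff_product np Uv; rewrite mulf_eq0 => /orP[/eqP s|/eqP s].
    by rewrite (L0 _ (WV' _ Wv)).2// mulr0.
  by rewrite (K0 _ (WV _ Wv)).2// mul0r.
have [Kz|Lz] := separate_product_zero oW Wp (smooth_sub WV su) (smooth_sub WV' sw) (smooth_sub WV sK)
  (smooth_sub WV' sL) (fun v Wv => Wv.2) (fun v Wv => dK v (WV _ Wv)) (fun v Wv => dL v (WV' _ Wv)) KL.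
- right; near=> v; apply/K0; last by near: v.
  by near: v; exact: open_nbhs_nbhs.
- left; near=> v; apply/L0; last by near: v.
  by near: v; exact: open_nbhs_nbhs.
Unshelve. all: by end_near. Qed.

End DoubleRoot.
End NullPair.

(** * Bump functions and a partition of unity *)

Section Bump.
Context {R : realType}.
Local Notation E := 'rV[R]_2.

(** The function exp(-1/x), extended by zero, and its products with powers of 1/x. *)
Definition flat_exp (k : nat) (x : R) : R := if 0 < x then x^-1 ^+ k * expR (- x^-1) else 0.

Lemma flat_exp_ge0 k x : 0 <= flat_exp k x.
Proof.
rewrite /flat_exp; case: ifP => // x0; apply: mulr_ge0; last exact: expR_ge0.
by rewrite exprn_ge0// invr_ge0 ltW.
Qed.

Lemma flat_exp_gt0 k x : 0 < x -> 0 < flat_exp k x.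
Proof. by move=> x0; rewrite /flat_exp x0 mulr_gt0 ?expR_gt0// exprn_gt0 ?invr_gt0. Qed.

(** From the inequality (v / m)^m <= exp v, with v = 1 / x and m = k + 2. *)
Lemma flat_exp_bound k x : flat_exp k x <= (k.+2)%:R ^+ k.+2 * x ^+ 2.
Proof.
rewrite /flat_exp; case: ifP => [x0|_]; last by apply: mulr_ge0; [exact: exprn_ge0|exact: sqr_ge0].
have v0 : 0 < x^-1 by rewrite invr_gt0.
set v := x^-1 in v0 *; set m := k.+2.
have m0 : (0 : R) < m%:R by rewrite ltr0n.
have lower : (v / m%:R) ^+ m <= expR v.
  have -> : expR v = expR (v / m%:R) ^+ m by rewrite -expRM_natl mulrC divfK// gt_eqF.
  apply: lerXn2r; rewrite ?nnegrE ?divr_ge0 ?expR_ge0 ?ltW//.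
  by apply: lt_le_trans (expR_ge1Dx _); rewrite ltrDr.
have -> : x ^+ 2 = v ^- 2 by rewrite /v -exprVn invrK.
rewrite expRN ler_pdivrMr ?expR_gt0//.
have -> : v ^+ k = m%:R ^+ m * v ^- 2 * (v / m%:R) ^+ m.
  rewrite expr_div_n [RHS]mulrC mulrA divfK ?expf_neq0 ?gt_eqF// /m -[in RHS]addn2 exprD mulfK//.
  by rewrite expf_neq0// gt_eqF.
apply: ler_wpM2l => //; apply: mulr_ge0; first exact/exprn_ge0/ltW.
by rewrite invr_ge0 sqr_ge0.
Qed.

Lemma is_derive_flat_exp (k : nat) (x : R) : is_derive x 1 (flat_exp k) (flat_exp k.+2 x - k%:R * flat_exp k.+1 x).
Proof.
have [x0|x0|->] := ltgtP x 0.
- rewrite /flat_exp (le_gtF (ltW x0)) mulr0 subrr.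
  apply: (@near_eq_is_derive _ _ _ (fun=> 0)).
  near=> y; rewrite (_ : (0 < y) = false)//; apply/negbTE; rewrite -leNgt; apply: ltW.
  by near: y; exact: lt_nbhsl.
- have h1 : is_derive x 1 (fun y : R => y^-1) (- x ^- 2 *: 1).
    by apply: (@is_deriveV _ (fun y => y)); rewrite gt_eqF.
  have h2 := is_deriveX k h1.
  have h3 := is_deriveN h1.
  have h4 := @is_derive1_comp R expR (- (fun y : R => y^-1)) x _ _ (is_derive_expR (- x^-1)) h3.
  have h5 := is_deriveM h2 h4.
  apply: (@near_eq_is_derive _ _ _ (((fun y : R => y^-1) ^+ k) * (expR \o - (fun y : R => y^-1)))).
    near=> y; rewrite /flat_exp (_ : 0 < y); last by near: y; exact: lt_nbhsr.
    by rewrite !fctE.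
  apply: is_derive_eq h5 _; rewrite /flat_exp x0 !fctE /GRing.scale /= -exprVn.
  move: (x^-1) (expR _) => v e; case: k {h2} => [|k]; first by rewrite expr1 expr0 !expr2; ring.
  by rewrite /= !exprS; ring.
- apply: is_derive_eq (_ : is_derive _ _ _ 0) _; last by rewrite /flat_exp ltxx mulr0 subrr.
  apply: is_derive_zero => e e0; set C : R := (k.+2)%:R ^+ k.+2.
  have C0 : 0 < C by rewrite exprn_gt0// ltr0n.
  apply/nbhs_ballP; exists (e / C) => /=; first exact: divr_gt0.
  move=> t; rewrite -ball_normE/= sub0r normrN => te.
  rewrite add0r {2}/flat_exp ltxx subr0 ger0_norm ?flat_exp_ge0//.
  apply: le_trans (flat_exp_bound _ _) _; rewrite -/C -[t ^+ 2]ger0_norm ?sqr_ge0// normrX expr2 mulrA.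
  by apply: ler_wpM2r => //; rewrite mulrC -ler_pdivlMr// ltW.
Unshelve. all: by end_near. Qed.

Lemma C1n_sub n (f g : R -> R) r : C1n n f -> C1n n g -> C1n n (fun x => f x - r * g x).
Proof.
elim: n f g => [|n IHn] f g.
  by move=> cf cg x; apply: cvgB; [exact: cf|apply: cvgM; [exact: cvg_cst|exact: cg]].
move=> [df pf] [dg pg]; have D (x : R) : is_derive x 1 (fun x => f x - r * g x) (derive1 f x - r * derive1 g x).
  have h1 : is_derive x 1 f (derive1 f x) by rewrite derive1E; exact: derivableP.
  have h2 : is_derive x 1 g (derive1 g x) by rewrite derive1E; exact: derivableP.
  exact: is_deriveB h1 (is_deriveZ r h2).
split=> [x|]; first by have [] := D x.
have -> : derive1 (fun x => f x - r * g x) = fun x => derive1 f x - r * derive1 g x.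
  by apply/funext => x; rewrite derive1E; have [_] := D x.
exact: IHn.
Qed.

(** Derivation preserves the span of the family, so all its members are smooth. *)
Lemma C1n_flat_exp n k : C1n n (flat_exp k).
Proof.
have dk j x : derivable (flat_exp j) x 1 by have [] := is_derive_flat_exp j x.
elim: n k => [|n IHn] k.
  by move=> x; apply: differentiable_continuous; exact/derivable1_diffP.
split=> // .
have -> : derive1 (flat_exp k) = fun x => flat_exp k.+2 x - k%:R * flat_exp k.+1 x.
  by apply/funext => x; rewrite derive1E; have [_] := is_derive_flat_exp k x.
exact: C1n_sub.
Qed.

Definition bump (p : E) (r : R) (v : E) : R :=
  let q := (v 0 i0 - p 0 i0) * (v 0 i0 - p 0 i0) + (v 0 i1 - p 0 i1) * (v 0 i1 - p 0 i1) in
  flat_exp 0 (r * r - q) * (flat_exp 0 (r * r - q) + flat_exp 0 (q - r * r / 4))^-1.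

Lemma smooth_bump p r U : open U -> 0 < r -> smooth_on U (bump p r).
Proof.
move=> oU r0; set q := fun v : E => (v 0 i0 - p 0 i0) * (v 0 i0 - p 0 i0) + (v 0 i1 - p 0 i1) * (v 0 i1 - p 0 i1).
have sc i : smooth_on U (fun v : E => v 0 i - p 0 i).
  by apply: smooth_subr => //; [exact: smooth_coord (@smooth_id R U)|exact: smooth_cst].
have sq : smooth_on U q by apply: smooth_add => //; apply: smooth_mul.
have s1 : smooth_on U (fun v => flat_exp 0 (r * r - q v)).
  have sq' : smooth_on U (fun v => r * r - q v) by apply: smooth_subr => //; exact: smooth_cst.
  by move=> n; exact: (Cn_comp1 oU (C1n_flat_exp n 0) (sq' n)).
have s2 : smooth_on U (fun v => flat_exp 0 (q v - r * r / 4)).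
  have sq' : smooth_on U (fun v => q v - r * r / 4) by apply: smooth_subr => //; exact: smooth_cst.
  by move=> n; exact: (Cn_comp1 oU (C1n_flat_exp n 0) (sq' n)).
apply: smooth_mul => //; apply: smooth_inv => //; last exact: smooth_add.
move=> v _; rewrite gt_eqF//; have rr : 0 < r * r by exact: mulr_gt0.
have [q0|q0] := ltP (q v) (r * r).
  by rewrite ltr_pwDl ?flat_exp_ge0// flat_exp_gt0// subr_gt0.
rewrite ltr_wpDl ?flat_exp_ge0// flat_exp_gt0// subr_gt0; apply: lt_le_trans q0.
by rewrite ltr_pdivrMr// ltr_pMr// ltr1n.
Qed.

Lemma bump_support p r v : 0 < r -> bump p r v != 0 -> `|p - v| <= r.
Proof.
move=> r0; rewrite /bump; set q := (X in r * r - X).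
have [q0 _|q0] := ltP q (r * r); last first.
  by rewrite {1}/flat_exp subr_gt0 ltNge q0 /= mul0r eqxx.
have co i : (v 0 i - p 0 i) * (v 0 i - p 0 i) <= q.
  by case: (ord2E i) => ->; rewrite /q ?lerDl ?lerDr -expr2 sqr_ge0.
have ab i : `|(p - v) 0 i| <= r.
  rewrite !mxE distrC -(ler_pXn2r (n := 2)) ?nnegrE//; last exact: ltW.
  rewrite real_normK ?num_real// !expr2; apply: ltW; exact: le_lt_trans (co i) q0.
by apply: rV2_norm_le; exact: ab.
Qed.

Lemma bump_one p r v : 0 < r -> `|p - v| < r / 4 -> bump p r v = 1.
Proof.
move=> r0 pv; rewrite /bump; set q := (X in r * r - X).
have ab i : (v 0 i - p 0 i) * (v 0 i - p 0 i) <= (r / 4) ^+ 2.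
  have : `|(p - v) 0 i| <= r / 4 by apply: le_trans (rV2_coord_le _ i) (ltW pv).
  rewrite !mxE distrC => h; rewrite -expr2 -real_normK ?num_real//.
  by rewrite ler_pXn2r ?nnegrE// divr_ge0 ?ltW.
have q1 : q <= r * r / 4.
  have := lerD (ab i0) (ab i1); rewrite -/q => /le_trans; apply.
  have -> : (r / 4) ^+ 2 + (r / 4) ^+ 2 = r * r / 8 by field.
  have rr : 0 <= r * r by rewrite mulr_ge0 ?ltW.
  by rewrite ler_wpM2l// lef_pV2 ?posrE// ler_nat.
have rr : 0 < r * r by exact: mulr_gt0.
have z : flat_exp 0 (q - r * r / 4) = 0 by rewrite /flat_exp subr_gt0 ltNge q1.
rewrite z addr0 mulfV// gt_eqF// flat_exp_gt0// subr_gt0; apply: le_lt_trans q1 _.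
by rewrite ltr_pdivrMr// ltr_pMr// ltr1n.
Qed.

End Bump.

Section Separation.
Context {R : realType} {M : topologicalType} {A : set (chart R M)}.
Local Notation E := 'rV[R]_2.
Implicit Types (phi chi : chart R M) (p q : M).

Lemma smooth_local (V : normedModType R) (U : set E) (f : E -> V) :
  (forall u, U u -> exists W, [/\ open W, W u & smooth_on W f]) -> smooth_on U f.
Proof.
move=> loc n; elim: n f loc => [|n IHn] f loc.
  by move=> u Uu; have [W [_ Wu sf]] := loc _ Uu; exact: sf 0%N _ Wu.
split=> [u Uu|i]; first by have [W [_ Wu sf]] := loc _ Uu; exact: (sf 1%N).1 _ Wu.
apply: IHn => u Uu; have [W [oW Wu sf]] := loc _ Uu; exists W; split=> // m.
exact: (sf m.+1).2.
Qed.

Lemma open_cinv_preimage phi (O : set M) : open O -> open [set u | cimg phi u /\ O (cinv phi u)].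
Proof.
move=> oO; rewrite openE => u [Uu Ou]; rewrite /interior.
near=> v; split; near: v; first by apply: open_nbhs_nbhs; split=> //; exact: open_cimg.
by apply: (continuous_cinv Uu); exact: open_nbhs_nbhs.
Unshelve. all: by end_near. Qed.

(** The support of a bump in a chart is compact, hence closed in a separated space, so
    that its extension by zero is smooth. *)
Lemma smooth_bump_at p (O : set M) : hausdorff_space M -> atlas A -> open O -> O p ->
  exists b : M -> R, [/\ smooth A b, forall q, ~ O q -> b q = 0 & \forall q \near p, b q = 1].
Proof.
move=> hausM [cov cA] oO Op; have [phi Aphi dp] := cov p.
pose U' := [set u | cimg phi u /\ O (cinv phi u)].
have oU' : open U' by exact: open_cinv_preimage.
have U'p : U' (cmap phi p) by split; [exact: cmap_cimg|rewrite cmapK].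
have [r' /= r'0 rU'] := (nbhs_ballP _ _).1 (open_nbhs_nbhs (conj oU' U'p)).
pose r := r' / 2; have r0 : 0 < r by exact: divr_gt0.
pose K := closed_ball (cmap phi p) r.
have KE v : K v <-> `|cmap phi p - v| <= r by rewrite /K closed_ballE.
have KU v : K v -> U' v.
  move=> /KE Kv; apply: rU'; rewrite -ball_normE/=; apply: le_lt_trans Kv _.
  by rewrite ltr_pdivrMr// ltr_pMr// ltr1n.
have cK : compact K.
  apply: bounded_closed_compact; last exact: closed_ball_closed.
  exists (`|cmap phi p| + r); split=> [|k kr v /KE Kv] /=; first exact: num_real.
  apply: le_trans (ltW kr); apply: (@le_trans _ _ (`|cmap phi p| + `|cmap phi p - v|)); last by rewrite lerD2l.
  by have := ler_normB (cmap phi p) (cmap phi p - v); rewrite opprB addrC subrK.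
have cKM : closed (cinv phi @` K).
  apply: (compact_closed hausM); apply: continuous_compact => //.
  apply: continuous_in_subspaceT => v; rewrite inE => /KU[Uv _]; exact: continuous_cinv.
pose b q := if pselect (cdom phi q) then bump (cmap phi p) r (cmap phi q) else 0.
have bE q : cdom phi q -> b q = bump (cmap phi p) r (cmap phi q) by rewrite /b; case: pselect.
have b0 q : ~ (cinv phi @` K) q -> b q = 0.
  move=> nK; rewrite /b; case: pselect => // dq; apply/eqP; apply: contra_notT nK => bn.
  by exists (cmap phi q); [apply/KE; exact: bump_support r0 bn|rewrite cmapK].
exists b; split.
- move=> chi Achi; apply: smooth_local => u Uu.
  have [dq|ndq] := pselect (cdom phi (cinv chi u)).
    exists (overlap chi phi); split; [exact: open_overlap|by split|].
    have [sT _] := cA _ _ Achi Aphi.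
    apply: (@smooth_ext _ _ _ (bump (cmap phi p) r \o transition chi phi)).
    - exact: open_overlap.
    - by move=> v [_ dv] /=; rewrite bE.
    - apply: (@smooth_comp _ _ setT) => //; [exact: open_overlap|].
      by apply: smooth_bump => //; exact: openT.
  exists [set v | cimg chi v /\ (~` (cinv phi @` K)) (cinv chi v)]; split.
  - by apply: open_cinv_preimage; exact: closed_openC.
  - split=> // -[v Kv vu]; apply: ndq; rewrite -vu; apply: cinv_cdom; exact: (KU _ Kv).1.
  - apply: (@smooth_ext _ _ _ (fun=> 0)); [|by move=> v [_ nv] /=; rewrite b0|exact: smooth_cst].
    by apply: open_cinv_preimage; exact: closed_openC.
- by move=> q nO; apply: b0 => -[v /KU[_ Ov] vq]; apply: nO; rewrite -vq.
- have r4 : 0 < r / 4 by exact: divr_gt0.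
  have := @open_cmap_preimage _ _ phi (ball (cmap phi p) (r / 4)) p (ball_open _ _) dp (ballxx _ r4).
  apply: filterS => q [dq Bq]; rewrite bE//; apply: bump_one => //.
  by move: Bq; rewrite -ball_normE.
Unshelve. all: by end_near. Qed.

(** Countably many bumps b_n, each supported in O1 or in O2, are such that around every
    point one of them equals 1. The products b_n (1 - b_0) ... (1 - b_{n-1}) then vanish
    locally for large n and add up to 1; g is the sum of those supported in O1. *)
Lemma smooth_separation (O1 O2 : set M) : hausdorff_space M -> @second_countable M -> atlas A ->
  open O1 -> open O2 -> (forall p, O1 p \/ O2 p) ->
  exists g : M -> R, [/\ smooth A g, forall p, ~ O1 p -> g p = 0 & forall p, ~ O2 p -> g p = 1].
Proof.
move=> hausM [B cB [oB bB]] atA oO1 oO2 O12.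
have /countable_injP[f finj] := cB.
pose good (d : (M -> R) * bool) := smooth A d.1 /\ forall q, ~ (if d.2 then O1 q else O2 q) -> d.1 q = 0.
have good0 : good (fun=> 0, true) by split=> // phi _; exact: smooth_cst.
have local p : exists d V, [/\ good d, B V, V p & forall q, V q -> d.1 q = 1].
  have mk (sg : bool) : (if sg then O1 p else O2 p) -> exists d V, [/\ good d, B V, V p & forall q, V q -> d.1 q = 1].
    move=> Op; have oO : open (if sg then O1 else O2) by case: (sg).
    have Op' : (if sg then O1 else O2) p by case: (sg) Op.
    have [b [sb b0 b1]] := smooth_bump_at hausM atA oO Op'.
    have [V /= [BV Vp] Vb] := bB p _ b1.
    by exists (b, sg), V; split=> //; split=> //= q nO; apply: b0; case: (sg) nO.
  by have [/(mk true)|/(mk false)] := O12 p.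
have /choice[d dP] : forall m : nat, exists d, good d /\
    ((exists V d', [/\ good d', B V, f V = m & forall q, V q -> d'.1 q = 1]) ->
     exists V, [/\ B V, f V = m & forall q, V q -> d.1 q = 1]).
  move=> m; have [[V [d' [gd BV fV Vd]]]|no] := pselect (exists V d', [/\ good d', B V, f V = m & forall q, V q -> d'.1 q = 1]).
    by exists d'; split=> // _; exists V.
  by exists (fun=> 0, true).
have covered p : exists m, \forall q \near p, (d m).1 q = 1.
  have [d' [V [gd BV Vp Vd]]] := local p; exists (f V).
  have [|V' [BV' fV' V'd]] := (dP (f V)).2; first by exists V, d'.
  have VV' : V' = V by apply: finj; rewrite ?inE.
  have : nbhs p V by apply: open_nbhs_nbhs; split=> //; exact: oB.
  by apply: filterS => q Vq; apply: V'd; rewrite VV'.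
(* the successive remainders and the partial sums of the partition of unity *)
pose rem := fix rem n q : R := if n is n'.+1 then rem n' q * (1 - (d n').1 q) else 1.
pose sum := fix sum n q : R := if n is n'.+1 then sum n' q + (if (d n').2 then rem n' q * (d n').1 q else 0) else 0.
have sd n : smooth A (d n).1 by have [[]] := dP n.
have srem n : smooth A (rem n).
  elim: n => [|n IHn] phi Aphi; first exact: smooth_cst.
  have oU := @open_cimg _ _ phi.
  apply: (smooth_mul oU (IHn _ Aphi)); apply: (smooth_subr oU (smooth_cst _ _)); exact: sd.
have ssum n : smooth A (sum n).
  elim: n => [|n IHn] phi Aphi; first exact: smooth_cst.
  have oU := @open_cimg _ _ phi.
  apply: (smooth_add oU (IHn _ Aphi)); case: (d n).2; last exact: smooth_cst.
  by apply: (smooth_mul oU (srem _ _ Aphi)); exact: sd.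
have rem0 m q n : (d m).1 q = 1 -> (m < n)%N -> rem n q = 0.
  move=> dm; elim: n => // n IHn; rewrite ltnS leq_eqVlt => /orP[/eqP <-|mn] /=.
    by rewrite dm subrr mulr0.
  by rewrite IHn// mul0r.
have stable m q n : (d m).1 q = 1 -> (m < n)%N -> sum n q = sum m.+1 q.
  move=> dm; elim: n => // n IHn; rewrite ltnS leq_eqVlt => /orP[/eqP <-//|mn].
  rewrite [LHS]/= (rem0 _ _ _ dm mn) mul0r if_same addr0; exact: IHn.
have /choice[m mP] := covered.
pose g q := sum (m q).+1 q.
have gE k q : (d k).1 q = 1 -> g q = sum k.+1 q.
  move=> dk; have dm : (d (m q)).1 q = 1 by exact: nbhs_singleton (mP q).
  rewrite /g; have [mk|mk] := leqP (m q) k.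
    by rewrite (stable _ _ k.+1 dm).
  by rewrite -(stable _ _ (m q).+1 dk)// ltnS ltnW.
exists g; split.
- move=> phi Aphi; apply: smooth_local => u Uu; set k := m (cinv phi u).
  exists [set v | cimg phi v /\ (interior [set q | (d k).1 q = 1]) (cinv phi v)]; split.
  - by apply: open_cinv_preimage; exact: open_interior.
  - by split=> //; exact: mP.
  - apply: (@smooth_ext _ _ _ (sum k.+1 \o cinv phi)).
    + by apply: open_cinv_preimage; exact: open_interior.
    + by move=> v [_ /interior_subset dv] /=; rewrite (gE k).
    + by apply: smooth_sub (ssum k.+1 _ Aphi) => v [].
- move=> q nO; rewrite /g; elim: (m q).+1 => //= n ->; rewrite add0r.
  have [[_ d0] _] := dP n; case: (d n) d0 => bn [] //= -> //; by rewrite mulr0.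
- move=> q nO; have dm : (d (m q)).1 q = 1 by exact: nbhs_singleton (mP q).
  have total n : sum n q = 1 - rem n q.
    elim: n => [|n /= ->]; first by rewrite subrr.
    have [[_ d0] _] := dP n; case: (d n) d0 => bn [] /=; first by move=> _; ring.
    by move=> -> //; ring.
  by rewrite /g total (rem0 _ _ _ dm)// subr0.
Qed.

End Separation.

(** * A double principal curvature *)

Section Cross.
Context {R : realType} {c : R}.
Hypothesis hc : c * c = 1.
Implicit Types (a b d : 'rV[R]_4).

Definition minor3 a b d (i j k : 'I_4) : R :=
  a 0 i * (b 0 j * d 0 k - b 0 k * d 0 j) - a 0 j * (b 0 i * d 0 k - b 0 k * d 0 i)
  + a 0 k * (b 0 i * d 0 j - b 0 j * d 0 i).

(** The vector product: <cross a b d, z> is the determinant of a, b, d, z. *)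
Definition cross3 a b d : 'rV[R]_4 :=
  \row_(j < 4) [:: minor3 a b d 1 2%:R 3%:R; c * minor3 a b d 0 2%:R 3%:R;
                - minor3 a b d 0 1 3%:R; minor3 a b d 0 1 2%:R]`_j.

Lemma cross3_dot a b d z : dot c (cross3 a b d) z =
  - (minor3 a b d 1 2%:R 3%:R * z 0 0) + minor3 a b d 0 2%:R 3%:R * z 0 1
  - minor3 a b d 0 1 3%:R * z 0 2%:R + minor3 a b d 0 1 2%:R * z 0 3%:R.
Proof.
rewrite dotE !mxE /=.
by apply: (lincomb (congr1 (fun y => y * (minor3 a b d 0 2%:R 3%:R * z 0 1)) hc)); ring.
Qed.

Lemma cross3_orth a b d : [/\ dot c (cross3 a b d) a = 0, dot c (cross3 a b d) b = 0 & dot c (cross3 a b d) d = 0].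
Proof.
by rewrite !cross3_dot /minor3; split;
 move: (a 0 0) (a 0 1) (a 0 2%:R) (a 0 3%:R) (b 0 0) (b 0 1) (b 0 2%:R) (b 0 3%:R)
   (d 0 0) (d 0 1) (d 0 2%:R) (d 0 3%:R) => *; ring.
Qed.

(** By the Cauchy-Binet formula for the Gram determinant of a, b, d. *)
Lemma cross3_norm a b d : dot c a b = 0 -> dot c a d = 0 -> dot c b d = 0 ->
  dot c (cross3 a b d) (cross3 a b d) = - (c * (dot c a a * dot c b b * dot c d d)).
Proof.
move=> ab ad bd.
have gram : dot c a a * (dot c b b * dot c d d - dot c b d * dot c b d)
   - dot c a b * (dot c a b * dot c d d - dot c b d * dot c a d)
   + dot c a d * (dot c a b * dot c b d - dot c b b * dot c a d)
   = c * (minor3 a b d 1 2%:R 3%:R * minor3 a b d 1 2%:R 3%:R)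
     - minor3 a b d 0 2%:R 3%:R * minor3 a b d 0 2%:R 3%:R
     - c * (minor3 a b d 0 1 3%:R * minor3 a b d 0 1 3%:R)
     - c * (minor3 a b d 0 1 2%:R * minor3 a b d 0 1 2%:R).
  rewrite !dotE /minor3.
  move: (a 0 0) (a 0 1) (a 0 2%:R) (a 0 3%:R) (b 0 0) (b 0 1) (b 0 2%:R) (b 0 3%:R)
   (d 0 0) (d 0 1) (d 0 2%:R) (d 0 3%:R) => *; ring.
rewrite cross3_dot !mxE /=.
move: gram; rewrite ab ad bd.
move: (minor3 _ _ _ 1 _ _) (minor3 _ _ _ 0 2%:R _) (minor3 _ _ _ 0 1 3%:R) (minor3 _ _ _ 0 1 2%:R)
  (dot c a a) (dot c b b) (dot c d d) => m0 m1 m2 m3 p q r gram.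
apply: (lincomb (congr2 (fun y z => c * y + z * (m0 * m0 - m2 * m2 - m3 * m3)) gram hc)).
by rewrite /=; ring.
Qed.

Lemma smooth_minor3 U (a b d : 'rV[R]_2 -> 'rV[R]_4) i j k : open U -> smooth_on U a -> smooth_on U b ->
  smooth_on U d -> smooth_on U (fun u => minor3 (a u) (b u) (d u) i j k).
Proof.
move=> oU sa sb sd; have ca i' := smooth_coord i' oU sa; have cb i' := smooth_coord i' oU sb.
have cd i' := smooth_coord i' oU sd.
have two i' j' : smooth_on U (fun u => b u 0 i' * d u 0 j' - b u 0 j' * d u 0 i').
  by apply: smooth_subr => //; apply: smooth_mul.
apply: smooth_add => //; first apply: smooth_subr => //; apply: smooth_mul => //; exact: two.
Qed.

Lemma smooth_cross3 U (a b d : 'rV[R]_2 -> 'rV[R]_4) : open U -> smooth_on U a -> smooth_on U b ->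
  smooth_on U d -> smooth_on U (fun u => cross3 (a u) (b u) (d u)).
Proof.
move=> oU sa sb sd; have sm i j k := smooth_minor3 i j k oU sa sb sd.
apply: smooth_rV => // j.
case: j => -[|[|[|[|//]]]] lt.
- by apply: smooth_ext oU _ (sm 1 2%:R 3%:R) => u _; rewrite mxE.
- apply: smooth_ext oU _ (smooth_mul oU (smooth_cst U c) (sm 0 2%:R 3%:R)) => u _; by rewrite mxE.
- by apply: smooth_ext oU _ (smooth_opp oU (sm 0 1 3%:R)) => u _; rewrite mxE.
- by apply: smooth_ext oU _ (sm 0 1 2%:R) => u _; rewrite mxE.
Qed.

End Cross.

Section PointFacts.
Context {R : realType}.
Local Notation E := 'rV[R]_2.
Context {c eps : R} {U : set E} {x n : E -> 'rV[R]_4}.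
Hypothesis H : immersed_patch c eps U x n.
Local Notation g := (fg c x).
Local Notation cof0 := (cof0 (c := c) (x := x)).
Local Notation cof1 := (cof1 (c := c) (x := x)).
Local Notation sff := (sff (c := c) (x := x) (n := n)).
Local Notation copair := (copair (c := c) (x := x)).
Local Notation null_pair := (null_pair (c := c) (U := U) (x := x) (n := n)).

Lemma tangent_indep (a0 a1 : R) u : U u -> a0 *: pd i0 x u + a1 *: pd i1 x u = 0 -> a0 = 0 /\ a1 = 0.
Proof.
move=> Uu e; have G0 := patch_G H Uu.
have e0 := congr1 (fun v => dot c v (pd i0 x u)) e; have e1 := congr1 (fun v => dot c v (pd i1 x u)) e.
rewrite /= !dot_lin -/(g i0 i0 u) -/(g i1 i0 u) (fgC i1 i0) in e0.
rewrite /= !dot_lin -/(g i0 i1 u) -/(g i1 i1 u) in e1.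
split; apply: (mulIf G0); rewrite mul0r /fG.
  by apply: (lincomb (congr2 (fun y z => g i1 i1 u * y - g i0 i1 u * z) e0 e1)); rewrite /=; ring.
by apply: (lincomb (congr2 (fun y z => g i0 i0 u * z - g i0 i1 u * y) e0 e1)); rewrite /=; ring.
Qed.

Lemma asymptotic_eigen (k : R) (B B' : E -> 'rV[R]_4) u :
  (forall u, U u -> ft c x n u = 2 * k) -> null_pair B B' -> U u ->
  sff B B u = 0 ->
  cof0 B u * fS0 c x n i0 u + cof1 B u * fS0 c x n i1 u = k * cof0 B u /\
  cof0 B u * fS1 c x n i0 u + cof1 B u * fS1 c x n i1 u = k * cof1 B u.
Proof.
move=> tk np Uu s0; have [tB _ _ _ _] := np.
have := dirv_n H tk np Uu; rewrite s0 mul0r scale0r addr0 -(dirv_x H tB Uu) /dirv !(weingarten H)//.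
move=> e.
have [|d0 d1] := @tangent_indep
  (cof0 B u * fS0 c x n i0 u + cof1 B u * fS0 c x n i1 u - k * cof0 B u)
  (cof0 B u * fS1 c x n i0 u + cof1 B u * fS1 c x n i1 u - k * cof1 B u) u Uu.
- apply/rowP => j; have := congr1 (fun v : 'rV[R]_4 => v 0 j) e; rewrite !mxE => ej.
  by apply: (lincomb (congr1 -%R ej)); ring.
- by split; apply/eqP; rewrite -subr_eq0; apply/eqP.
Qed.

Lemma sff_copair B u :
  sff B B u =
  - copair (dot c (pd i0 x u) (B u)) (dot c (pd i1 x u) (B u)) (dot c (pd i0 n u) (B u)) (dot c (pd i1 n u) (B u)) u.
Proof.
by rewrite /sff /dirv !dot_lin /cof0 /cof1 /copair ![dot c (B u) (pd _ x u)]dotC; ring.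
Qed.

Lemma definite_umbilic (k : R) i u : U u -> ft c x n u = 2 * k -> fh c x n u = k * k ->
  0 < g i0 i0 u -> 0 < fG c x u -> pd i n u = - k *: pd i x u.
Proof.
move=> Uu tE hE g0 Gp; have Gn := patch_G H Uu.
have et : fb c x n i1 i1 u * g i0 i0 u - 2 * fb c x n i0 i1 u * g i0 i1 u + fb c x n i0 i0 u * g i1 i1 u
    = 2 * k * (g i0 i0 u * g i1 i1 u - g i0 i1 u * g i0 i1 u).
  by move: tE; rewrite /ft => /(congr1 (fun z => z * fG c x u)); rewrite divfK.
have eh : fb c x n i0 i0 u * fb c x n i1 i1 u - fb c x n i0 i1 u * fb c x n i0 i1 u
    = k * k * (g i0 i0 u * g i1 i1 u - g i0 i1 u * g i0 i1 u).
  by move: hE; rewrite /fh => /(congr1 (fun z => z * fG c x u)); rewrite divfK.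
have [b00 b01 b11] := umbilic_definite g0 Gp et eh.
rewrite (weingarten H)// /fS0 /fS1 /fG in Gn *.
case: (ord2E i) => ->; rewrite ?(fbC H i1 i0 Uu) ?b00 b01 ?b11; apply/rowP => j; rewrite !mxE;
  move: (pd i0 x u 0 j) (pd i1 x u 0 j) (g i0 i0 u) (g i0 i1 u) (g i1 i1 u) Gn => *; by field.
Qed.

End PointFacts.

Section DoubleCurvature.
Context {R : realType} {M : topologicalType} {A : set (chart R M)} {c eps : R} {s : nat}.
Context {psi N : M -> 'rV[R]_4}.
Hypothesis hc : c = 1 \/ c = -1.
Hypothesis heps : eps = 1 \/ eps = -1.
Hypothesis hM : smooth_surface A.
Hypothesis hpsi : immersed_in_Mc A c psi s.
Hypothesis hN : unit_normal A c eps psi N.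
Local Notation E := 'rV[R]_2.
Implicit Types (phi chi : chart R M) (p : M).
Local Notation X phi := (psi \o cinv phi).
Local Notation Y phi := (N \o cinv phi).
Local Notation const_t := (constant_t (A := A) (c := c) (psi := psi) (N := N)).
Local Notation const_h := (constant_h (A := A) (c := c) (psi := psi) (N := N)).
Local Notation sffM F phi :=
  (sff (c := c) (x := X phi) (n := Y phi) (F \o cinv phi) (F \o cinv phi)).
Let patch phi := @patchP _ _ _ _ _ _ _ _ hc heps hpsi hN phi.
Let cov p : exists2 phi, A phi & cdom phi p.
Proof. by have [_ _ _ [cov _]] := hM; exact: cov. Qed.
Let spsi : smooth A psi. Proof. by have [] := hpsi. Qed.
Let sN : smooth A N. Proof. by have [] := hN. Qed.
Let hMc p : dot c (psi p) (psi p) = c.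
Proof. by rewrite dot.unlock; have [_ h _] := hpsi; exact: h. Qed.
Let Nx p : dot c (N p) (psi p) = 0.
Proof. by rewrite dot.unlock; have [_ _ h _] := hN; exact: h. Qed.
Let NN p : dot c (N p) (N p) = eps.
Proof. by rewrite dot.unlock; have [_ h _ _] := hN; exact: h. Qed.

Lemma smooth_linear (f f' : M -> R) (F F' : M -> 'rV[R]_4) : smooth A f -> smooth A f' ->
  smooth A F -> smooth A F' -> smooth A (fun p => f p *: F p + f' p *: F' p).
Proof.
move=> sf sf' sF sF' phi Aphi; have oU := @open_cimg _ _ phi; apply: smooth_rV => // j.
apply: smooth_ext (smooth_add oU (smooth_mul oU (sf _ Aphi) (smooth_coord j oU (sF _ Aphi)))
  (smooth_mul oU (sf' _ Aphi) (smooth_coord j oU (sF' _ Aphi)))) => // u _.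
by rewrite !mxE.
Qed.

Lemma smooth_dotM (F F' : M -> 'rV[R]_4) : smooth A F -> smooth A F' -> smooth A (fun p => dot c (F p) (F' p)).
Proof. by move=> sF sF' phi Aphi; apply: (smooth_dot c _ (sF _ Aphi) (sF' _ Aphi)); exact: open_cimg. Qed.

Lemma sff_agree (B : M -> 'rV[R]_4) phi chi p : A phi -> A chi -> cdom phi p -> cdom chi p ->
  sffM B phi (cmap phi p) =
  sffM B chi (cmap chi p).
Proof.
move=> Aphi Achi dp dq; have Up := cmap_cimg dp; have Uq := cmap_cimg dq.
have [T [D0 TP]] := forms_change hc heps hM hpsi hN Aphi Achi dp dq.
have [x0 n0 _ _] := TP i0; have [x1 n1 _ _] := TP i1.
rewrite !sff_copair// x0 x1 n0 n1 /= !cmapK// !dot_lin; congr (- _).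
apply: (@copair_change _ c _ _ _ _ T _ _ _ _ D0 (patch_G (patch Achi) Uq)) => i j.
by have [_ _ ->] := TP i.
Qed.

(** In the definite case a double principal curvature is umbilic, which the two-type
    condition excludes. *)
Lemma definite_double_curvature (k : R) : s = 0%N -> L1_2_type A c eps psi N ->
  const_t (2 * k) ->
  const_h (k * k) -> False.
Proof.
move=> s0 htype tc hcst; apply: (two_type_not_umbilic hc heps hM hpsi hN (k := k) htype tc hcst).
move=> phi u i Aphi Uu; have H := patch Aphi.
have [_ _ /(_ _ _ Aphi Uu)[_ ind]] := hpsi; rewrite s0 in ind.
have du : differentiable (X phi) u := smooth_differentiable (spsi Aphi) Uu.
apply: (definite_umbilic H i Uu (tc _ _ Aphi Uu) (hcst _ _ Aphi Uu)).
  by rewrite -first_formE//; exact: has_index0_pos.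
rewrite -det_first_formE//; have [d d0 dd] := has_index_det ind.
rewrite mulr1 in dd; have d2 : 0 < d * d by rewrite -expr2 exprn_even_gt0.
by rewrite -(pmulr_rgt0 _ d2) dd ltr01.
Qed.

Section Lorentzian.
Hypothesis s1 : s = 1%N.

(** The frame of the flat space made of the surface, N and psi has the signature of the
    flat metric. *)
Lemma lorentzian_eps p : eps = 1.
Proof.
have [phi Aphi dp] := cov p; have Uu := cmap_cimg dp; have H := patch Aphi.
case: heps => // e.
have [_ _ /(_ _ _ Aphi Uu)[_ ind]] := hpsi; rewrite s1 in ind.
have du : differentiable (X phi) (cmap phi p) := smooth_differentiable (spsi Aphi) Uu.
have [d d0] := has_index_det ind; rewrite det_first_formE//= => dd.
have := frame_sign H Uu; rewrite e mulrN1 => /oppr_inj GE.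
have : 0 <= d * d * fG c (X phi) (cmap phi p) by rewrite GE mulr_ge0 ?sqr_ge0// -expr2 sqr_ge0.
by rewrite dd (_ : (i0 < 1)%N)// (_ : (i1 < 1)%N = false)// mulr1 ler0N1.
Qed.

(** The constant field e_1 of the De Sitter space and the rotation field
    (-x_2, x_1, 0, 0) of the anti De Sitter space are timelike along the quadric, and
    stay so when projected to the tangent plane, since the normal is spacelike. *)
Lemma timelike_field : eps = 1 -> exists V : M -> 'rV[R]_4,
  [/\ smooth A V, forall p, dot c (V p) (N p) = 0, forall p, dot c (V p) (psi p) = 0 &
    forall p, dot c (V p) (V p) < 0].
Proof.
move=> e1.
have [T sT Tneg] : exists2 T : M -> 'rV[R]_4, smooth A T & forall p,
    dot c (T p) (T p) - dot c (T p) (N p) * dot c (T p) (N p) - c * (dot c (T p) (psi p) * dot c (T p) (psi p)) < 0.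
  case: hc => cE.
    exists (fun=> delta_mx 0 0); first by move=> phi _; exact: smooth_cst.
    move=> p; rewrite [dot c (delta_mx _ _) (delta_mx _ _)]dotE !mxE /= cE.
    have := sqr_ge0 (dot 1 (delta_mx 0 0) (N p)); have := sqr_ge0 (dot 1 (delta_mx 0 0) (psi p)).
    rewrite !expr2; lra.
  exists (fun p => \row_(j < 4) [:: - psi p 0 1; psi p 0 0; 0; 0]`_j).
    move=> phi Aphi; have oU := @open_cimg _ _ phi; apply: smooth_rV => // j.
    have sc j' := smooth_coord j' oU (spsi Aphi).
    case: j => -[|[|[|[|//]]]] lt.
    - by apply: smooth_ext oU _ (smooth_opp oU (sc 1)) => u _; rewrite mxE.
    - by apply: smooth_ext oU _ (sc 0) => u _; rewrite mxE.
    - by apply: smooth_ext oU _ (smooth_cst _ 0) => u _; rewrite mxE.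
    - by apply: smooth_ext oU _ (smooth_cst _ 0) => u _; rewrite mxE.
  move=> p; set T := \row_j _.
  have -> : dot c T (psi p) = 0 by rewrite dotE !mxE /= cE; ring.
  have := hMc p; rewrite [dot c T T]dotE dotE !mxE /= cE.
  have := sqr_ge0 (dot (-1) T (N p)); have := sqr_ge0 (psi p 0 2%:R); have := sqr_ge0 (psi p 0 3%:R).
  rewrite !expr2; lra.
pose V p := T p - dot c (T p) (N p) *: N p - (c * dot c (T p) (psi p)) *: psi p.
have cc : c * c = 1 by case: hc => ->; rewrite ?mulr1 ?mulrN1 ?opprK.
exists V; split.
- have sTN := smooth_dotM sT sN; have sTx := smooth_dotM sT spsi.
  move=> phi Aphi; have oU := @open_cimg _ _ phi; apply: smooth_rV => // j.
  apply: smooth_ext (smooth_subr oU (smooth_subr oU (smooth_coord j oU (sT _ Aphi))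
    (smooth_mul oU (sTN _ Aphi) (smooth_coord j oU (sN Aphi))))
    (smooth_mul oU (smooth_mul oU (smooth_cst _ c) (sTx _ Aphi)) (smooth_coord j oU (spsi Aphi)))) => // u _.
  by rewrite !mxE.
- by move=> p; rewrite /V !dot_lin NN e1 [dot c (psi p) _]dotC Nx; ring.
- move=> p; rewrite /V !dot_lin hMc Nx.
  by apply: (lincomb (congr1 (fun y => - dot c (T p) (psi p) * y) cc)); ring.
- move=> p; apply: le_lt_trans (Tneg p); rewrite le_eqVlt; apply/orP; left; apply/eqP.
  rewrite /V !dot_lin hMc NN e1 Nx [dot c (psi p) (N p)]dotC Nx [dot c (N p) (T p)]dotC [dot c (psi p) (T p)]dotC.
  by apply: (lincomb (congr1 (fun y => c * dot c (T p) (psi p) * dot c (T p) (psi p) * y) cc)); ring.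
Qed.

Definition null_fields (P Q : M -> 'rV[R]_4) := [/\ smooth A P, smooth A Q &
  forall phi, A phi -> null_pair (c := c) (U := cimg phi) (x := X phi) (n := Y phi) (P \o cinv phi) (Q \o cinv phi)].

(** A timelike tangent field V and its vector product W with N and psi are orthogonal and
    have opposite norms, so that V + W and V - W are null. *)
Lemma null_fields_exist : eps = 1 -> exists P Q, null_fields P Q.
Proof.
move=> e1; have [V [sV VN Vx Vneg]] := timelike_field e1.
have cc : c * c = 1 by case: hc => ->; rewrite ?mulr1 ?mulrN1 ?opprK.
pose W p := cross3 (c := c) (V p) (N p) (psi p).
have sW : smooth A W by move=> phi Aphi; apply: smooth_cross3; [exact: open_cimg|exact: sV|exact: sN|exact: spsi].
have WO p := cross3_orth cc (V p) (N p) (psi p).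
have WW p : dot c (W p) (W p) = - dot c (V p) (V p).
  rewrite /W cross3_norm// NN hMc e1.
  by apply: (lincomb (congr1 (fun y => - dot c (V p) (V p) * y) cc)); ring.
have one : smooth A (fun _ : M => 1 : R) by move=> phi _; exact: smooth_cst.
have mone : smooth A (fun _ : M => - 1 : R) by move=> phi _; exact: smooth_cst.
have WV p : dot c (W p) (V p) = 0 by have [] := WO p.
have WN p : dot c (W p) (N p) = 0 by have [] := WO p.
have Wx p : dot c (W p) (psi p) = 0 by have [] := WO p.
exists (fun p => 1 *: V p + 1 *: W p), (fun p => 1 *: V p + (-1) *: W p).
have sP := smooth_linear one one sV sW; have sQ := smooth_linear one mone sV sW.
clearbody W.
split=> // phi Aphi; split.
- split; [exact: sP|move=> u _ /=|move=> u _ /=].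
    by rewrite !dot_lin VN WN; ring.
  by rewrite !dot_lin Vx Wx; ring.
- split; [exact: sQ|move=> u _ /=|move=> u _ /=].
    by rewrite !dot_lin VN WN; ring.
  by rewrite !dot_lin Vx Wx; ring.
- by move=> u _ /=; rewrite !dot_lin [dot c (V _) (W _)]dotC WV WW; ring.
- by move=> u _ /=; rewrite !dot_lin [dot c (V _) (W _)]dotC WV WW; ring.
- move=> u _ /=; rewrite !dot_lin [dot c (V _) (W _)]dotC WV WW lt_eqF//.
  have := Vneg (cinv phi u); lra.
Qed.

(** Where both null fields are principal they can be interpolated, and elsewhere
    the same one of them is principal near the point: a smooth function separating
    the two regions picks a principal combination of them. *)
Lemma lorentzian_double_curvature (k : R) :
  const_t (2 * k) ->
  const_h (k * k) ->
  has_constant_principal_curvature A psi N.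
Proof.
move=> tc hcst.
have [[pt _]|noM] := pselect (exists pt : M, True); last first.
  by apply: (principal_field_empty hc heps hpsi hN) => p; apply: noM; exists p.
have [P [Q [sP sQ np]]] := null_fields_exist (lorentzian_eps pt).
pose asym (F : M -> 'rV[R]_4) p := forall phi, A phi -> cdom phi p ->
  sffM F phi (cmap phi p) = 0.
have near_asym F phi p : A phi -> cdom phi p ->
   (\forall v \near cmap phi p, sffM F phi v = 0) ->
   (interior [set q | asym F q]) p.
  move=> Aphi dp /nbhs_ballP[r /= r0 rB].
  have := @open_cmap_preimage _ _ phi (ball (cmap phi p) r) p (ball_open _ _) dp (ballxx _ r0).
  apply: filterS => q [dq Bq] chi Achi dq'.
  by rewrite -(sff_agree _ Aphi Achi dq dq'); exact: rB.
have alt p : (interior [set q | asym P q]) p \/ (interior [set q | asym Q q]) p.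
  have [phi Aphi dp] := cov p.
  have [nP|nQ] := null_alternative (patch Aphi) (fun u Uu => tc _ _ Aphi Uu) (fun u Uu => hcst _ _ Aphi Uu) (np _ Aphi) (cmap_cimg dp).
    by left; exact: near_asym Aphi dp nP.
  by right; exact: near_asym Aphi dp nQ.
have [hausM sc _ atA] := hM.
have [g [sg g0 g1]] := smooth_separation hausM sc atA (@open_interior _ _) (@open_interior _ _) alt.
have sg' : smooth A (fun p => 1 - g p).
  by move=> phi Aphi; apply: (smooth_subr _ (smooth_cst _ _) (sg _ Aphi)); exact: open_cimg.
pose Z p := g p *: P p + (1 - g p) *: Q p.
apply: (principal_field hc heps hpsi hN (V := Z) (k := k)).
- exact: smooth_linear.
- move=> p; have [phi Aphi dp] := cov p; have Uu := cmap_cimg dp.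
  have [_ _ nP nQ n0] := np _ Aphi.
  have := nP _ Uu; have := nQ _ Uu; have := n0 _ Uu; rewrite /= cmapK// => {}n0 {}nQ {}nP.
  apply/negP => /eqP Zp.
  have := congr1 (fun v => dot c v (Q p)) Zp; rewrite /Z /= !dot_lin nQ mulr0 addr0 => /eqP.
  rewrite mulf_eq0 (negbTE n0) orbF => /eqP gp.
  have := congr1 (fun v => dot c (P p) v) Zp; rewrite /Z /= gp !dot_lin nP => /eqP.
  by rewrite subr0 mul0r add0r mul1r (negbTE n0).
- move=> phi u Aphi Uu; have H := patch Aphi; have np' := np _ Aphi.
  have [tP' tQ' _ _ _] := np'; set q := cinv phi u.
  have dq : cdom phi q by exact: cinv_cdom.
  have uE : cmap phi q = u by exact: cinvK.
  pose f0 F := cof0 (c := c) (x := X phi) (F \o cinv phi) u.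
  pose f1 F := cof1 (c := c) (x := X phi) (F \o cinv phi) u.
  have xP : f0 P *: pd i0 (X phi) u + f1 P *: pd i1 (X phi) u = P q by exact: (dirv_x H tP' Uu).
  have xQ : f0 Q *: pd i0 (X phi) u + f1 Q *: pd i1 (X phi) u = Q q by exact: (dirv_x H tQ' Uu).
  have eP : g q = 0 \/ f0 P * fS0 c (X phi) (Y phi) i0 u + f1 P * fS0 c (X phi) (Y phi) i1 u = k * f0 P /\
     f0 P * fS1 c (X phi) (Y phi) i0 u + f1 P * fS1 c (X phi) (Y phi) i1 u = k * f1 P.
    have [/interior_subset aP|nP] := pselect ((interior [set r | asym P r]) q); last by left; exact: g0.
    right; apply: (asymptotic_eigen H (fun u Uu => tc _ _ Aphi Uu) np' Uu).
    by rewrite -uE; exact: aP.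
  have eQ : 1 - g q = 0 \/ f0 Q * fS0 c (X phi) (Y phi) i0 u + f1 Q * fS0 c (X phi) (Y phi) i1 u = k * f0 Q /\
     f0 Q * fS1 c (X phi) (Y phi) i0 u + f1 Q * fS1 c (X phi) (Y phi) i1 u = k * f1 Q.
    have [/interior_subset aQ|nQ] := pselect ((interior [set r | asym Q r]) q); last by left; rewrite g1// subrr.
    right; apply: (asymptotic_eigen H (fun u Uu => tc _ _ Aphi Uu) (null_pairC np') Uu).
    by rewrite -uE; exact: aQ.
  exists (g q * f0 P + (1 - g q) * f0 Q), (g q * f1 P + (1 - g q) * f1 Q).
  rewrite /Z -/q -xP -xQ; move: (g q) (1 - g q) (f0 P) (f1 P) (f0 Q) (f1 Q) eP eQ => a b p0 p1 q0 q1 eP eQ.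
  split.
  - by apply/rowP => j; rewrite !mxE; ring.
  - move: (fS0 c (X phi) (Y phi) i0 u) (fS0 c (X phi) (Y phi) i1 u) eP eQ => S0 S1 eP eQ.
    have e : a * (p0 * S0 + p1 * S1) + b * (q0 * S0 + q1 * S1) = a * (k * p0) + b * (k * q0).
      by case: eP => [->|[-> _]]; case: eQ => [->|[-> _]]; rewrite ?mul0r.
    by apply: (lincomb e); ring.
  - move: (fS1 c (X phi) (Y phi) i0 u) (fS1 c (X phi) (Y phi) i1 u) eP eQ => S0 S1 eP eQ.
    have e : a * (p0 * S0 + p1 * S1) + b * (q0 * S0 + q1 * S1) = a * (k * p1) + b * (k * q1).
      by case: eP => [->|[_ ->]]; case: eQ => [->|[_ ->]]; rewrite ?mul0r.
    by apply: (lincomb e); ring.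
Qed.

End Lorentzian.
(** If the discriminant of S is not zero it is the square of l1, so that the principal
    curvatures are (t0 + l1) / 2 and (t0 - l1) / 2; if it is zero, the index of the metric
    selects the case. *)
Lemma principal_of_constant (t0 h0 : R) : s = 0%N \/ s = 1%N -> L1_2_type A c eps psi N ->
  const_t t0 ->
  const_h h0 ->
  has_constant_principal_curvature A psi N.
Proof.
move=> hs htype tc hcst.
have [D0|D0] := eqVneq (t0 * t0 - 4 * h0) 0.
  have tE : t0 = 2 * (t0 / 2) by field.
  have hE : h0 = (t0 / 2) * (t0 / 2) by apply: (lincomb (congr1 (fun y => - y / 4) D0)); field.
  rewrite tE in tc; rewrite hE in hcst.
  case: hs => s01; last exact: lorentzian_double_curvature s01 _ tc hcst.
  by case: (definite_double_curvature s01 htype tc hcst).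
have [[p0 _]|noM] := pselect (exists p0 : M, True); last first.
  by apply: (principal_field_empty hc heps hpsi hN) => p; apply: noM; exists p.
have [phi Aphi dp] := cov p0; have Uu := cmap_cimg dp.
have [a [psi1 [psi2 [l1 [l2 typ]]]]] := two_type_charts htype.
have [s1 s2 xE e1 e2] := typ _ Aphi.
have D := discr_square (patch Aphi) s1 s2 xE e1 e2 (fun u Uu => tc _ _ Aphi Uu) (fun u Uu => hcst _ _ Aphi Uu) D0 Uu.
have l0 : l1 != 0 by apply: contra_neq D0 => l0; rewrite D l0 mulr0.
have tE : t0 = (t0 + l1) / 2 + (t0 - l1) / 2 by field.
have hE : h0 = (t0 + l1) / 2 * ((t0 - l1) / 2) by apply: (lincomb (congr1 (fun y => - y / 4) D)); field.
rewrite tE in tc; rewrite hE in hcst.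
apply: (distinct_curvatures_principal hc heps hM hpsi hN _ tc hcst).
apply: contra_neq l0 => e; apply: (lincomb e); by field.
Qed.

End DoubleCurvature.

(** * The equivalence *)

Theorem theoremA (R : realType) (c : R) (hc : c = 1 \/ c = -1)
    (M : topologicalType) (A : set (chart R M))
    (hM : smooth_surface A) (horient : orientable A)
    (s : nat) (hs : s = 0%N \/ s = 1%N)
    (psi : M -> 'rV[R]_4) (hpsi : immersed_in_Mc A c psi s)
    (eps : R) (heps : eps = 1 \/ eps = -1)
    (N : M -> 'rV[R]_4) (hN : unit_normal A c eps psi N)
    (htype : L1_2_type A c eps psi N) :
  (has_constant_principal_curvature A psi N
     <-> constant_mean_curvature A eps psi N) /\
  (constant_mean_curvature A eps psi N
     <-> constant_second_mean_curvature A psi N).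
Proof.
have i12 : has_constant_principal_curvature A psi N -> constant_mean_curvature A eps psi N.
  by move=> h; apply/(constant_mean_curvatureP hc heps hpsi hN); exact: t_of_eigenvalue hc heps hM hpsi hN htype h.
have i23 : constant_mean_curvature A eps psi N -> constant_second_mean_curvature A psi N.
  move=> /(constant_mean_curvatureP hc heps hpsi hN)[t0 tc].
  by apply/(constant_second_mean_curvatureP hc heps hpsi hN); exact: h_of_t hc heps hM hpsi hN htype _ tc.
have i32 : constant_second_mean_curvature A psi N -> constant_mean_curvature A eps psi N.
  move=> /(constant_second_mean_curvatureP hc heps hpsi hN)[h0 hcst].
  by apply/(constant_mean_curvatureP hc heps hpsi hN); exact: t_of_h hc heps hM hpsi hN htype _ hcst.
split; split=> // hH.
have [t0 tc] := (constant_mean_curvatureP hc heps hpsi hN).1 hH.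
have [h0 hcst] := (constant_second_mean_curvatureP hc heps hpsi hN).1 (i23 hH).
exact: principal_of_constant hc heps hM hpsi hN t0 h0 hs htype tc hcst.
Qed.
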